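(* Let $n\ge2$ be finite and let $P_V\subseteq G_n$ be the open set defined in the context. The spectrum $\sigma(\operatorname{rad}A(P_V))$ of the (Jacobson) radical of $A(P_V)$ is $\{(x,k,y)\in G_n\mid x\prec y\}$, where $\prec$ is the lexicographic order on $X$.
   Context: Fix a finite $n\ge 2$. $X=\prod_{1}^{\infty}\{1,\dots,n\}$ with the product topology. For a (possibly empty) finite string $\alpha$ in $\{1,\dots,n\}$, $\ell(\alpha)$ is its length, and $\alpha\gamma$ ($\gamma\in X$) is the concatenation. The Cuntz groupoid is $G_n=\{(\alpha\gamma,\ell(\alpha)-\ell(\beta),\beta\gamma)\mid \alpha,\beta \text{ finite strings},\ \gamma\in X\}$ with $(x,k,y)(y,j,z)=(x,k+j,z)$, $(x,k,y)^{-1}=(y,-k,x)$, and topology with basis the (compact open) sets $U_{\alpha,\beta}=\{(\alpha\gamma,\ell(\alpha)-\ell(\beta),\beta\gamma)\mid\gamma\in X\}$. The groupoid C*-algebra $C^*(G_n)$ is the completion of $C_c(G_n)$ (with convolution $f*g(x,k,y)=\sum f(x,k_1,z)g(z,k_2,y)$, the sum over $k_1+k_2=k$ and $z$ with both factors in $G_n$, and $f^*(x,k,y)=\overline{f(y,-k,x)}$) in the groupoid C*-norm. The Cuntz algebra $O_n$, generated by isometries $S_1,\dots,S_n$ with $\sum S_iS_i^*=I$, is identified with $C^*(G_n)$ so that $S_\alpha S_\beta^*$ (where $S_\alpha=S_{\alpha_1}\cdots S_{\alpha_k}$, $S_\emptyset=I$) corresponds to the characteristic function $\chi_{\alpha,\beta}$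 of $U_{\alpha,\beta}$. Since the sup norm is dominated by the C*-norm, elements of $C^*(G_n)$ are viewed as continuous functions on $G_n$ vanishing at infinity. For an open $P\subseteq G_n$, $A(P)=\{f\in C^*(G_n)\mid f \text{ vanishes on } G_n\setminus P\}$. $D_0=\{(x,0,x)\mid x\in X\}$. For an $A(D_0)$-bimodule $B\subseteq O_n$, its spectrum is $\sigma(B)=\{(x,k,y)\in G_n\mid f(x,k,y)\neq0\text{ for some }f\in B\}$. Definition of $P_V$ (orders $\prec,\preceq$ are lexicographic): an element of $G_n$ is in $P_V$ if it can be written $(\alpha\gamma,\ell(\alpha)-\ell(\beta),\beta\gamma)$ with $\alpha,\beta$ satisfying one of: (i) $\ell(\alpha)=\ell(\beta)$ and $\alpha\preceq\beta$; (ii) $\ell(\alpha)<\ell(\beta)$ and $\alpha\prec(\beta_1,\dots,\beta_{\ell(\alpha)})$; (iii) $\ell(\alpha)<\ell(\beta)$, $\alpha=(\beta_1,\dots,\beta_{\ell(\alpha)})$ and $\beta_{\ell(\alpha)+1}=\dots=\beta_{\ell(\beta)}=n$; (iv) $\ell(\alpha)>\ell(\beta)$ and $(\alpha_1,\dots,\alpha_{\ell(\beta)})\prec\beta$; (v) $\ell(\alpha)>\ell(\beta)$, $(\alpha_1,\dots,\alpha_{\ell(\beta)})=\beta$ and $\alpha_{\ell(\beta)+1}=\dots=\alpha_{\ell(\alpha)}=1$. Equivalently, $P_V$ is the union of $\{(x,k,y)\in G_n\mid x\prec y\}$ (lexicographic order on $X$), $\{(x,0,x)\mid x\in X\}$,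 $\{(x,k,x)\in G_n\mid k<0,\ x_j=n\text{ for all large }j\}$ and $\{(x,k,x)\in G_n\mid k>0,\ x_j=1\text{ for all large }j\}$. $P_V$ is open in $G_n$, and $A(P_V)$ is a norm closed subalgebra of $O_n$ containing $A(D_0)$. *)

(* Defs.v *)
From HB Require Import structures.
From mathcomp Require Import all_boot all_order all_algebra complex zify.
From mathcomp Require Import all_classical all_reals all_analysis.

Set Implicit Arguments.
Unset Strict Implicit.
Unset Printing Implicit Defensive.

Import Order.TTheory GRing.Theory Num.Theory.
Import numFieldNormedType.Exports.

Local Open Scope classical_set_scope.
Local Open Scope ring_scope.
Local Open Scope complex_scope.

(* The alphabet {1,...,n} is 'I_n, shifted by one: the letter 1 is the ordinal
   of value 0 and the letter n is the ordinal of value n - 1.                 *)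
Definition infword (n : nat) := nat -> 'I_n.

Definition wcat n (alpha : seq 'I_n) (gamma : infword n) : infword n :=
  fun i => nth (gamma (i - size alpha)%N) alpha i.

Definition infword_lt n (x y : infword n) : Prop :=
  exists m, (forall i, (i < m)%N -> x i = y i) /\ (x m < y m)%N.

Definition in_cuntz n (x : infword n) (k : int) (y : infword n) : Prop :=
  exists alpha beta gamma, [/\ x = wcat alpha gamma,
    k = (size alpha)%:Z - (size beta)%:Z & y = wcat beta gamma].

Record cuntz (n : nat) := Cuntz {
  grange : infword n;
  gdeg : int;
  gsource : infword n;
  cuntzP : in_cuntz grange gdeg gsource }.

HB.instance Definition _ n := gen_eqMixin (cuntz n).
HB.instance Definition _ n := gen_choiceMixin (cuntz n).

Definition gmul n (a b c : cuntz n) : Prop :=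
  [/\ gsource a = grange b, grange c = grange a,
      gdeg c = gdeg a + gdeg b & gsource c = gsource b].

Lemma in_cuntz_inv n (x : infword n) k y : in_cuntz x k y -> in_cuntz y (- k) x.
Proof.
move=> [a [b [c [-> -> ->]]]]; exists b, a, c; split=> //.
by rewrite opprB.
Qed.

Definition ginv n (a : cuntz n) : cuntz n := Cuntz (in_cuntz_inv (cuntzP a)).

Definition cyl n (ab : seq 'I_n * seq 'I_n) : set (cuntz n) :=
  [set g | exists gamma, [/\ grange g = wcat ab.1 gamma,
    gdeg g = (size ab.1)%:Z - (size ab.2)%:Z & gsource g = wcat ab.2 gamma]].

Lemma cyl_cover n : \bigcup_(ab in [set: seq 'I_n * seq 'I_n]) cyl ab = setT.
Proof.
apply/seteqP; split=> // g _.
by have [a [b [c [? ? ?]]]] := cuntzP g; exists (a, b) => //; exists c.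
Qed.

Lemma wcatL n (a : seq 'I_n) c c' i : (i < size a)%N -> wcat a c i = wcat a c' i.
Proof. by move=> ?; apply: set_nth_default. Qed.

Lemma wcatR n (a : seq 'I_n) c i :
  (size a <= i)%N -> wcat a c i = c (i - size a)%N.
Proof. by move=> ?; rewrite /wcat nth_default. Qed.

Lemma cyl_nested n (i j : seq 'I_n * seq 'I_n) t :
  (size i.1 <= size j.1)%N -> cyl i t -> cyl j t -> cyl j `<=` cyl i.
Proof.
case: i j => [a b] [a' b'] /= le_aa [c [rt dt st]] [c' [rt' dt' st']] g.
move=> /= [z [rg dg sg]].
rewrite /= in rt dt st rt' dt' st' rg dg sg.
exists (fun k => grange g (k + size a)%N) => /=; split; last 2 first.
- lia.
- rewrite sg; apply/funext => k.
  have [ltk|lek] := ltnP k (size b).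
    rewrite (@wcatL _ b' z c'); last lia.
    by rewrite -st' st; exact: wcatL.
  rewrite [RHS]wcatR // rg.
  have [ltk'|lek'] := ltnP k (size b').
    rewrite (wcatL z c') // -st' st wcatR //.
    rewrite (wcatL z c'); last lia.
    rewrite -rt' rt wcatR; last lia.
    by congr c; lia.
  rewrite wcatR // wcatR; last lia.
  by congr z; lia.
- apply/funext => k.
  have [ltk|lek] := ltnP k (size a).
    rewrite rg (@wcatL _ a' z c'); last lia.
    by rewrite -rt' rt; exact: wcatL.
  by rewrite [RHS]wcatR // subnK.
Qed.

Lemma cyl_join n (i j : seq 'I_n * seq 'I_n) t :
  setT i -> setT j -> cyl i t -> cyl j t ->
  exists k, [/\ setT k, cyl k t & cyl k `<=` cyl i `&` cyl j].
Proof.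
move=> _ _ ti tj; have [le|/ltnW le] := leqP (size i.1) (size j.1).
- by exists j; split=> //; rewrite subsetI; split => //; exact: cyl_nested ti tj.
- by exists i; split=> //; rewrite subsetI; split => //; exact: cyl_nested tj ti.
Qed.

HB.instance Definition _ n := isPointed.Build (seq 'I_n) [::].

HB.instance Definition _ n :=
  isBaseTopological.Build (cuntz n) (@cyl_cover n) (@cyl_join n).

(* R[i]^o is the type of complex numbers with its usual topology. *)
Definition Cc (R : realType) n (f : cuntz n -> R[i]^o) : Prop :=
  continuous f /\ compact (closure [set g | f g != 0]).

Definition convolution (R : realType) n (f h : cuntz n -> R[i]^o) : cuntz n -> R[i]^o :=
  fun g => \sum_(p \in [set p : cuntz n * cuntz n | gmul p.1 p.2 g])
    (f p.1 * h p.2).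

Definition fstar (R : realType) n (f : cuntz n -> R[i]^o) : cuntz n -> R[i]^o :=
  fun g => conjc (f (ginv g)).

(* Norms of normed modules over R[i] take their values in R[i]. *)
Definition rnorm (R : realType) (V : normedModType R[i]) (v : V) : R :=
  complex.Re `|v|.

Definition Inorm (R : realType) n (f : cuntz n -> R[i]^o) : R :=
  Num.max
    (sup [set \sum_(g \in [set g | grange g = x]) rnorm (f g) | x in setT])
    (sup [set \sum_(g \in [set g | gsource g = x]) rnorm (f g) | x in setT]).

(* A Hilbert space is a Banach space over R[i] whose norm is induced by an
   inner product, taken linear in its first argument.                         *)
Record is_inner_product (R : realType) (H : normedModType R[i])
    (ip : H -> H -> R[i]) : Prop := {
  ip_linear : forall (c : R[i]) (x y z : H),
    ip (c *: x + y) z = c * ip x z + ip y z;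
  ip_conj : forall x y : H, ip y x = conjc (ip x y);
  ip_norm : forall x : H, ip x x = `|x| ^+ 2 }.

Record is_rep (R : realType) n (H : completeNormedModType R[i])
    (ip : H -> H -> R[i]) (L : (cuntz n -> R[i]^o) -> H -> H) : Prop := {
  rep_op : forall f, Cc f -> linear (L f);
  rep_linear : forall (c : R[i]^o) f h xi, Cc f -> Cc h ->
    L (fun g => c * f g + h g) xi = c *: L f xi + L h xi;
  rep_conv : forall f h xi, Cc f -> Cc h -> L (convolution f h) xi = L f (L h xi);
  rep_star : forall f xi eta, Cc f -> ip (L f xi) eta = ip xi (L (fstar f) eta);
  rep_bounded : forall f xi, Cc f -> rnorm (L f xi) <= Inorm f * rnorm xi }.

Definition opnorm (R : realType) (H : normedModType R[i]) (T : H -> H) : R :=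
  sup [set rnorm (T xi) | xi in [set xi : H | rnorm xi <= 1]].

Definition groupoid_norm (R : realType) n (f : cuntz n -> R[i]^o) : R :=
  sup [set r : R | exists (H : completeNormedModType R[i])
      (ip : H -> H -> R[i]) (L : (cuntz n -> R[i]^o) -> H -> H),
    [/\ is_inner_product ip, is_rep ip L & r = opnorm (L f)]].

Record cstarAlg (R : realType) := CStarAlg {
  cstar_sort :> completeNormedModType R[i];
  cmul : cstar_sort -> cstar_sort -> cstar_sort;
  cadj : cstar_sort -> cstar_sort;
  cmulA : forall a b c, cmul a (cmul b c) = cmul (cmul a b) c;
  cmul_linearl : forall (z : R[i]) a b c,
    cmul (z *: a + b) c = z *: cmul a c + cmul b c;
  cmul_linearr : forall (z : R[i]) a b c,
    cmul a (z *: b + c) = z *: cmul a b + cmul a c;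
  cmul_norm : forall a b, `|cmul a b| <= `|a| * `|b|;
  cadj_linear : forall (z : R[i]) a b,
    cadj (z *: a + b) = conjc z *: cadj a + cadj b;
  cadj_mul : forall a b, cadj (cmul a b) = cmul (cadj b) (cadj a);
  cadjK : forall a, cadj (cadj a) = a;
  cstar_identity : forall a, `|cmul (cadj a) a| = `|a| ^+ 2 }.

(* (A, iota) is C^*(G_n): a completion of the *-algebra C_c(G_n) in the
   groupoid C*-norm. Such a pair is unique up to a unique isometric
   *-isomorphism. Only the values of iota on C_c(G_n) are meaningful.         *)
Record is_groupoid_cstar (R : realType) n (A : cstarAlg R)
    (iota : (cuntz n -> R[i]^o) -> A) : Prop := {
  iota_linear : forall (c : R[i]^o) f h, Cc f -> Cc h ->
    iota (fun g => c * f g + h g) = c *: iota f + iota h;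
  iota_conv : forall f h, Cc f -> Cc h ->
    iota (convolution f h) = cmul (iota f) (iota h);
  iota_star : forall f, Cc f -> iota (fstar f) = cadj (iota f);
  iota_norm : forall f, Cc f -> rnorm (iota f) = groupoid_norm f;
  iota_dense : dense (iota @` [set f | Cc f]) }.

(* An element a of C^*(G_n) viewed as a function: since the uniform norm is
   dominated by the C*-norm, functions f_m in C_c(G_n) with iota f_m --> a
   converge uniformly, to a limit depending on a only.                        *)
Definition as_fun (R : realType) n (A : cstarAlg R)
    (iota : (cuntz n -> R[i]^o) -> A) (a : A) : cuntz n -> R[i]^o :=
  xget (fun=> 0) [set F : cuntz n -> R[i]^o |
    exists u : nat -> cuntz n -> R[i]^o,
      [/\ forall m, Cc (u m), iota (u m) @[m --> \oo] --> a
        & {uniform, u @ \oo --> F}]].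

Definition A_of (R : realType) n (A : cstarAlg R)
    (iota : (cuntz n -> R[i]^o) -> A) (P : set (cuntz n)) : set A :=
  [set a | forall g, ~ P g -> as_fun iota a g = 0].

Definition spectrum (R : realType) n (A : cstarAlg R)
    (iota : (cuntz n -> R[i]^o) -> A) (B : set A) : set (cuntz n) :=
  [set g | exists2 f, B f & as_fun iota f g != 0].

Definition left_ideal (R : realType) (A : cstarAlg R) (B I : set A) : Prop :=
  [/\ I `<=` B, I 0, (forall x y, I x -> I y -> I (x - y))
    & forall b x, B b -> I x -> I (cmul b x)].

Definition maximal_left_ideal (R : realType) (A : cstarAlg R) (B M : set A) :=
  [/\ left_ideal B M, M <> B
    & forall I, left_ideal B I -> M `<=` I -> I = M \/ I = B].

(* For B a subalgebra with a unit; no regularity (modularity) condition is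
   then needed on the ideals.                                                 *)
Definition jacobson_radical (R : realType) (A : cstarAlg R) (B : set A) : set A :=
  [set a | B a /\ forall M, maximal_left_ideal B M -> M a].

(* seqlexi 'I_n is seq 'I_n with the lexicographic order; below it is only
   used between words of the same length.                                     *)
Definition PV_words n (alpha beta : seq 'I_n) : Prop :=
  let lt (a b : seqlexi 'I_n) := (a < b)%O in
  let le (a b : seqlexi 'I_n) := (a <= b)%O in
  let la := size alpha in let lb := size beta in
  [\/ la = lb /\ le alpha beta
   ,  (la < lb)%N /\ lt alpha (take la beta)
   ,  [/\ (la < lb)%N, alpha = take la beta
        & all (fun b : 'I_n => b.+1 == n) (drop la beta)]
   |  (lb < la)%N /\ lt (take lb alpha) beta \/
      [/\ (lb < la)%N, take lb alpha = beta
        & all (fun a : 'I_n => a == 0%N :> nat) (drop lb alpha)]].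

Definition PV n : set (cuntz n) :=
  [set g | exists alpha beta, PV_words alpha beta /\ cyl (alpha, beta) g].

(* Main.v *)
(** Elements of C*(G_n) are determined by the functions they define on G_n: the
    regular representation on l2(Z x X) is isometric. For a function f of
    degree 0 the I-norm of the powers of f^* f is at most a fixed constant times
    their uniform norm, hence times the regular norm, and high powers remove
    the constant through the C*-identity; a general f has only finitely many
    homogeneous parts, and the number of parts of its powers grows linearly.

    If (x,k,y) has x < y, choose words alpha, beta longer than the first
    difference of x and y with (x,k,y) in U_{alpha,beta}. No element of P_V goes
    from beta X to alpha X, so chi b chi = 0 for chi the characteristic function
    of U_{alpha,beta} and all b in A(P_V); hence chi lies in the radical.

    Conversely an element of P_V outside {x < y} is some (x,k,x). All degrees k
    with (x,k,x) in P_V have the same sign s, since x cannot end both in 1's and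
    in n's. So a |-> sum_k a(x, s k, x) w^k is a multiplicative functional on
    A(P_V) for small w > 0, and its kernel is a maximal left ideal. An
    element of the radical is killed by all these functionals, so all its
    coefficients a(x, s k, x) vanish. *)

From HB Require Import structures.
Require Import Defs.
From mathcomp Require Import all_boot all_order all_algebra complex.
From mathcomp Require Import finmap ring lra zify.
From mathcomp Require Import all_classical all_reals all_analysis summability.

Set Implicit Arguments.
Unset Strict Implicit.
Unset Printing Implicit Defensive.

Import Order.TTheory GRing.Theory Num.Theory.
Import numFieldNormedType.Exports.

Local Open Scope classical_set_scope.
Local Open Scope ring_scope.
Local Open Scope complex_scope.

(** The groupoid norm is a supremum over all representations, whereas [as_fun] sees only values at
    points. Identities between products, such as [cmul f (cmul b f) = 0] or the unit laws, are
    checked on values, so they rest on the injectivity of [as_fun]; in general theory this is the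
    amenability of G_n. The coordinate in Z of l2(Z x X) separates degrees: homogeneous parts act
    between orthogonal levels, so cutting a function down to one degree does not increase its bound.
    The estimates are made for locally constant functions, which are dense and stable under
    convolution, adjoint and truncation, with explicit control of supports.

    The value of a product of two general elements at a point is an infinite sum. Only points with
    finitely many intermediate points are used: none for chi b chi, one for the unit, and those of
    degrees s j with j <= k over (x, s k, x), since x <= z <= x forces z = x.

    The functionals need no continuity: a nonzero multiplicative functional has a kernel of
    codimension one. Their series converge because every coefficient is bounded by the norm. *)

Local Notation Re := complex.Re.
Local Notation Im := complex.Im.

#[local] Existing Instance totally_filter.

(** * Real-valued norms on complex normed modules *)

Section rnorm.
Context {R : realType}.
Implicit Types V : normedModType R[i].

Lemma rnormE V (v : V) : `|v| = (rnorm v)%:C.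
Proof. by rewrite /rnorm RRe_real// ger0_real. Qed.

Lemma rnorm_ge0 V (v : V) : 0 <= rnorm v.
Proof. by rewrite -lecR -rnormE normr_ge0. Qed.

Lemma rnorm0 V : rnorm (0 : V) = 0.
Proof. by rewrite /rnorm normr0. Qed.

Lemma rnorm_eq0 V (v : V) : rnorm v = 0 -> v = 0.
Proof. by move=> v0; apply/eqP; rewrite -normr_eq0 rnormE v0. Qed.

Lemma ler_rnormD V (u v : V) : rnorm (u + v) <= rnorm u + rnorm v.
Proof. by rewrite -lecR rmorphD /= -!rnormE ler_normD. Qed.

Lemma rnormN V (v : V) : rnorm (- v) = rnorm v.
Proof. by rewrite /rnorm normrN. Qed.

Lemma rnormB V (u v : V) : rnorm (u - v) = rnorm (v - u).
Proof. by rewrite -rnormN opprB. Qed.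

Lemma ler_rnormB V (u v : V) : rnorm (u - v) <= rnorm u + rnorm v.
Proof. by rewrite -(rnormN v) ler_rnormD. Qed.

Lemma rnorm_sub V (u v : V) : rnorm u - rnorm v <= rnorm (u - v).
Proof. by rewrite lerBlDr -{1}(subrK v u) ler_rnormD. Qed.

Lemma ler_rnorm_sum V (I : Type) (r : seq I) (F : I -> V) :
  rnorm (\sum_(i <- r) F i) <= \sum_(i <- r) rnorm (F i).
Proof.
elim/big_rec2: _ => [|i x y _ H]; first by rewrite rnorm0.
by rewrite (le_trans (ler_rnormD _ _))// lerD2l.
Qed.

Lemma rnormZ V (c : R[i]) (v : V) : rnorm (c *: v) = rnorm (c : R[i]^o) * rnorm v.
Proof.
by apply: (@complexI R); rewrite rmorphM /= -!rnormE normrZ.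
Qed.

Lemma rnorm_cvgP V (T : Type) (F : set_system T) (FF : Filter F) (f : T -> V) (l : V) :
  (f @ F --> l) <-> (forall e : R, 0 < e -> \forall x \near F, rnorm (l - f x) <= e).
Proof.
split=> [/cvgrPdist_le fl e e0|H].
  have /fl : 0 < e%:C by rewrite ltcR.
  by apply: filterS => x; rewrite rnormE lecR.
apply/cvgrPdist_le => e e0; have eE : e = (Re e)%:C by rewrite RRe_real// gtr0_real.
have /H : 0 < Re e by rewrite -ltcR -eE.
by apply: filterS => x; rewrite rnormE eE lecR.
Qed.

Lemma rnorm_seqP V (f : nat -> V) (l : V) :
  (f @ \oo --> l) <->
  (forall e : R, 0 < e -> exists N, forall m, (N <= m)%N -> rnorm (l - f m) <= e).
Proof.
split=> [/rnorm_cvgP fl e e0|H].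
  by have [N _ HN] := fl e e0; exists N => m Nm; exact: HN.
apply/rnorm_cvgP => e /H [N HN]; exists N => // m /= Nm; exact: HN.
Qed.

End rnorm.

Notation cabs z := (@rnorm _ (_[i]^o) z).

Fact nsq_key : unit. Proof. exact: tt. Qed.

(* Locked: otherwise unification unfolds it and splits sums of squares. *)
Definition nsq (R : realType) (z : R[i]) : R :=
  locked_with nsq_key (Re z ^+ 2 + Im z ^+ 2).

Section cabs.
Context {R : realType}.
Implicit Types z w : R[i].

Lemma nsqReIm z : nsq z = Re z ^+ 2 + Im z ^+ 2.
Proof. by rewrite /nsq unlock. Qed.

Lemma nsqE z : nsq z = cabs z ^+ 2.
Proof.
apply: (@complexI R); rewrite nsqReIm add_Re2_Im2 rmorphXn /= -rnormE.
by [].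
Qed.

Lemma nsq_ge0 z : 0 <= nsq z.
Proof. by rewrite nsqReIm addr_ge0// sqr_ge0. Qed.

Lemma nsq0 : nsq (0 : R[i]) = 0.
Proof. by rewrite nsqReIm /= expr0n /= addr0. Qed.

Lemma cabsM z w : cabs (z * w) = cabs z * cabs w.
Proof. exact: (rnormZ z (w : R[i]^o)). Qed.

Lemma cabs1 : cabs (1 : R[i]) = 1.
Proof. by rewrite /rnorm normr1. Qed.

Lemma cabsX z k : cabs (z ^+ k) = cabs z ^+ k.
Proof. by elim: k => [|k IH]; rewrite ?expr0 ?cabs1// !exprS cabsM IH. Qed.

Lemma cabsJ z : cabs (conjc z) = cabs z.
Proof. by rewrite /rnorm; congr Re; rewrite normcJ. Qed.

Lemma cabsR (x : R) : 0 <= x -> cabs (x%:C) = x.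
Proof. by move=> x0; rewrite /rnorm ger0_norm// ler0c. Qed.

Lemma nsqM z w : nsq (z * w) = nsq z * nsq w.
Proof. by rewrite !nsqE cabsM exprMn. Qed.

Lemma nsqJ z : nsq (conjc z) = nsq z.
Proof. by rewrite !nsqE cabsJ. Qed.

Lemma nsqN z : nsq (- z) = nsq z.
Proof. by rewrite !nsqE rnormN. Qed.

Lemma nsqD_le z w : nsq (z + w) <= 2 * nsq z + 2 * nsq w.
Proof. case: z w => [a b] [c d]; rewrite !nsqReIm /=.
have := sqr_ge0 (a - c); have := sqr_ge0 (b - d); lra. Qed.

Lemma nsq_eq0 z : nsq z = 0 -> z = 0.
Proof.
by rewrite nsqE => /eqP; rewrite expf_eq0 /= => /eqP/(@rnorm_eq0 _ R[i]^o).
Qed.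

Lemma conjcM z w : conjc (z * w) = conjc z * conjc w.
Proof. exact: rmorphM. Qed.

Lemma mulJ_nsq z : z * conjc z = (nsq z)%:C.
Proof. by rewrite -sqr_normc nsqReIm add_Re2_Im2. Qed.

End cabs.

(** * Finite Cauchy-Schwarz and Minkowski inequalities *)

Section cauchy_schwarz.
Context {R : realType} {I : Type}.

Lemma cauchy_schwarz_sum (s : seq I) (a b : I -> R) :
  (\sum_(i <- s) a i * b i) ^+ 2 <= (\sum_(i <- s) a i ^+ 2) * (\sum_(i <- s) b i ^+ 2).
Proof.
elim: s => [|i s IH]; first by rewrite !big_nil expr0n mulr0.
rewrite !big_cons.
set X := \sum_(_ <- _) _ in IH *; set A := \sum_(_ <- _) _ in IH *.
set B := \sum_(_ <- _) _ in IH *.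
have A0 : 0 <= A by apply: sumr_ge0 => *; rewrite sqr_ge0.
have B0 : 0 <= B by apply: sumr_ge0 => *; rewrite sqr_ge0.
(* The cross term of the new summand. By the induction hypothesis X^2 <= A B this is the inequality
   between arithmetic and geometric means, proved by comparing squares. *)
have key : 2 * (a i * b i) * X <= a i ^+ 2 * B + b i ^+ 2 * A.
  have h : (2 * (a i * b i) * X) ^+ 2 <= (a i ^+ 2 * B + b i ^+ 2 * A) ^+ 2.
    have : 4 * (a i * b i) ^+ 2 * X ^+ 2 <= 4 * (a i * b i) ^+ 2 * (A * B).
      by rewrite ler_wpM2l// mulr_ge0// sqr_ge0.
    have := sqr_ge0 (a i ^+ 2 * B - b i ^+ 2 * A).
    nra.
  have h0 : 0 <= a i ^+ 2 * B + b i ^+ 2 * A by rewrite addr_ge0// mulr_ge0// sqr_ge0.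
  by apply: le_trans (ler_norm _) _; rewrite -ler_sqr ?nnegrE// real_normK// num_real.
nra.
Qed.

Lemma cauchy_schwarz_cabs (s : seq I) (a b : I -> R[i]) :
  nsq (\sum_(i <- s) a i * b i) <=
    (\sum_(i <- s) nsq (a i)) * (\sum_(i <- s) nsq (b i)).
Proof.
have := cauchy_schwarz_sum s (fun i => cabs (a i)) (fun i => cabs (b i)).
under eq_bigr do rewrite -cabsM.
under [in X in _ <= X -> _]eq_bigr do rewrite -nsqE.
under [in X in _ <= _ * X -> _]eq_bigr do rewrite -nsqE.
apply: le_trans; rewrite nsqE ler_sqr ?nnegrE ?rnorm_ge0//; last first.
  by apply: sumr_ge0 => *; exact: rnorm_ge0.
exact: ler_rnorm_sum.
Qed.

Lemma minkowski_nsq (s : seq I) (a b : I -> R[i]) (A B : R) : 0 <= A -> 0 <= B ->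
  \sum_(i <- s) nsq (a i) <= A ^+ 2 -> \sum_(i <- s) nsq (b i) <= B ^+ 2 ->
  \sum_(i <- s) nsq (a i + b i) <= (A + B) ^+ 2.
Proof.
move=> A0 B0 hA hB.
have : \sum_(i <- s) nsq (a i + b i) <=
    \sum_(i <- s) (nsq (a i) + nsq (b i) + 2 * (cabs (a i) * cabs (b i))).
  apply: ler_sum => i _; rewrite !nsqE.
  have := @ler_rnormD _ R[i]^o (a i) (b i).
  have := @rnorm_ge0 _ R[i]^o (a i + b i); nra.
rewrite !big_split /= -mulr_sumr => /le_trans; apply.
set X := \sum_(_ <- _) (_ * _).
have X0 : 0 <= X by apply: sumr_ge0 => *; rewrite mulr_ge0// rnorm_ge0.
have : X <= A * B.
  rewrite -ler_sqr ?nnegrE ?mulr_ge0//.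
  apply: le_trans (cauchy_schwarz_sum _ _ _) _.
  rewrite exprMn; apply: ler_pM; rewrite ?sumr_ge0// => *; rewrite ?sqr_ge0//.
    by under eq_bigr do rewrite -nsqE.
  by under eq_bigr do rewrite -nsqE.
move: hA hB; set P := \sum_(_ <- _) _; set Q := \sum_(_ <- _) _ => hA hB hX.
have -> : (A + B) ^+ 2 = A ^+ 2 + B ^+ 2 + 2 * (A * B) by ring.
by apply: lerD; [exact: lerD|rewrite ler_wpM2l].
Qed.
End cauchy_schwarz.

(** * The Hilbert space l2(I) *)

Section l2.
Context {R : realType} {I : choiceType}.
Implicit Types x y : I -> R[i]^o.

Definition ssq x (s : {fset I}) : R := \sum_(i <- s) nsq (x i).

Lemma ssq_ge0 x s : 0 <= ssq x s.
Proof. by apply: sumr_ge0 => *; exact: nsq_ge0. Qed.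

Lemma ssq_mono x (s t : {fset I}) : (s `<=` t)%fset -> ssq x s <= ssq x t.
Proof.
move=> st; rewrite /ssq.
rewrite (big_fsetID _ (mem s) t)/=.
rewrite (_ : [fset z in t | z \in s]%fset = s) ?lerDl ?sumr_ge0// => *; rewrite ?nsq_ge0//.
apply/fsetP => z; rewrite !inE /=; case zs : (z \in s); rewrite ?andbF// andbT.
exact: (fsubsetP st).
Qed.

(** Square summability over an arbitrary index set, stated through bounded finite partial sums; no
    enumeration or countability of I is involved. *)
Definition l2pred : {pred I -> R[i]^o} :=
  fun x => `[< exists C : R, forall s, ssq x s <= C >].

Lemma l2pred_submod : submod_closed l2pred.
Proof.
split=> [|c x y /asboolP[C hC] /asboolP[D hD]]; apply/asboolP.
  by exists 0 => s; rewrite /ssq big1// => i _; rewrite nsq0.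
exists (2 * (nsq c * C) + 2 * D) => s.
have -> : ssq (c *: x + y) s = \sum_(i <- s) nsq (c * x i + y i) by [].
apply: le_trans (_ : \sum_(i <- s) (2 * (nsq c * nsq (x i)) + 2 * nsq (y i)) <= _).
  by apply: ler_sum => i _; rewrite -nsqM nsqD_le.
rewrite big_split /= -!mulr_sumr.
by apply: lerD; rewrite ler_wpM2l//; [rewrite ler_wpM2l ?nsq_ge0//; exact: hC|exact: hD].
Qed.

HB.instance Definition _ := GRing.isSubmodClosed.Build _ _ l2pred l2pred_submod.

Record l2 := L2 { l2val :> I -> R[i]^o; l2valP : l2val \in l2pred }.

HB.instance Definition _ := [isSub for l2val].
HB.instance Definition _ := [Choice of l2 by <:].
HB.instance Definition _ := [SubChoice_isSubLmodule of l2 by <:].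

Lemma l2D (u v : l2) i : (u + v) i = u i + v i. Proof. by []. Qed.
Lemma l2B (u v : l2) i : (u - v) i = u i - v i. Proof. by []. Qed.
Lemma l2Z c (u : l2) i : (c *: u) i = c * u i. Proof. by []. Qed.
Lemma l2_ext (u v : l2) : (forall i, u i = v i) -> u = v.
Proof. by move=> uv; apply: val_inj; apply/funext. Qed.

Definition l2nrm (u : l2) : R := Num.sqrt (sup [set ssq u s | s in [set: {fset I}]]).

Lemma l2_ubound (u : l2) : has_ubound [set ssq u s | s in [set: {fset I}]].
Proof.
have /asboolP[C hC] := l2valP u.
by exists C => _ [s _ <-].
Qed.

Lemma l2nrm_ge0 u : 0 <= l2nrm u. Proof. exact: sqrtr_ge0. Qed.

Lemma l2nrm_sqr u : l2nrm u ^+ 2 = sup [set ssq u s | s in [set: {fset I}]].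
Proof.
rewrite sqr_sqrtr// (le_trans (ssq_ge0 u fset0))//.
by apply: ub_le_sup; [exact: l2_ubound|exists fset0].
Qed.

Lemma ssq_le (u : l2) s : ssq u s <= l2nrm u ^+ 2.
Proof.
by rewrite l2nrm_sqr; apply: ub_le_sup; [exact: l2_ubound|exists s].
Qed.

Lemma l2nrm_sqr_le (u : l2) C : (forall s, ssq u s <= C) -> l2nrm u ^+ 2 <= C.
Proof.
move=> hC; rewrite l2nrm_sqr.
by apply: ge_sup; [exists (ssq u fset0), fset0|move=> _ [s _ <-]].
Qed.

Lemma l2nrm_le (u : l2) C : 0 <= C -> (forall s, ssq u s <= C ^+ 2) -> l2nrm u <= C.
Proof.
by move=> C0 /l2nrm_sqr_le; rewrite ler_sqr ?nnegrE// l2nrm_ge0.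
Qed.

Lemma ler_l2nrmD u v : l2nrm (u + v) <= l2nrm u + l2nrm v.
Proof.
apply: l2nrm_le => [|s]; first by rewrite addr_ge0 ?l2nrm_ge0.
by apply: minkowski_nsq; rewrite ?l2nrm_ge0//; exact: ssq_le.
Qed.

Lemma ssqZ c x s : ssq (c *: x) s = nsq c * ssq x s.
Proof. by rewrite /ssq mulr_sumr; apply: eq_bigr => i _; rewrite -nsqM. Qed.

Lemma l2nrmZ_le c u : l2nrm (c *: u) <= cabs c * l2nrm u.
Proof.
apply: l2nrm_le => [|s]; first by rewrite mulr_ge0 ?l2nrm_ge0 ?rnorm_ge0.
by rewrite ssqZ exprMn -nsqE ler_wpM2l ?nsq_ge0 ?ssq_le.
Qed.

Lemma l2nrmZ c u : l2nrm (c *: u) = cabs c * l2nrm u.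
Proof.
apply/le_anti; rewrite l2nrmZ_le/=.
have [->|c0] := eqVneq c 0; first by rewrite rnorm0 mul0r l2nrm_ge0.
have := l2nrmZ_le c^-1 (c *: u); rewrite scalerA mulVf// scale1r => h.
apply: le_trans (ler_wpM2l (rnorm_ge0 (c : R[i]^o)) h) _.
by rewrite mulrA -cabsM divff// cabs1 mul1r.
Qed.

Lemma nsq_le_l2 (u : l2) i : nsq (u i) <= l2nrm u ^+ 2.
Proof. by apply: le_trans (ssq_le u [fset i]%fset); rewrite /ssq big_seq_fset1. Qed.

Lemma cabs_le_l2 (u : l2) i : cabs (u i) <= l2nrm u.
Proof.
by rewrite -ler_sqr ?nnegrE ?rnorm_ge0 ?l2nrm_ge0// -nsqE nsq_le_l2.
Qed.

Lemma l2nrm_eq0 u : l2nrm u = 0 -> u = 0.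
Proof.
move=> u0; apply: l2_ext => i; apply: nsq_eq0; apply/le_anti.
by rewrite nsq_ge0 (le_trans (nsq_le_l2 _ _))// u0 expr0n.
Qed.

Let nrm (u : l2) : R[i] := (l2nrm u)%:C.

Let nrmD u v : nrm (u + v) <= nrm u + nrm v.
Proof. by rewrite /nrm -rmorphD lecR ler_l2nrmD. Qed.

Let nrmZ c u : nrm (c *: u) = `|c| * nrm u.
Proof. by rewrite /nrm l2nrmZ rmorphM /= -rnormE. Qed.

Let nrm_eq0 u : nrm u = 0 -> u = 0.
Proof. by move=> /complexI; exact: l2nrm_eq0. Qed.

HB.instance Definition _ := Lmodule_isNormed.Build R[i] l2 nrmD nrmZ nrm_eq0.

Lemma rnorm_l2 (u : l2) : rnorm u = l2nrm u. Proof. by []. Qed.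

End l2.
Arguments l2 : clear implicits.

(** * Limits of real and complex valued functions along filters *)

Section limits.
Context {R : realType}.

Lemma cvg_le_bound (T : Type) (F : set_system T) (FF : ProperFilter F)
    (a : T -> R) (l C : R) :
  a @ F --> l -> (\forall t \near F, a t <= C) -> l <= C.
Proof. by move=> al aC; exact: (closed_cvg (fun r : R => r <= C) (@closed_le R C) aC l al). Qed.

Lemma cvg_sumr (T J : Type) (F : set_system T) (FF : Filter F) (V : normedModType R[i])
    (s : seq J) (f : J -> T -> V) (l : J -> V) :
  (forall j, f j @ F --> l j) -> (fun t => \sum_(j <- s) f j t) @ F --> \sum_(j <- s) l j.
Proof.
move=> fl; elim: s => [|j s IH].
  by rewrite big_nil; under eq_cvg do rewrite big_nil; exact: cvg_cst.
by rewrite big_cons; under eq_cvg do rewrite big_cons; exact: cvgD.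
Qed.

Lemma cvg_sumR (T J : Type) (F : set_system T) (FF : Filter F)
    (s : seq J) (f : J -> T -> R) (l : J -> R) :
  (forall j, f j @ F --> l j) -> (fun t => \sum_(j <- s) f j t) @ F --> \sum_(j <- s) l j.
Proof.
move=> fl; elim: s => [|j s IH].
  by rewrite big_nil; under eq_cvg do rewrite big_nil; exact: cvg_cst.
by rewrite big_cons; under eq_cvg do rewrite big_cons; exact: cvgD.
Qed.

Lemma cvg_rnorm (T : Type) (F : set_system T) (FF : Filter F) (V : normedModType R[i])
    (f : T -> V) (l : V) :
  f @ F --> l -> (fun t => rnorm (f t)) @ F --> rnorm l.
Proof.
move=> /rnorm_cvgP fl; apply/cvgrPdist_le => e e0.
apply: filterS (fl e e0) => t; apply: le_trans.
rewrite ler_norml rnorm_sub andbT lerNl opprB rnormB.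
exact: rnorm_sub.
Qed.

Lemma cvg_nsq (T : Type) (F : set_system T) (FF : Filter F)
    (f : T -> R[i]^o) (l : R[i]^o) :
  f @ F --> l -> (fun t => nsq (f t)) @ F --> nsq l.
Proof.
move=> /cvg_rnorm fl.
rewrite nsqE expr2; under eq_cvg do rewrite nsqE expr2.
exact: cvgM.
Qed.

Lemma cvg_real_complex (T : Type) (F : set_system T) (FF : Filter F)
    (f : T -> R) (l : R) :
  f @ F --> l -> (fun t => (f t)%:C : R[i]^o) @ F --> (l%:C : R[i]^o).
Proof.
move=> /cvgrPdist_le fl; apply/rnorm_cvgP => e e0.
apply: filterS (fl e e0) => t; rewrite -rmorphB /=.
by rewrite /rnorm normc_def /= expr0n addr0 sqrtr_sqr.
Qed.

Lemma cvg_complex (T : Type) (F : set_system T) (FF : Filter F)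
    (f : T -> R[i]^o) (a b : R) :
  (fun t => Re (f t)) @ F --> a -> (fun t => Im (f t)) @ F --> b ->
  f @ F --> (a +i* b : R[i]^o).
Proof.
move=> /cvgrPdist_le fa /cvgrPdist_le fb; apply/rnorm_cvgP => e e0.
have e20 : 0 < e / 2 by rewrite divr_gt0.
near=> t; rewrite (splitr e).
apply: le_trans (_ : `|a - Re (f t)| + `|b - Im (f t)| <= _); last first.
  by apply: lerD; near: t; [exact: fa|exact: fb].
case: (f t) => [x y] /=; rewrite /rnorm normc_def /=.
rewrite -ler_sqr ?nnegrE ?addr_ge0 ?sqrtr_ge0// sqr_sqrtr ?addr_ge0 ?sqr_ge0//.
rewrite -(real_normK (num_real (a - x))) -(real_normK (num_real (b - y))).
by rewrite sqrrD lerD2r lerDl mulrn_wge0// mulr_ge0.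
Unshelve. all: by end_near. Qed.

Lemma cvg_conjc (T : Type) (F : set_system T) (FF : Filter F)
    (f : T -> R[i]^o) (l : R[i]^o) :
  f @ F --> l -> (fun t => conjc (f t) : R[i]^o) @ F --> (conjc l : R[i]^o).
Proof.
move=> /rnorm_cvgP fl; apply/rnorm_cvgP => e e0.
apply: filterS (fl e e0) => t.
by rewrite -[in X in _ -> X](rmorphB (@conjc R)) /= cabsJ.
Qed.

(** Real and imaginary parts are 1-Lipschitz for the modulus, so the completeness of R applies to
    each of them. *)
Lemma complex_cauchy_cvg (T : Type) (F : set_system T) (FF : ProperFilter F)
    (f : T -> R[i]^o) :
  (forall e : R, 0 < e -> exists z, \forall t \near F, cabs (z - f t) <= e) ->
  exists l : R[i]^o, f @ F --> l.
Proof.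
move=> H.
have C1 (g : R[i] -> R) : (forall z w, `|g z - g w| <= cabs (z - w)) ->
    exists a : R, (fun t => g (f t)) @ F --> a.
  move=> gle; apply/cvg_ex.
  apply: R_complete; apply: cauchy_exP => e e0.
  have [//|z Hz] := H (e / 2); first by rewrite divr_gt0.
  exists (g z); apply: filterS Hz => t zt; change (is_true (`|g z - g (f t)| < e)).
  have e2 : e / 2 < e by rewrite ltr_pdivrMr// ltr_pMr// ltr1n.
  exact: le_lt_trans (le_trans (gle _ _) zt) e2.
have hRe (z w : R[i]) : `|Re z - Re w| <= cabs (z - w).
  case: z w => [x y] [z w] /=; rewrite /rnorm normc_def /= -sqrtr_sqr.
  by rewrite ler_sqrt ?addr_ge0 ?sqr_ge0// lerDl sqr_ge0.
have hIm (z w : R[i]) : `|Im z - Im w| <= cabs (z - w).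
  case: z w => [x y] [z w] /=; rewrite /rnorm normc_def /= -sqrtr_sqr.
  by rewrite ler_sqrt ?addr_ge0 ?sqr_ge0// lerDr sqr_ge0.
have [a fa] := C1 _ hRe; have [b fb] := C1 _ hIm.
by exists (a +i* b); exact: cvg_complex.
Qed.

End limits.

(** * Completeness and inner product of l2(I) *)

Section l2_complete.
Context {R : realType} {I : choiceType}.
Local Notation H := (l2 R I).

(** Coordinates are contractive, so F converges pointwise to some [xi]. Letting z run along F in the
    finite sums of |y - z|^2 keeps the Cauchy bound, uniformly in the finite set s. *)
Lemma l2_complete (F : set_system H) : ProperFilter F -> cauchy F -> cvg F.
Proof.
move=> FF /cauchyP Fc.
have Fc' (e : R) : 0 < e -> exists x : H, \forall y \near F, rnorm (x - y) <= e.
  move=> e0; have [|x Fx] := Fc e%:C; first by rewrite ltcR.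
  exists x; apply: filterS Fx => y; rewrite /ball /= => /ltW.
  by rewrite rnormE lecR.
have ptw i : exists l : R[i]^o, (fun u : H => u i) @ F --> l.
  apply: complex_cauchy_cvg => e /Fc'[x Fx]; exists (x i).
  by apply: filterS Fx => y; apply: le_trans; exact: (cabs_le_l2 (x - y) i).
have [xi Hxi] := choice ptw.
have close (e : R) : 0 < e -> \forall y \near F, forall s, ssq (fun i => l2val y i - xi i) s <= e ^+ 2.
  move=> e0; have [|x Fx] := Fc' (e / 2); first by rewrite divr_gt0.
  move: (Fx) => Fx'; apply: filterS Fx => y xy s.
  have Fy : \forall z \near F, ssq (fun i => y i - l2val z i) s <= e ^+ 2.
    apply: filterS Fx' => z xz; apply: le_trans (ssq_le (y - z) s) _.
    rewrite ler_sqr ?nnegrE ?l2nrm_ge0 ?(ltW e0)// -rnorm_l2.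
    rewrite -(subrK x y) -addrA (le_trans (ler_rnormD _ _))//.
    by rewrite [leRHS](splitr e) lerD// rnormB.
  apply: (cvg_le_bound _ _ Fy).
  apply: cvg_sumR => i; apply: cvg_nsq; apply: cvgB; [exact: cvg_cst|exact: Hxi].
(* Square summability of the limit: [xi] differs from one member y0 of the space by a square
   summable function. *)
have [y0 Hy0] : exists y0 : H, forall s, ssq (fun i => y0 i - xi i) s <= 1 ^+ 2.
  by have := close 1 ltr01; move=> /filter_ex.
have dP : (fun i => y0 i - xi i : R[i]^o) \in l2pred by apply/asboolP; exists (1 ^+ 2).
pose d : H := L2 dP.
have dE i : xi i = (y0 - d) i by rewrite l2B /= opprB addrC subrK.
apply/cvg_ex; exists (y0 - d); apply/rnorm_cvgP => e e0.
apply: filterS (close e e0) => y hy; rewrite rnormB rnorm_l2.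
apply: l2nrm_le => [|s]; first exact: ltW.
rewrite (_ : ssq _ _ = ssq (fun i => y i - xi i) s)//.
by apply: eq_bigr => i _; rewrite dE.
Qed.

HB.instance Definition _ := Uniform_isComplete.Build H l2_complete.

Lemma ssq_cvg (u : H) : (fun s => ssq u s) @ totally --> l2nrm u ^+ 2.
Proof.
apply/cvgrPdist_le => e e0.
have : l2nrm u ^+ 2 - e < l2nrm u ^+ 2 by rewrite ltrBlDr ltrDl.
rewrite [X in _ < X]l2nrm_sqr => /sup_gt[|_ [s0 _ <-] h].
  by exists (ssq u fset0), fset0.
exists s0 => // s /= /(@ssq_mono _ _ u) hs.
rewrite ger0_norm ?subr_ge0 ?ssq_le//.
by rewrite lerBlDr addrC -lerBlDr (le_trans (ltW h)).
Qed.

Definition psum (u v : H) (s : {fset I}) : R[i]^o := \sum_(i <- s) u i * conjc (v i).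

(** Polarization: the real and imaginary parts are differences of the sums [ssq], which increase
    with s and are bounded. *)
Lemma psum_is_cvg (u v : H) : exists l : R[i]^o, psum u v @ totally --> l.
Proof.
have E1 s : Re (psum u v s) = (ssq (u + v) s - ssq (u - v) s) / 4.
  rewrite /psum /ssq raddf_sum -sumrB mulr_suml; apply: eq_bigr => i _.
  rewrite l2D l2B !nsqReIm; case: (u i) (v i) => [a b] [c d] /=.
  by field.
have E2 s : Im (psum u v s) = (ssq (u + 'i%C *: v) s - ssq (u - 'i%C *: v) s) / 4.
  rewrite /psum /ssq raddf_sum -sumrB mulr_suml; apply: eq_bigr => i _.
  rewrite l2D l2B l2Z !nsqReIm; case: (u i) (v i) => [a b] [c d] /=.
  by field.
eexists; apply: cvg_complex.
  under eq_cvg do rewrite E1; apply: cvgMr_tmp; apply: cvgB; exact: ssq_cvg.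
under eq_cvg do rewrite E2; apply: cvgMr_tmp; apply: cvgB; exact: ssq_cvg.
Qed.

Definition l2ip (u v : H) : R[i] := lim (psum u v @ totally).

Lemma l2ip_cvg u v : psum u v @ totally --> (l2ip u v : R[i]^o).
Proof. by apply/cvg_ex; exact: psum_is_cvg. Qed.

Lemma l2ipP u v (l : R[i]^o) : psum u v @ totally --> l -> l2ip u v = l.
Proof. by move=> h; apply: (@cvg_lim R[i]^o) => //. Qed.

Lemma l2ip_inner_product : is_inner_product l2ip.
Proof.
split=> [c x y z|x y|x].
- apply: l2ipP.
  have -> : psum (c *: x + y) z = (fun s => c *: psum x z s + psum y z s).
    apply/funext => s; rewrite /psum scaler_sumr -[RHS]big_split /=.
    apply: eq_bigr => i _.
    by rewrite [LHS](_ : _ = (c * x i + y i) * conjc (z i))// mulrDl -mulrA.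
  by apply: cvgD; [apply: cvgZl_tmp; exact: l2ip_cvg|exact: l2ip_cvg].
- apply: l2ipP.
  have -> : psum y x = (fun s => conjc (psum x y s)).
    apply/funext => s; rewrite /psum rmorph_sum; apply: eq_bigr => i _.
    by rewrite /= conjcM conjcK mulrC.
  by apply: cvg_conjc; exact: l2ip_cvg.
- apply: l2ipP; rewrite rnormE -rmorphXn /= rnorm_l2.
  have -> : psum x x = (fun s => (ssq x s)%:C).
    apply/funext => s; rewrite /psum /ssq rmorph_sum; apply: eq_bigr => i _.
    by rewrite mulJ_nsq.
  by apply: cvg_real_complex; exact: ssq_cvg.
Qed.

Lemma l2ip_le (u v : H) : cabs (l2ip u v) <= rnorm u * rnorm v.
Proof.
have /cvg_rnorm h := @l2ip_cvg u v.
apply: (cvg_le_bound _ h); apply: nearW => s.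
rewrite -ler_sqr ?nnegrE ?rnorm_ge0 ?mulr_ge0 ?rnorm_ge0//.
rewrite -nsqE exprMn; apply: le_trans (cauchy_schwarz_cabs _ _ _) _.
apply: ler_pM; rewrite ?ssq_ge0//; [exact: ssq_le|].
by under eq_bigr do rewrite nsqJ; exact: ssq_le.
Qed.

End l2_complete.

(** * Finitely supported vectors *)

Section finite_support.
Context {R : realType} {I : choiceType}.
Local Notation H := (l2 R I).
Implicit Types (x : I -> R[i]^o) (u v : H) (s t : {fset I}).

Definition restrict s x : I -> R[i]^o := fun i => if i \in s then x i else 0.

Lemma ssq_restrict s x t : ssq (restrict s x) t = ssq x (t `&` s)%fset.
Proof.
rewrite /ssq -(@big_fset_incl _ _ _ _ (t `&` s)%fset t) ?fsubsetIl//; last first.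
  by move=> i it; rewrite inE it /= /restrict => /negbTE ->; rewrite nsq0.
by apply: eq_big_seq => i; rewrite inE /restrict => /andP[_ ->].
Qed.

Lemma l2pred_restrict s x : restrict s x \in l2pred.
Proof.
by apply/asboolP; exists (ssq x s) => t; rewrite ssq_restrict ssq_mono ?fsubsetIr.
Qed.

Definition l2fin s x : H := L2 (l2pred_restrict s x).

Lemma l2finE s x i : l2fin s x i = if i \in s then x i else 0.
Proof. by []. Qed.

Lemma l2nrm_l2fin s x : l2nrm (l2fin s x) ^+ 2 = ssq x s.
Proof.
apply/le_anti/andP; split.
  by apply: l2nrm_sqr_le => t; rewrite ssq_restrict ssq_mono ?fsubsetIr.
by apply: le_trans (ssq_le _ s); rewrite ssq_restrict fsetIid.
Qed.

Lemma l2fin_approx u (e : R) : 0 < e -> exists s, rnorm (u - l2fin s u) <= e.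
Proof.
move=> e0.
have : l2nrm u ^+ 2 - e ^+ 2 < l2nrm u ^+ 2 by rewrite ltrBlDr ltrDl exprn_gt0.
rewrite [X in _ < X]l2nrm_sqr => /sup_gt[|_ [s _ <-] hs].
  by exists (ssq u fset0), fset0.
exists s; rewrite rnorm_l2; apply: l2nrm_le => [|t]; first exact: ltW.
have -> : ssq (u - l2fin s u) t = ssq u (t `\` s)%fset.
  rewrite /ssq -(@big_fset_incl _ _ _ _ (t `\` s)%fset t) ?fsubsetDl//; last first.
    move=> i it; rewrite inE it andbT negbK l2B l2finE => ->.
    by rewrite subrr nsq0.
  apply: eq_big_seq => i; rewrite inE l2B l2finE => /andP[/negbTE -> _].
  by rewrite subr0.
have : ssq u s + ssq u (t `\` s)%fset <= l2nrm u ^+ 2.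
  apply: le_trans (ssq_le u (s `|` t)%fset).
  rewrite {3}/ssq (big_fsetID _ (mem s) (s `|` t)%fset)/=.
  rewrite (_ : [fset z in (s `|` t) | z \in s]%fset = s); last first.
    by apply/fsetP => z; rewrite !inE /=; case: (z \in s); rewrite ?andbF.
  rewrite (_ : [fset z in (s `|` t) | z \notin s]%fset = (t `\` s)%fset)//.
  by apply/fsetP => z; rewrite !inE /=; case: (z \in s); rewrite ?andbF ?andbT.
move: hs; lra.
Qed.

Lemma l2ip_fin u v s : (forall i, u i != 0 -> i \in s) ->
  l2ip u v = \sum_(i <- s) u i * conjc (v i).
Proof.
move=> us; apply: l2ipP; apply/rnorm_cvgP => e e0; exists s => // t /= st.
rewrite (_ : psum u v t = \sum_(i <- s) u i * conjc (v i)) ?subrr ?rnorm0 ?ltW//.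
rewrite /psum (big_fset_incl _ st)// => i _; apply: contraNeq => h; apply: us.
by apply: contra_neq h => ->; rewrite mul0r.
Qed.

End finite_support.

(** * Row finite matrices and the Schur test *)

Section matrices.
Context {R : realType} {I : choiceType}.
Local Notation H := (l2 R I).
Implicit Types (M N : I -> I -> R[i]) (x y : I -> R[i]^o) (s t : {fset I}).

Definition row_finite M := forall p, exists s, forall q, M p q != 0 -> q \in s.

Definition adjmx M : I -> I -> R[i] := fun p q => conjc (M q p).

Definition schur (A : R) M :=
  (forall p s, \sum_(q <- s) cabs (M p q) <= A) /\
  (forall q s, \sum_(p <- s) cabs (M p q) <= A).

Definition mxapp M x : I -> R[i]^o := fun p => \sum_(q \in [set: I]) M p q * x q.

Lemma mxappE M x p s : (forall q, M p q != 0 -> q \in s) ->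
  mxapp M x p = \sum_(q <- s) M p q * x q.
Proof.
move=> hs; apply: fsbigTE => i; apply: contraNeq => h; apply: hs.
by apply: contra_neq h => ->; rewrite mul0r.
Qed.

Lemma row_finite_seq M (r : seq I) : row_finite M ->
  exists s, forall p, p \in r -> forall q, M p q != 0 -> q \in s.
Proof.
move=> fM; elim: r => [|p r [s hs]]; first by exists fset0.
have [t ht] := fM p; exists (t `|` s)%fset => p'.
rewrite !inE => /orP[/eqP -> q /ht|/hs h q /h]; rewrite !inE => ->//.
by rewrite orbT.
Qed.

Lemma schur_ge0 (A : R) M : I -> schur A M -> 0 <= A.
Proof. by move=> p [/(_ p fset0) + _]; rewrite big_seq_fset0. Qed.

Lemma schur_adj (A : R) M : schur A M -> schur A (adjmx M).
Proof.
by move=> [h1 h2]; split=> p s; rewrite /adjmx; under eq_bigr do rewrite cabsJ.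
Qed.

(** Schur test. In each row |M p q| |u q| is split as sqrt |M p q| times sqrt |M p q| |u q|;
    Cauchy-Schwarz and the row bound give one factor A, exchanging the sums and the column bound
    give the other. The finite set [s] contains the supports of all rows in [t]. *)
Lemma schur_ssq (A : R) M (u : H) t : row_finite M -> schur A M ->
  ssq (mxapp M u) t <= A ^+ 2 * l2nrm u ^+ 2.
Proof.
move=> fM [rA cA]; have [s hs] := row_finite_seq t fM.
have [t0|[p0 _]] := fset_0Vmem t.
  by rewrite t0 /ssq big_seq_fset0 mulr_ge0// sqr_ge0.
have A0 : 0 <= A by apply: (@schur_ge0 A M p0).
have step p : p \in t ->
    nsq (mxapp M u p) <= A * \sum_(q <- s) cabs (M p q) * nsq (u q).
  move=> pt; rewrite (mxappE _ (hs p pt)).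
  have h := cauchy_schwarz_sum s (fun q => Num.sqrt (cabs (M p q)))
    (fun q => Num.sqrt (cabs (M p q)) * cabs (u q)).
  have e1 : \sum_(q <- s) Num.sqrt (cabs (M p q)) * (Num.sqrt (cabs (M p q)) * cabs (u q))
      = \sum_(q <- s) cabs (M p q * u q).
    by apply: eq_bigr => q _; rewrite mulrA -expr2 sqr_sqrtr ?rnorm_ge0// cabsM.
  have e2 : \sum_(q <- s) Num.sqrt (cabs (M p q)) ^+ 2 = \sum_(q <- s) cabs (M p q).
    by apply: eq_bigr => q _; rewrite sqr_sqrtr ?rnorm_ge0.
  have e3 : \sum_(q <- s) (Num.sqrt (cabs (M p q)) * cabs (u q)) ^+ 2 =
      \sum_(q <- s) cabs (M p q) * nsq (u q).
    by apply: eq_bigr => q _; rewrite exprMn sqr_sqrtr ?rnorm_ge0// nsqE.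
  move: h; rewrite e1 e2 e3 => h.
  apply: le_trans (_ : (\sum_(q <- s) cabs (M p q * u q)) ^+ 2 <= _).
    rewrite nsqE ler_sqr ?nnegrE ?rnorm_ge0 ?sumr_ge0 ?ler_rnorm_sum// => *.
    exact: rnorm_ge0.
  apply: le_trans h _; apply: ler_wpM2r => //.
  by apply: sumr_ge0 => *; rewrite mulr_ge0 ?rnorm_ge0 ?nsq_ge0.
apply: le_trans (_ : \sum_(p <- t) A * \sum_(q <- s) cabs (M p q) * nsq (u q) <= _).
  by rewrite /ssq big_seq [leRHS]big_seq; exact: ler_sum.
rewrite -mulr_sumr expr2 -mulrA ler_wpM2l// exchange_big /=.
apply: le_trans (_ : A * ssq u s <= _); last by rewrite ler_wpM2l// ssq_le.
rewrite /ssq mulr_sumr; apply: ler_sum => q _.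
by rewrite -mulr_suml ler_wpM2r ?nsq_ge0.
Qed.

Lemma schur_l2pred (A : R) M (u : H) : row_finite M -> schur A M -> mxapp M u \in l2pred.
Proof.
by move=> fM sM; apply/asboolP; exists (A ^+ 2 * l2nrm u ^+ 2) => s; exact: schur_ssq.
Qed.

(** The default 0 makes the operator total, so that the regular representation is defined on all
    functions; it is not reached for row finite matrices satisfying a Schur bound. *)
Definition mxop M (u : H) : H :=
  if pselect (mxapp M u \in l2pred) is left h then L2 h else 0.

Lemma mxopE (A : R) M (u : H) p : row_finite M -> schur A M -> mxop M u p = mxapp M u p.
Proof.
move=> fM sM; rewrite /mxop; case: pselect => // nh; exfalso; apply: nh.
exact: schur_l2pred sM.
Qed.

Lemma mxop_le (A : R) M (u : H) : 0 <= A -> row_finite M -> schur A M ->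
  rnorm (mxop M u) <= A * rnorm u.
Proof.
move=> A0 fM sM; rewrite !rnorm_l2; apply: l2nrm_le => [|s].
  by rewrite mulr_ge0 ?l2nrm_ge0.
rewrite exprMn; apply: le_trans (schur_ssq u s fM sM).
by rewrite /ssq; under eq_bigr do rewrite (mxopE _ _ fM sM).
Qed.

Lemma mxapp_linear M c x y p : row_finite M ->
  mxapp M (c *: x + y) p = c * mxapp M x p + mxapp M y p.
Proof.
move=> fM; have [s hs] := fM p; rewrite !(mxappE _ hs) mulr_sumr -big_split /=.
apply: eq_bigr => q _.
by rewrite [(c *: x + y) q](_ : _ = c * x q + y q)// mulrDr mulrCA.
Qed.

Lemma mxop_linear (A : R) M : row_finite M -> schur A M -> linear (mxop M).
Proof.
move=> fM sM c u v; apply: l2_ext => p.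
by rewrite l2D l2Z !(mxopE _ _ fM sM) mxapp_linear.
Qed.


(** For finitely supported u both sides are the same finite double sum. Both sides are bounded in u,
    so the identity extends by density. *)
Lemma mxop_adj (A : R) M (u v : H) : 0 <= A ->
  row_finite M -> row_finite (adjmx M) -> schur A M ->
  l2ip (mxop M u) v = l2ip u (mxop (adjmx M) v).
Proof.
move=> A0 fM fM' sM; have sM' := schur_adj sM.
pose ipP := @l2ip_inner_product R I.
have ipB (x y z : H) : l2ip (x - y) z = l2ip x z - l2ip y z.
  have -> : x - y = -1 *: y + x by rewrite scaleN1r addrC.
  by rewrite (ip_linear ipP) mulN1r addrC.
have fin s : l2ip (mxop M (l2fin s u)) v = l2ip (l2fin s u) (mxop (adjmx M) v).
  have [t ht] := row_finite_seq s fM'.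
  rewrite (@l2ip_fin _ _ (mxop M _) _ t); last first.
    move=> p; rewrite (mxopE _ _ fM sM) => h.
    have [r hr] := fM p; move: h; rewrite (mxappE _ hr).
    apply: contraNT => pt; rewrite big1// => q _; rewrite l2finE.
    case: ifPn => qs; last by rewrite mulr0.
    apply/eqP; rewrite mulf_eq0; apply/orP; left.
    apply: contraNT pt => Mpq; apply: ht qs _ _.
    by rewrite /adjmx conjc_eq0.
  rewrite (@l2ip_fin _ _ (l2fin s u) _ s); last first.
    by move=> q; rewrite l2finE; case: ifP; rewrite ?eqxx.
  transitivity (\sum_(p <- t) \sum_(q <- s) M p q * u q * conjc (v p)).
    apply: eq_bigr => p _; rewrite (mxopE _ _ fM sM) -mulr_suml; congr (_ * _).
    have [r hr] := fM p; rewrite (mxappE _ (_ : forall q, _ -> q \in (r `|` s)%fset)).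
      rewrite -(@big_fset_incl _ _ _ _ s (r `|` s)%fset) ?fsubsetUr//; last first.
        by move=> i _ /negbTE; rewrite l2finE => ->; rewrite mulr0.
      by apply: eq_big_seq => i; rewrite l2finE => ->.
    by move=> q /hr; rewrite inE => ->.
  rewrite exchange_big; apply: eq_big_seq => q qs /=.
  rewrite /restrict qs (mxopE _ _ fM' sM') (mxappE _ (ht q qs)) rmorph_sum mulr_sumr.
  by apply: eq_bigr => p _; rewrite /= conjcM /adjmx conjcK mulrCA mulrA.
apply/eqP; rewrite -subr_eq0; apply/eqP; apply: (@rnorm_eq0 _ R[i]^o).
apply/le_anti; rewrite rnorm_ge0 andbT; apply/ler_addgt0Pl => e e0; rewrite addr0.
(* Each of the two error terms is at most A d |v|, where d is the norm of the discarded part of u;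
   the summand 1 keeps B positive. *)
pose B := 2 * A * rnorm v + 1.
have B0 : 0 < B by rewrite ltr_pwDr// !mulr_ge0// rnorm_ge0.
have [s hs] := @l2fin_approx _ _ u (e / B) (divr_gt0 e0 B0).
have E : l2ip (mxop M u) v - l2ip u (mxop (adjmx M) v) =
    l2ip (mxop M (u - l2fin s u)) v - l2ip (u - l2fin s u) (mxop (adjmx M) v).
  rewrite ipB.
  have -> : mxop M (u - l2fin s u) = mxop M u - mxop M (l2fin s u).
    have := mxop_linear fM sM (-1) (l2fin s u) u.
    by rewrite !scaleN1r (addrC _ u) (addrC _ (mxop M u)).
  by rewrite ipB fin opprB addrA subrK.
rewrite E; apply: le_trans (ler_rnormB _ _) _.
have h1 := l2ip_le (mxop M (u - l2fin s u)) v.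
have h2 := l2ip_le (u - l2fin s u) (mxop (adjmx M) v).
have h3 := mxop_le (u - l2fin s u) A0 fM sM.
have h4 := mxop_le v A0 fM' sM'.
set d := rnorm (u - _) in hs h1 h2 h3 *.
have d0 : 0 <= d := rnorm_ge0 _.
have v0 := rnorm_ge0 v.
apply: (@le_trans _ _ (d * B)); last by rewrite -ler_pdivlMr.
apply: le_trans (lerD h1 h2) _.
apply: le_trans (lerD (ler_wpM2r v0 h3) (ler_wpM2l d0 h4)) _.
rewrite /B; nra.
Qed.

End matrices.

(** * The regular representation *)

Section cuntz_groupoid.
Context {n : nat}.
Local Notation X := (infword n).
Implicit Types (x y z : X) (g h : cuntz n) (a b : seq 'I_n) (k l : int).

Lemma cuntz_eq g h : grange g = grange h -> gdeg g = gdeg h ->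
  gsource g = gsource h -> g = h.
Proof.
case: g h => [x k y P] [x' k' y' P'] /= ex ek ey; subst x' k' y'.
by rewrite (Prop_irrelevance P P').
Qed.

Definition wtail (i : nat) x : X := fun m => x (m + i)%N.

Lemma wcat_mkseq i x : wcat (mkseq x i) (wtail i x) = x.
Proof.
apply/funext => m; rewrite /wcat /wtail.
have [mi|im] := ltnP m i.
  by rewrite (set_nth_default (x 0%N)) ?size_mkseq// nth_mkseq.
by rewrite nth_default size_mkseq// subnK.
Qed.

Lemma wtail_wcat a x : wtail (size a) (wcat a x) = x.
Proof. by apply/funext => m; rewrite /wtail wcatR ?leq_addl// addnK. Qed.

Lemma wcat_cat a b x : wcat (a ++ b) x = wcat a (wcat b x).
Proof.
apply/funext => m; have [ma|am] := ltnP m (size a).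
  by rewrite [RHS]/wcat (set_nth_default (x (m - size (a ++ b))%N))// /wcat nth_cat ma.
by rewrite [RHS]wcatR// /wcat nth_cat ltnNge am /= size_cat subnDA.
Qed.

(** Only the lengths of the two words matter, since the words are recovered as prefixes of x and y.
    This presents G_n as the groupoid of the one-sided shift: equal tails with lag k. *)
Lemma in_cuntzE x k y : in_cuntz x k y <->
  exists i j : nat, k = i%:Z - j%:Z /\ wtail i x = wtail j y.
Proof.
split=> [[a [b [c [-> -> ->]]]]|[i [j [-> e]]]].
  by exists (size a), (size b); rewrite !wtail_wcat.
exists (mkseq x i), (mkseq y j), (wtail i x).
by rewrite !size_mkseq wcat_mkseq; split=> //; rewrite e wcat_mkseq.
Qed.

Lemma in_cuntzD x k y l z : in_cuntz x k y -> in_cuntz y l z -> in_cuntz x (k + l) z.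
Proof.
move=> /in_cuntzE[i [j [-> e]]] /in_cuntzE[i' [j' [-> e']]]; apply/in_cuntzE.
exists (i + i')%N, (j + j')%N; split; first by lia.
apply/funext => m; have := congr1 (fun w : X => w (m + i')%N) e.
have := congr1 (fun w : X => w (m + j)%N) e'; rewrite /wtail => e1 e2.
rewrite (_ : m + (i + i') = m + i' + i)%N; last by lia.
rewrite e2 (_ : m + i' + j = m + j + i')%N; last by lia.
by rewrite e1; congr z; lia.
Qed.

Lemma in_cuntz_refl x : in_cuntz x 0 x.
Proof. by apply/in_cuntzE; exists 0%N, 0%N; rewrite subrr. Qed.

Lemma cylP a b g : cyl (a, b) g -> [/\ grange g = wcat a (wtail (size a) (grange g)),
  gdeg g = (size a)%:Z - (size b)%:Z & gsource g = wcat b (wtail (size a) (grange g))].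
Proof. by move=> [c /= [rg dg sg]]; rewrite rg wtail_wcat. Qed.

End cuntz_groupoid.

(** * Convolution operators and the I-norm *)

Section convmx.
Context {R : realType} {n : nat}.
Local Notation X := (infword n).
Local Notation I := (int * infword n)%type.
Implicit Types (f h : cuntz n -> R[i]^o) (g : cuntz n) (Q : seq (seq 'I_n * seq 'I_n)).

(** Extension by 0 to triples outside G_n, so that matrix entries need no membership proofs. *)
Definition evg f (x : X) (k : int) (y : X) : R[i] :=
  if pselect (in_cuntz x k y) is left H then f (Cuntz H) else 0.

Lemma evgE f g : evg f (grange g) (gdeg g) (gsource g) = f g.
Proof.
rewrite /evg; case: pselect => [H|]; last by case; exact: cuntzP.
by congr f; exact: cuntz_eq.
Qed.

Lemma evg_neq0 f x k y : evg f x k y != 0 ->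
  exists g, [/\ grange g = x, gdeg g = k, gsource g = y & f g != 0].
Proof. by rewrite /evg; case: pselect => [H|]; rewrite ?eqxx// => fg; exists (Cuntz H). Qed.

(* The matrix of left convolution by f on l2(Z x X), on which G_n acts by
   (x,k,y).(j,y) = (j+k,x): the first coordinate makes the degree visible. *)
Definition convmx f (p q : I) : R[i] := evg f p.2 (p.1 - q.1) q.2.

Lemma convmxE f j g : convmx f (j, grange g) (j - gdeg g, gsource g) = f g.
Proof. by rewrite /convmx /= opprB addrC subrK evgE. Qed.

Lemma convmx_neq0 f p q : convmx f p q != 0 ->
  exists g, [/\ grange g = p.2, q = (p.1 - gdeg g, gsource g) & f g != 0].
Proof.
move=> /evg_neq0[g [rg dg sg fg]]; exists g; split=> //.
by rewrite dg sg opprB addrC subrK; case: q {dg sg}.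
Qed.

Lemma convmx_fstar f : convmx (fstar f) = adjmx (convmx f).
Proof.
apply/funext => p; apply/funext => q; rewrite /adjmx /convmx /evg.
case: pselect => H; case: pselect => H'.
- by rewrite /fstar; congr (conjc (f _)); apply: cuntz_eq => //=; rewrite opprB.
- by case: H'; rewrite -opprB; exact: in_cuntz_inv.
- by case: H; rewrite -opprB; exact: in_cuntz_inv.
- by rewrite conjc0.
Qed.

Lemma convmx_linear c f h p q :
  convmx (fun g => c * f g + h g) p q = c * convmx f p q + convmx h p q.
Proof. by rewrite /convmx /evg; case: pselect => // ?; rewrite mulr0 addr0. Qed.

Lemma fstarK f : fstar (fstar f) = f.
Proof.
apply/funext => g; rewrite /fstar conjcK; congr f; apply: cuntz_eq => //=.
exact: opprK.
Qed.

(** A finite list of cylinders stands in for compactness of the support. *)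
Definition suppin Q f := forall g, f g != 0 -> exists2 ab, ab \in Q & cyl ab g.

Lemma suppin_fstar Q f : suppin Q f -> suppin [seq (ab.2, ab.1) | ab <- Q] (fstar f).
Proof.
move=> sf g; rewrite /fstar conjc_eq0 => /sf[[a b] abQ [c /= [rg dg sg]]].
exists (b, a); first by apply/mapP; exists (a, b).
by exists c => /=; split=> //; rewrite -[LHS]opprK dg opprB.
Qed.

(** A cylinder contains at most one element with a given range, so each pair of words accounts for
    at most one nonzero entry in row p. The candidate is listed even when p does not lie over the
    cylinder. *)
Definition krow Q (p : I) : {fset I} :=
  [fset q | q in [seq (p.1 - ((size ab.1)%:Z - (size ab.2)%:Z),
     wcat ab.2 (wtail (size ab.1) p.2)) | ab <- Q]]%fset.

Lemma krowP Q f p q : suppin Q f -> convmx f p q != 0 -> q \in krow Q p.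
Proof.
move=> sf /convmx_neq0[g [rg -> /sf[[a b] abQ /cylP[_ -> ->]]]].
by rewrite !inE /= -rg; apply/mapP; exists (a, b).
Qed.

Lemma size_krow Q p : (size (krow Q p) <= size Q)%N.
Proof.
rewrite -(size_map (fun ab => (p.1 - ((size ab.1)%:Z - (size ab.2)%:Z),
     wcat ab.2 (wtail (size ab.1) p.2))) Q).
apply: uniq_leq_size; first exact: fset_uniq.
by move=> q; rewrite !inE.
Qed.

Lemma convmx_row_finite Q f : suppin Q f -> row_finite (convmx f).
Proof. by move=> sf p; exists (krow Q p) => q; exact: krowP. Qed.

Definition rsum f (x : X) : R := \sum_(g \in [set g | grange g = x]) rnorm (f g).

(** With the range fixed, g is determined by (j - degree, source); the sum over a range fibre is
    thus an absolute row sum, the same at every level j. *)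
Lemma rsumE Q f j x : suppin Q f ->
  rsum f x = \sum_(q <- krow Q (j, x)) cabs (convmx f (j, x) q).
Proof.
move=> sf; rewrite /rsum.
pose phi (g : cuntz n) : I := (j - gdeg g, gsource g).
transitivity (\sum_(g \in [set g | grange g = x]) cabs (convmx f (j, x) (phi g))).
  by apply: eq_fsbigr => g; rewrite inE /= => <-; rewrite convmxE.
rewrite -(@fsbig_image _ _ _ _ _ [set g | grange g = x] phi (fun q => cabs (convmx f (j, x) q))); last first.
  move=> g h; rewrite !inE /= => gx hx [] /addrI/oppr_inj dg sg.
  by apply: cuntz_eq => //; rewrite gx hx.
rewrite (@fsbig_widen _ _ _ _ _ [set: I])//.
  apply: fsbigTE => q; apply: contraNeq => h; apply: krowP sf _.
  by apply: contra_neq h => ->; rewrite rnorm0.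
move=> q [_ nq] /=; apply/eqP; apply: contra_notT nq => h.
have : convmx f (j, x) q != 0 by apply: contra_neq h => ->; rewrite rnorm0.
by move=> /convmx_neq0[g [rg -> _]]; exists g.
Qed.

Lemma sum_source f y : \sum_(g \in [set g | gsource g = y]) rnorm (f g) = rsum (fstar f) y.
Proof.
rewrite /rsum (reindex_fsbig (@ginv n) [set g | grange g = y]).
  by apply: eq_fsbigr => g _; rewrite /fstar cabsJ.
split=> [g /= //|g h _ _ e|g /= gy].
  by apply: cuntz_eq; [exact: (congr1 (@gsource n) e)| |exact: (congr1 (@grange n) e)];
    apply: oppr_inj; exact: (congr1 (@gdeg n) e).
by exists (ginv g) => //; apply: cuntz_eq => //=; exact: opprK.
Qed.

Lemma InormE f : Inorm f = Num.max (sup [set rsum f x | x in setT])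
  (sup [set rsum (fstar f) x | x in setT]).
Proof.
rewrite /Inorm; congr (Num.max _ (sup _)); apply/seteqP.
by split=> _ [y _ <-]; exists y => //; rewrite sum_source.
Qed.

Definition bsupp Q (M : R) f := [/\ 0 <= M, suppin Q f & forall g, cabs (f g) <= M].

Lemma bsupp_fstar Q M f : bsupp Q M f -> bsupp [seq (ab.2, ab.1) | ab <- Q] M (fstar f).
Proof.
by move=> [M0 sf fM]; split=> // [|g]; [exact: suppin_fstar|rewrite /fstar cabsJ].
Qed.

Lemma rsum_le Q M f x : bsupp Q M f -> rsum f x <= (size Q)%:R * M.
Proof.
move=> [M0 sf fM]; rewrite (rsumE 0 x sf).
apply: le_trans (_ : \sum_(q <- krow Q (0, x)) M <= _).
  apply: ler_sum => q _; have [->|/convmx_neq0] := eqVneq (convmx f (0, x) q) 0.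
    by rewrite rnorm0.
  by move=> [g [/= <- -> _]]; rewrite convmxE.
by rewrite big_const_seq count_predT iter_addr addr0 -[leLHS]mulr_natl ler_wpM2r// ler_nat size_krow.
Qed.

Lemma rsum_Inorm Q M f x : bsupp Q M f -> rsum f x <= Inorm f.
Proof.
move=> bf; rewrite InormE le_max; apply/orP; left; apply: ub_le_sup; last by exists x.
by exists ((size Q)%:R * M) => _ [y _ <-]; exact: rsum_le.
Qed.

Lemma Inorm_fstar f : Inorm (fstar f) = Inorm f.
Proof. by rewrite !InormE fstarK maxC. Qed.

Lemma Inorm_le Q M f : bsupp Q M f -> Inorm f <= (size Q)%:R * M.
Proof.
move=> bf; have [M0 _ _] := bf.
have h h' Q' : size Q' = size Q -> bsupp Q' M h' -> sup [set rsum h' x | x in setT] <= (size Q)%:R * M.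
  move=> eQ bh; have [->|ne] := eqVneq [set rsum h' x | x in [set: X]] set0.
    by rewrite sup0 mulr_ge0.
  by apply: ge_sup => [|_ [x _ <-]]; [exact/set0P|rewrite -eQ; exact: rsum_le].
rewrite InormE ge_max (h f Q)//=.
by apply: h (bsupp_fstar bf); rewrite size_map.
Qed.

Lemma convmx_row_le Q M f p (s : {fset I}) : bsupp Q M f -> \sum_(q <- s) cabs (convmx f p q) <= Inorm f.
Proof.
case: p => j x bf; apply: le_trans (rsum_Inorm x bf); have [_ sf _] := bf.
rewrite (rsumE j x sf).
apply: (@le_trans _ _ (\sum_(q <- (s `|` krow Q (j, x))%fset) cabs (convmx f (j, x) q))).
  rewrite [leRHS](big_fsetID _ (mem s))/=.
  rewrite (_ : [fset q in _ | _]%fset = s) ?lerDl ?sumr_ge0// => [*|]; first exact: rnorm_ge0.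
  by apply/fsetP => q; rewrite !inE /=; case: (q \in s); rewrite ?andbF.
rewrite -(@big_fset_incl _ _ _ _ (krow Q (j, x))) ?fsubsetUr// => q _.
by apply: contraNeq => h; apply: krowP sf _; apply: contra_neq h => ->; rewrite rnorm0.
Qed.

Lemma convmx_schur Q M f : bsupp Q M f -> schur (Inorm f) (convmx f).
Proof.
move=> bf; split=> p s; first exact: convmx_row_le bf.
have := convmx_row_le p s (bsupp_fstar bf); rewrite Inorm_fstar convmx_fstar.
by under eq_bigr do rewrite /adjmx cabsJ.
Qed.

Lemma Inorm_ge0 Q M f : X -> bsupp Q M f -> 0 <= Inorm f.
Proof. by move=> x /convmx_schur/schur_ge0; apply; exact: (0, x). Qed.

(** A factorization of g is determined by its intermediate point q, and an intermediate point that
    comes from no factorization makes one of the two entries vanish. *)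
Lemma convolutionE f h (s : {fset I}) j g :
  (forall q, convmx f (j, grange g) q != 0 -> q \in s) ->
  convolution f h g =
    \sum_(q <- s) convmx f (j, grange g) q * convmx h q (j - gdeg g, gsource g).
Proof.
move=> hs; rewrite /convolution.
pose phi (p : cuntz n * cuntz n) : I := (j - gdeg p.1, gsource p.1).
pose F q := convmx f (j, grange g) q * convmx h q (j - gdeg g, gsource g).
transitivity (\sum_(p \in [set p : cuntz n * cuntz n | gmul p.1 p.2 g]) F (phi p)).
  apply: eq_fsbigr => -[a b]; rewrite inE /= => -[/= ab ga dg sg].
  rewrite /F /phi /= ga convmxE ab; congr (_ * _).
  by rewrite sg dg opprD addrA convmxE.
rewrite -(@fsbig_image _ _ _ _ _ [set p : cuntz n * cuntz n | gmul p.1 p.2 g] phi F); last first.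
  move=> [a b] [a' b']; rewrite !inE /= => -[/= ab ga dg sg] [/= ab' ga' dg' sg'].
  move=> [/addrI/oppr_inj da sa].
  have eb : gdeg b = gdeg b' by apply: (@addrI _ (gdeg a)); rewrite -dg dg' da.
  by congr (_, _); apply: cuntz_eq => //; [rewrite -ga ga'|rewrite -ab sa ab'|rewrite -sg sg'].
rewrite (@fsbig_widen _ _ _ _ _ [set: I])//.
  apply: fsbigTE => q; apply: contraNeq => h0; apply: hs.
  by apply: contra_neq h0 => e; rewrite /F e mul0r.
move=> q [_ nq] /=; apply/eqP; apply: contra_notT nq; rewrite mulf_eq0 negb_or => /andP[].
move=> /convmx_neq0[a /= [ra -> _]] /convmx_neq0[b /= [regbound [] db sb _]].
exists (a, b) => //; split=> //=.
move: db; lia.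
Qed.

Lemma convmx_convolution f h (s : {fset I}) p r :
  (forall q, convmx f p q != 0 -> q \in s) ->
  convmx (convolution f h) p r = \sum_(q <- s) convmx f p q * convmx h q r.
Proof.
case: p r => j x [i z] hs; rewrite {1}/convmx /evg; case: pselect => [H|H] /=.
  rewrite (@convolutionE _ _ s j)//=.
  by apply: eq_bigr => q _; congr (_ * convmx h q (_, _)); rewrite opprB addrC subrK.
rewrite big1// => q _; apply/eqP; apply: contra_notT H; rewrite mulf_eq0 negb_or => /andP[].
move=> /convmx_neq0[a /= [<- -> _]] /convmx_neq0[b /= [regbound [] -> -> _]].
rewrite (_ : j - _ = gdeg a + gdeg b); last by lia.
by apply: in_cuntzD (cuntzP a) _; rewrite -regbound; exact: cuntzP.
Qed.

Local Notation H := (l2 R I).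

Definition lreg f : H -> H := mxop (convmx f).

Lemma lregE Q M f xi p : bsupp Q M f -> lreg f xi p = mxapp (convmx f) xi p.
Proof.
move=> bf; have [_ sf _] := bf.
exact: mxopE (convmx_row_finite sf) (convmx_schur bf).
Qed.

(** This makes [lreg] a competitor in the supremum [groupoid_norm]. The bounded cylinder covers of
    functions in C_c are a hypothesis here; compactness provides them later, in [Cc_bsupp]. *)
Lemma lreg_rep (x0 : X) : (forall f, Cc f -> exists Q M, bsupp Q M f) -> is_rep (@l2ip R I) lreg.
Proof.
move=> Ccb; split.
- move=> f /Ccb[Q [M bf]]; have [_ sf _] := bf.
  exact: mxop_linear (convmx_row_finite sf) (convmx_schur bf).
- move=> c f h xi /Ccb[Q [M bf]] /Ccb[Q' [M' bh]].
  have [_ sf _] := bf; have [_ sh _] := bh.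
  have E p : mxapp (convmx (fun g => c * f g + h g)) xi p = (c *: lreg f xi + lreg h xi : H) p.
    rewrite l2D l2Z (lregE _ _ bf) (lregE _ _ bh).
    have [s hs] := convmx_row_finite sf p; have [t ht] := convmx_row_finite sh p.
    rewrite !(mxappE _ (_ : forall q, _ -> q \in (s `|` t)%fset)).
    + rewrite mulr_sumr -big_split; apply: eq_bigr => q _ /=.
      by rewrite convmx_linear mulrDl mulrA.
    + by move=> q /ht; rewrite inE orbC => ->.
    + by move=> q /hs; rewrite inE => ->.
    + move=> q; rewrite convmx_linear inE; apply: contraNT; rewrite negb_or => /andP[qs qt].
      have -> : convmx f p q = 0 by apply/eqP; apply: contraNT qs; exact: hs.
      have -> : convmx h p q = 0 by apply/eqP; apply: contraNT qt; exact: ht.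
      by rewrite mulr0 addr0.
  (* No cylinder cover of the combination is at hand; its image is square summable because it agrees
     pointwise with the right-hand side. *)
  apply: l2_ext => p; rewrite -E {1}/lreg /mxop; case: pselect => // nP; exfalso; apply: nP.
  by rewrite (_ : mxapp _ _ = l2val (c *: lreg f xi + lreg h xi)) ?l2valP//; exact/funext.
- move=> f h xi /Ccb[Q [M bf]] /Ccb[Q' [M' bh]].
  have [_ sf _] := bf; have [_ sh _] := bh.
  have E p : mxapp (convmx (convolution f h)) xi p = lreg f (lreg h xi) p.
    rewrite (lregE _ _ bf).
    have [s hs] := convmx_row_finite sf p; rewrite (mxappE _ hs).
    have [t ht] := row_finite_seq s (convmx_row_finite sh).
    rewrite (mxappE _ (_ : forall q, _ -> q \in t)).
      under eq_bigr do rewrite (convmx_convolution _ _ hs) mulr_suml.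
      rewrite exchange_big /=; apply: eq_big_seq => q qs.
      rewrite (lregE _ _ bh) (mxappE _ (ht q qs)) mulr_sumr.
      by apply: eq_bigr => r _; rewrite mulrA.
    move=> q; rewrite (convmx_convolution _ _ hs); apply: contraNT => qt.
    rewrite big_seq big1// => r rs; have [->|/(ht r rs) qt'] := eqVneq (convmx h r q) 0.
      by rewrite mulr0.
    by rewrite qt' in qt.
  apply: l2_ext => p; rewrite -E {1}/lreg /mxop; case: pselect => // nP; exfalso; apply: nP.
  by rewrite (_ : mxapp _ _ = l2val (lreg f (lreg h xi))) ?l2valP//; exact/funext.
- move=> f xi eta /Ccb[Q [M bf]]; have [_ sf _] := bf; have [_ sf' _] := bsupp_fstar bf.
  rewrite /lreg convmx_fstar; apply: mxop_adj (convmx_schur bf).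
  + exact: Inorm_ge0 x0 bf.
  + exact: convmx_row_finite sf.
  + by rewrite -convmx_fstar; exact: convmx_row_finite sf'.
- move=> f xi /Ccb[Q [M bf]]; have [_ sf _] := bf.
  by apply: mxop_le (convmx_schur bf); [exact: Inorm_ge0 x0 bf|exact: convmx_row_finite sf].
Qed.

End convmx.

(** * Compactly supported and locally constant functions *)

Section cylinder_topology.
Context {n : nat}.
Local Notation X := (infword n).
Implicit Types (g : cuntz n) (ab : seq 'I_n * seq 'I_n).

Lemma open_cyl ab : open (cyl ab).
Proof.
exists [set ab] => //.
by rewrite bigcup_set1.
Qed.

Lemma nbhs_cylP g (U : set (cuntz n)) :
  nbhs g U <-> exists2 ab, cyl ab g & cyl ab `<=` U.
Proof.
rewrite nbhsE; split=> [[B [[D _ <-] [ab Dab abg]] DU]|[ab abg abU]].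
  by exists ab => // h abh; apply: DU; exists ab.
by exists (cyl ab) => //; split=> //; exact: open_cyl.
Qed.

Lemma mem_cyl g (i j : nat) : gdeg g = i%:Z - j%:Z ->
  wtail i (grange g) = wtail j (gsource g) ->
  cyl (mkseq (grange g) i, mkseq (gsource g) j) g.
Proof.
move=> dg tg; exists (wtail i (grange g)).
by rewrite !size_mkseq wcat_mkseq; split=> //=; rewrite tg wcat_mkseq.
Qed.

Lemma cyl_tail ab g : cyl ab g ->
  gdeg g = (size ab.1)%:Z - (size ab.2)%:Z /\
  wtail (size ab.1) (grange g) = wtail (size ab.2) (gsource g).
Proof. by move=> [c [-> -> ->]]; rewrite !wtail_wcat. Qed.

Lemma wtailD i j (x : X) : wtail i (wtail j x) = wtail (i + j) x.
Proof. by apply/funext => m; rewrite /wtail addnA. Qed.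


Lemma cyl_rcons a b g : cyl (a, b) g -> exists i, cyl (rcons a i, rcons b i) g.
Proof.
move=> [z /= [rg dg sg]]; exists (z 0%N); exists (wtail 1 z) => /=.
rewrite !size_rcons -!cats1 !wcat_cat.
have -> : wcat [:: z 0%N] (wtail 1 z) = z.
  have := wcat_mkseq 1 z; by rewrite /mkseq.
split=> //; lia.
Qed.

Definition gpoint a b (z : X) : cuntz n := Cuntz (ex_intro _ a (ex_intro _ b (ex_intro _ z
  (And3 (erefl (wcat a z)) (erefl ((size a)%:Z - (size b)%:Z)) (erefl (wcat b z)))))).

Lemma gpoint_cyl a b z : cyl (a, b) (gpoint a b z).
Proof. by exists z. Qed.

(** König's argument. A cylinder that is not eventually covered has a sub-cylinder, obtained by
    adding one common letter to both words, with the same defect. Iterating yields a point x, and a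
    basic neighbourhood of x contains one of the bad cylinders. *)
Lemma compact_cyl ab : compact (cyl ab).
Proof.
case: ab => a b; apply/compact_near_coveringP => J F P FF cov.
apply: contrapT => nF.
pose bad w := ~ \forall i \near F, cyl (a ++ w, b ++ w) `<=` P i.
have bad0 : bad [::] by rewrite /bad !cats0.
have step w : bad w -> exists i, bad (rcons w i).
  move=> bw; apply: contrapT => /forallNP nb; apply: bw.
  (* Finiteness of the alphabet enters here: finitely many eventual statements hold together
     eventually. *)
  have : \forall i \near F, forall k, cyl (a ++ rcons w k, b ++ rcons w k) `<=` P i.
    by apply: filter_forall => k; apply: contrapT; exact: nb.
  apply: filterS => i H g /cyl_rcons[k]; rewrite !rcons_cat; exact: H.
have [next nextP] : exists next, forall w, bad w -> bad (rcons w (next w)).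
  have [i0 _] := step _ bad0.
  have : forall w, exists i, bad w -> bad (rcons w i).
    by move=> w; have [/step[i ?]|?] := pselect (bad w); [exists i|exists i0].
  by move=> /choice[next H]; exists next.
pose word := fix word m := if m is m'.+1 then rcons (word m') (next (word m')) else [::].
have bad_word m : bad (word m) by elim: m => //= m /nextP.
have size_word m : size (word m) = m by elim: m => //= m IH; rewrite size_rcons IH.
pose x : X := fun m => next (word m).
have wordE m : word m = mkseq x m.
  by elim: m => //= m IH; rewrite [RHS]/mkseq -addn1 iotaD map_cat -/(mkseq x m) -IH cats1.
have [[U V] /= [/nbhs_cylP[cd cdg cdU] FV] UV] := cov _ (gpoint_cyl a b x).
(* A common extension of this length makes the range word at least as long as that of [cd], as
   nesting requires. *)
apply: (bad_word (size cd.1)); apply: filterS FV => i Vi g gw.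
apply: (UV (g, i)); split=> //; apply: cdU.
apply: cyl_nested gw => //; first by rewrite size_cat size_word leq_addl.
  exact: cdg.
exists (wtail (size cd.1) x) => /=; rewrite wordE !wcat_cat wcat_mkseq.
by split=> //; rewrite !size_cat; lia.
Qed.

End cylinder_topology.

(** * Finite cylinder covers of compactly supported functions *)

Section Cc.
Context {R : realType} {n : nat}.
Local Notation X := (infword n).
Implicit Types (f h : cuntz n -> R[i]^o) (g : cuntz n).

(** Compactness is used in its near-covering form, along the finite sets S of pairs of words: a
    point is covered once S contains a cylinder around it on which f oscillates by at most e. *)
Lemma Cc_cover f (e : R) : Cc f -> 0 < e -> exists Q, suppin Q f /\
  forall ab, ab \in Q -> forall g g', cyl ab g -> cyl ab g' -> cabs (f g - f g') <= e.
Proof.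
move=> [cf /compact_near_coveringP K] e0.
pose good ab := forall g g', cyl ab g -> cyl ab g' -> cabs (f g - f g') <= e.
pose P (S : {fset (seq 'I_n * seq 'I_n)%type}) g := exists2 ab, ab \in S & cyl ab g /\ good ab.
have /filter_ex[S SP] : \forall S \near totally, closure [set g | f g != 0] `<=` P S.
  apply: K => g _.
  have /nbhs_cylP[ab abg abU] : nbhs g [set g' | cabs (f g - f g') <= e / 2].
    have /rnorm_cvgP := cf g; apply; by rewrite divr_gt0.
  have gab : good ab.
    move=> g1 g2 /abU /= h1 /abU /= h2.
    rewrite -(subrK (f g) (f g1)) -addrA (le_trans (ler_rnormD _ _))//.
    by rewrite [leRHS](splitr e) lerD// rnormB.
  exists (cyl ab, [set S : {fset (seq 'I_n * seq 'I_n)%type} | ab \in S]) => /=.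
    split; first by apply/nbhs_cylP; exists ab.
    by exists [fset ab]%fset => // S /= /fsubsetP; apply; rewrite inE.
  by move=> [g' S] /= [g'ab abS]; exists ab.
exists [seq ab <- S | `[< good ab >]]; split=> [g fg|ab].
  have [ab abS [abg gab]] := SP g (@subset_closure _ [set g | f g != 0] g fg).
  by exists ab => //; rewrite mem_filter abS andbT; apply/asboolP.
by rewrite mem_filter => /andP[/asboolP gab _].
Qed.

(** On a cylinder of oscillation at most 1 the function is bounded by its value at one sample point
    plus 1; these bounds are added over the cover. *)
Lemma Cc_bsupp f : Cc f -> exists Q M, bsupp Q M f.
Proof.
move=> /Cc_cover/(_ ltr01)[Q [sf Qf]]; exists Q.
have [M [M0 hM]] : exists M, 0 <= M /\
    forall ab, ab \in Q -> forall g, cyl ab g -> cabs (f g) <= M.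
  elim: Q Qf {sf} => [|ab Q IH] Qf; first by exists 0.
  have [|M [M0 hM]] := IH; first by move=> ab' h; apply: Qf; rewrite inE h orbT.
  have [[g0 abg0]|/forallNP ne] := pselect (exists g, cyl ab g); last first.
    exists M; split=> // ab'; rewrite inE => /orP[/eqP -> g /ne//|]; exact: hM.
  exists (M + (cabs (f g0) + 1)); split.
    by rewrite !addr_ge0 ?rnorm_ge0.
  move=> ab'; rewrite inE => /orP[/eqP -> g abg|h g /(hM _ h) hg].
    rewrite -(subrK (f g0) (f g)) (le_trans (ler_rnormD _ _))// addrC.
    rewrite -[leLHS]add0r lerD// lerD2l; apply: Qf abg0 => //.
    by rewrite inE eqxx.
  by rewrite -[cabs _]addr0 lerD// addr_ge0 ?rnorm_ge0.
exists M; split=> // g; have [->|/sf[ab abQ abg]] := eqVneq (f g) 0.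
  by rewrite rnorm0.
exact: hM abQ g abg.
Qed.

Lemma loc_const_Cc Q f : suppin Q f ->
  (forall g, exists2 ab, cyl ab g & forall g', cyl ab g' -> f g' = f g) -> Cc f.
Proof.
move=> sf lf.
have nf g : nbhs g [set g' | f g' = f g].
  by have [ab abg h] := lf g; apply/nbhs_cylP; exists ab.
split.
  move=> g; apply/(@rnorm_cvgP _ _ _ _ (nbhs_filter g)) => e e0.
  apply: filterS (nf g) => g' /= ->.
  by rewrite subrr rnorm0 ltW.
have cl : closed [set g | f g != 0].
  by move=> g /(_ _ (nf g))[g' [/= + <-]].
have cpt : compact (\big[setU/set0]_(ab <- Q) cyl ab).
  by apply: bigsetU_compact => ab _; exact: compact_cyl.
apply: (subclosed_compact _ cpt); first exact: closed_closure.
rewrite -((closure_id _).1 cl) => g /= /sf[ab abQ abg].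
by rewrite -bigcup_seq; exists ab.
Qed.

End Cc.

(** * Locally constant functions and their convolution *)

Section locally_constant.
Context {R : realType} {n : nat}.
Local Notation X := (infword n).
Implicit Types (f h : cuntz n -> R[i]^o) (g : cuntz n) (a b w : seq 'I_n).

(** Membership in some cylinder whose words have lengths i and j, without naming the words. *)
Definition tailrel (i j : nat) g :=
  gdeg g = i%:Z - j%:Z /\ wtail i (grange g) = wtail j (gsource g).

Lemma tailrelD k i j g : tailrel i j g -> tailrel (k + i) (k + j) g.
Proof.
move=> [dg tg]; split; first by rewrite dg; lia.
by rewrite -!wtailD tg.
Qed.

Lemma tailrel_leq i i' j g : (i <= i')%N -> tailrel i j g -> tailrel i' (j + (i' - i)) g.
Proof. by move=> ii /(tailrelD (i' - i)); rewrite subnK// addnC. Qed.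

Lemma tailrelM i j k l g g1 g2 : gmul g1 g2 g -> tailrel i j g1 -> tailrel k l g2 ->
  tailrel (i + k) (j + l) g.
Proof.
move=> [e12 rg dg sg] [d1 t1] [d2 t2]; split; first by rewrite dg d1 d2; lia.
by rewrite rg sg addnC -wtailD t1 wtailD addnC e12 -wtailD t2 wtailD addnC.
Qed.

Lemma tailrel_inv i j g : tailrel i j (ginv g) -> tailrel j i g.
Proof.
by move=> [/= dg tg]; split=> //; rewrite -[LHS]opprK dg opprB.
Qed.

Lemma cyl_tailrel a b g : cyl (a, b) g -> tailrel (size a) (size b) g.
Proof. exact: cyl_tail. Qed.

Lemma tailrel_cyl i j g : tailrel i j g -> cyl (mkseq (grange g) i, mkseq (gsource g) j) g.
Proof. by move=> [dg tg]; exact: mem_cyl. Qed.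

Lemma gpointE a b g : cyl (a, b) g -> g = gpoint a b (wtail (size a) (grange g)).
Proof. by move=> /cylP[rg dg sg]; apply: cuntz_eq. Qed.

(* Supported on cylinders U_{a,b} with size a = m and size b <= 2 m, and constant
   on each cylinder with size a = m. *)
Definition locconst m f :=
  (forall g, f g != 0 -> exists2 j, (j <= m + m)%N & tailrel m j g) /\
  (forall a b g g', size a = m -> cyl (a, b) g -> cyl (a, b) g' -> f g = f g').

Lemma locconst_const m f a b g g' : locconst m f -> (m <= size a)%N ->
  cyl (a, b) g -> cyl (a, b) g' -> f g = f g'.
Proof.
move=> [sf cf] ma; wlog fg : g g' / f g != 0.
  move=> H abg abg'; have [fg0|fg] := eqVneq (f g) 0; last exact: H.
  have [fg0'|fg'] := eqVneq (f g') 0; first by rewrite fg0 fg0'.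
  by apply/esym; exact: H.
move=> abg abg'; have [j _ /tailrel_cyl tg] := sf g fg.
apply: (cf _ _ _ _ _ tg); first exact: size_mkseq.
by apply: (cyl_nested _ tg abg) abg'; rewrite size_mkseq.
Qed.

Lemma locconst_le m m' f : (m <= m')%N -> locconst m f -> locconst m' f.
Proof.
move=> mm lf; have [sf cf] := lf; split=> [g /sf[j jm /(tailrel_leq mm)]|a b g g' am].
  by exists (j + (m' - m))%N => //; lia.
by apply: locconst_const lf _; rewrite am.
Qed.

Lemma locconst_linear m c f h : locconst m f -> locconst m h -> locconst m (fun g => c * f g + h g).
Proof.
move=> [sf cf] [sh ch]; split=> [g|a b g g' am abg abg'].
  have [->|/sf//] := eqVneq (f g) 0; rewrite mulr0 add0r; exact: sh.
by rewrite (cf a b g g')// (ch a b g g').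
Qed.

Lemma locconst_trunc m k f : locconst m f -> locconst m (fun g => if gdeg g == k then f g else 0).
Proof.
move=> [sf cf]; split=> [g|a b g g' am abg abg'].
  by case: ifP => _; [exact: sf|rewrite eqxx].
by rewrite (cf a b g g')//; have [_ -> _] := cylP abg; have [_ -> _] := cylP abg'.
Qed.

(** The adjoint exchanges the two words of a cylinder, and source words may have length up to 2 m;
    hence the doubled parameter. *)
Lemma locconst_fstar m f : locconst m f -> locconst (m + m) (fstar f).
Proof.
move=> [sf cf]; split=> [g|a b g g' am].
  rewrite /fstar conjc_eq0 => /sf[j jm /tailrel_inv/(tailrel_leq jm) t].
  by exists (m + (m + m - j))%N => //; lia.
wlog fg : g g' / fstar f g != 0.
  move=> H abg abg'; have [fg0|fg] := eqVneq (fstar f g) 0; last exact: H.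
  have [fg0'|fg'] := eqVneq (fstar f g') 0; first by rewrite fg0 fg0'.
  by apply/esym; exact: H.
move: fg; rewrite /fstar conjc_eq0 => /sf[j jm /tailrel_cyl tg] abg abg'.
congr conjc; apply: (cf _ _ _ _ _ tg); first exact: size_mkseq.
have inv_cyl c d (u : cuntz n) : cyl (c, d) u -> cyl (d, c) (ginv u).
  move=> [z /= [ru du su]]; exists z => /=; split=> //.
  by rewrite du opprB.
have tg' := inv_cyl _ _ _ tg.
apply: inv_cyl; apply: (cyl_nested _ _ abg abg'); last first.
  rewrite (_ : g = ginv (ginv g)); first exact: tg'.
  by apply: cuntz_eq => //=; rewrite opprK.
by rewrite /= size_mkseq am.
Qed.

Definition chi (ab : seq 'I_n * seq 'I_n) : cuntz n -> R[i]^o :=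
  fun g => if `[< cyl ab g >] then 1 else 0.

Lemma chi_locconst ab : locconst (maxn (size ab.1) (size ab.2)) (chi ab).
Proof.
case: ab => a b; split=> [g|c d g g' cm] /=.
  rewrite /chi; case: asboolP => [/cyl_tailrel|]; last by rewrite eqxx.
  move=> /(tailrel_leq (leq_maxl _ (size b))).
  by exists (size b + (maxn (size a) (size b) - size a))%N => //; lia.
move=> cdg cdg'; rewrite /chi; congr (if _ then _ else _).
apply/asbool_equiv_eq; have ac : (size a <= size c)%N by rewrite cm leq_maxl.
by split=> [/(@cyl_nested _ (a, b) (c, d) g ac)|/(@cyl_nested _ (a, b) (c, d) g' ac)]; apply.
Qed.

Definition words (k : nat) : seq (seq 'I_n) := [seq tval t | t <- enum {: k.-tuple 'I_n}].

Lemma mem_words w : w \in words (size w).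
Proof. by apply/mapP; exists (in_tuple w) => //; rewrite mem_enum. Qed.


Definition words_le (k : nat) : {fset seq 'I_n} :=
  [fset w | w in flatten [seq words j | j <- iota 0 k.+1]]%fset.

Lemma mem_words_le k w : (size w <= k)%N -> w \in words_le k.
Proof.
move=> wk; apply/imfsetP; exists w => //; apply/flattenP.
exists (words (size w)); last exact: mem_words.
by apply: map_f; rewrite mem_iota add0n ltnS wk.
Qed.

Definition Qlc m : seq (seq 'I_n * seq 'I_n) :=
  [seq (a, b) | a <- words_le m, b <- words_le (m + m)].

Lemma locconst_suppin m f : locconst m f -> suppin (Qlc m) f.
Proof.
move=> [sf _] g /sf[j jm /tailrel_cyl tg].
exists (mkseq (grange g) m, mkseq (gsource g) j) => //.
by apply: allpairs_f; apply: mem_words_le; rewrite size_mkseq.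
Qed.

Lemma locconst_Cc m f : locconst m f -> Cc f.
Proof.
move=> lf; apply: loc_const_Cc (locconst_suppin lf) _ => g.
have [a [b [c [ra da sb]]]] := cuntzP g.
have : tailrel (m + size a) (m + size b) g.
  by apply: tailrelD; split=> //; rewrite ra sb !wtail_wcat.
move=> /tailrel_cyl tg.
exists (mkseq (grange g) (m + size a), mkseq (gsource g) (m + size b)) => // g' tg'.
by apply: (locconst_const lf _ tg' tg); rewrite size_mkseq leq_addr.
Qed.

(** Since f lives on cylinders with range words of length m <= size a, every intermediate point has
    the form w z with the same tail z. The index set does not depend on z, which is what makes
    convolutions locally constant. *)
Lemma convolution_gpoint m f h a b (z : X) : locconst m f -> (m <= size a)%N ->
  convolution f h (gpoint a b z) =
    \sum_(w <- words_le (size a + m)) f (gpoint a w z) * h (gpoint w b z).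
Proof.
move=> [sf _] ma.
pose phi w : (int * X)%type := (0 - ((size a)%:Z - (size w)%:Z), wcat w z).
rewrite (@convolutionE _ _ _ _ (phi @` words_le (size a + m))%fset 0).
  rewrite big_imfset /=.
    apply: eq_bigr => w _.
    rewrite (@convmxE _ _ f 0 (gpoint a w z)).
    congr (_ * _); have := @convmxE _ _ h (phi w).1 (gpoint w b z) => <-.
    by congr (convmx h (_, _) (_, _)); rewrite /=; lia.
  move=> w w' _ _ [/addrI/oppr_inj/addrI/oppr_inj[ww] e].
  rewrite -(cats0 w) -(cats0 w').
  apply: (@eq_from_nth _ (z 0%N)); rewrite !cats0 // => i iw.
  have := congr1 (fun x : X => x i) e; rewrite /wcat.
  by rewrite (set_nth_default (z 0%N))// => ->; rewrite (set_nth_default (z 0%N))// -ww.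
move=> q /convmx_neq0[g1 [/= rg1 -> /sf[j jm /(tailrel_leq ma) t1]]].
have := tailrel_cyl t1 => /gpointE; rewrite size_mkseq rg1 wtail_wcat => eg.
set w := mkseq (gsource g1) (j + (size a - m)) in eg.
have sw : size w = (j + (size a - m))%N by rewrite size_mkseq.
(* From j <= 2 m follows size w = j + (size a - m) <= size a + m. *)
apply/imfsetP; exists w => /=; first by apply: mem_words_le; rewrite sw; lia.
by rewrite /phi eg /= size_mkseq.
Qed.

Lemma gpoint_locconst m f a w (z : X) : locconst m f -> (m <= size a)%N -> f (gpoint a w z) != 0 ->
  (size a - m <= size w)%N.
Proof.
move=> [sf _] ma /sf[j jm [/= dg _]]; lia.
Qed.

Lemma convolution_neq0 Q f h g : suppin Q f -> convolution f h g != 0 ->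
  exists g1 g2, [/\ gmul g1 g2 g, f g1 != 0 & h g2 != 0].
Proof.
move=> sf; rewrite (@convolutionE _ _ f h (krow Q (0, grange g)) 0); last first.
  by move=> q; exact: krowP.
move=> ne; have [q [q1 q2]] : exists q, convmx f (0, grange g) q != 0 /\
    convmx h q (0 - gdeg g, gsource g) != 0.
  apply: contrapT => /forallNP nq; move/negP: ne; apply; apply/eqP.
  apply: big1 => q _; apply/eqP; rewrite mulf_eq0 -[_ || _]negbK negb_or.
  by apply/negP => /andP[? ?]; exact: (nq q).
move: q1 q2 => /convmx_neq0[g1 [/= r1 -> f1]] /convmx_neq0[g2 [/= r2 [] d2 s2 h2]].
by exists g1, g2; split=> //; split=> //; lia.
Qed.

(** A term with f nonzero has size w >= size a - m = m', long enough for h not to depend on the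
    tail. *)
Lemma locconst_convolution m m' f h : locconst m f -> locconst m' h -> locconst (m + m') (convolution f h).
Proof.
move=> lf lh; have [sf _] := lf; have [sh _] := lh; split=> [g|a b g g' am].
  move=> /(convolution_neq0 (locconst_suppin lf))[g1 [g2 [g12 /sf[j jm t1] /sh[j' jm' t2]]]].
  exists (j + j')%N; first by lia.
  exact: tailrelM g12 t1 t2.
move=> abg abg'; rewrite (gpointE abg) (gpointE abg').
set z := wtail _ _; set z' := wtail _ _.
have ma : (m <= size a)%N by rewrite am leq_addr.
rewrite !(convolution_gpoint _ _ _ lf ma); apply: eq_bigr => w _.
have -> : f (gpoint a w z) = f (gpoint a w z').
  by exact: (locconst_const lf ma (gpoint_cyl _ _ _) (gpoint_cyl _ _ _)).
have [->|fw] := eqVneq (f (gpoint a w z')) 0; first by rewrite !mul0r.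
congr (_ * _); apply: (locconst_const lh _ (gpoint_cyl _ _ _) (gpoint_cyl _ _ _)).
by apply: leq_trans (gpoint_locconst lf ma fw); rewrite am addKn.
Qed.


(** f is replaced on each small cylinder by its value at the point with tail [x0]. The difference
    stays supported in the cover Q1, chosen before e, so the I-norm is at most the length of Q1
    times the oscillation. *)
Lemma Cc_approx (x0 : X) f : Cc f -> exists C : R, 0 <= C /\
  forall e : R, 0 < e -> exists m f', locconst m f' /\ Inorm (fun g => f' g - f g) <= C * e.
Proof.
move=> Cf; have [Q1 [sf1 _]] := Cc_cover Cf ltr01.
exists (size Q1)%:R; split=> // e e0.
have [Q2 [sf2 osc]] := Cc_cover Cf e0.
have [m mQ] : exists m, forall ab, ab \in Q1 ++ Q2 -> (size ab.1 <= m)%N /\ (size ab.2 <= m)%N.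
  elim: (Q1 ++ Q2) => [|ab Q [m IH]]; first by exists 0%N.
  exists (m + size ab.1 + size ab.2)%N => ab'; rewrite inE => /orP[/eqP ->|/IH[h1 h2]].
    by split; [rewrite addnAC leq_addl|rewrite leq_addl].
  by split; rewrite -addnA ?(leq_trans h1) ?(leq_trans h2) ?leq_addr.
(* The length of the source word that goes with a range word of length m. The absolute value is
   harmless: on covered points m - degree is nonnegative. *)
pose src g := `|m%:Z - gdeg g|%N.
pose cov g := exists2 ab, ab \in Q1 & cyl ab g.
pose rep g := gpoint (mkseq (grange g) m) (mkseq (gsource g) (src g)) x0.
pose f' g : R[i]^o := if `[< cov g >] then f (rep g) else 0.
have tcov ab g : ab \in Q1 ++ Q2 -> cyl ab g -> tailrel m (src g) g /\ (src g <= m + m)%N.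
  case: ab => a b /mQ[/= am bm] /cyl_tailrel/(tailrel_leq am) t.
  have [dg _] := t.
  have -> : src g = (size b + (m - size a))%N by rewrite /src dg opprB addrC subrK.
  by split=> //; apply: leq_add; rewrite ?leq_subr.
have repc ab g : ab \in Q1 ++ Q2 -> tailrel m (src g) g -> (cyl ab g <-> cyl ab (rep g)).
  case: ab => a b abQ /tailrel_cyl tg; have [/= am _] := mQ _ abQ.
  have le : (size (a, b).1 <= size (mkseq (grange g) m, mkseq (gsource g) (src g)).1)%N.
    by rewrite size_mkseq.
  split=> h.
    by apply: (cyl_nested le h tg); exact: gpoint_cyl.
  by apply: (cyl_nested le h (gpoint_cyl _ _ _)).
exists m, f'; split.
  split=> [g|a b g g' am abg abg'].
    rewrite /f'; case: asboolP; rewrite ?eqxx// => -[ab abQ abg] _.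
    have [] := @tcov ab g => //; first by rewrite mem_cat abQ.
    by exists (src g).
  have eqc ab : ab \in Q1 -> (cyl ab g <-> cyl ab g').
    move=> abQ; have [|/= am' _] := mQ ab; first by rewrite mem_cat abQ.
    have le : (size ab.1 <= size (a, b).1)%N by rewrite /= am.
    by split=> h; [exact: (cyl_nested le h abg)|exact: (cyl_nested le h abg')].
  have covE : `[< cov g >] = `[< cov g' >].
    by apply: asbool_equiv_eq; split=> -[ab abQ /(eqc ab abQ)]; exists ab.
  have [rg dg sg] := cylP abg; have [rg' dg' sg'] := cylP abg'.
  rewrite /f' covE; case: asboolP => // -[ab abQ /(eqc ab abQ) abg1].
  have [|[dgt _] _] := @tcov ab g _ abg1; first by rewrite mem_cat abQ.
  have sb : src g = size b by move: dgt; rewrite dg am; lia.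
  have -> : rep g' = rep g; last by [].
  have esrc : src g' = src g by rewrite /src dg dg'.
  rewrite /rep esrc; congr gpoint.
    apply/eq_in_map => i; rewrite mem_iota add0n /= => im.
    by rewrite rg rg'; apply: wcatL; rewrite am.
  apply/eq_in_map => i; rewrite mem_iota add0n /= => im.
  by rewrite sg sg'; apply: wcatL; rewrite -sb.
apply: (@Inorm_le _ _ Q1 e); split; first exact: ltW.
  move=> g; rewrite /f'; case: asboolP => [//|nc]; rewrite sub0r oppr_eq0 => /sf1[ab abQ abg].
  by exfalso; apply: nc; exists ab.
move=> g; rewrite /f'; case: asboolP => [[ab1 ab1Q ab1g]|nc]; last first.
  have -> : f g = 0 by apply/eqP/negP => /negP/sf1[ab abQ abg]; apply: nc; exists ab.
  by rewrite subrr rnorm0 ltW.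
have ab1Q12 : ab1 \in Q1 ++ Q2 by rewrite mem_cat ab1Q.
have [tg _] := tcov ab1 g ab1Q12 ab1g.
(* A cylinder of Q2 contains g if and only if it contains its sample point, so it suffices that f is
   nonzero at one of the two. *)
have [f0|/sf2[ab abQ abg]] := eqVneq (f g) 0.
  have [->|/sf2[ab abQ abg]] := eqVneq (f (rep g)) 0; first by rewrite f0 subrr rnorm0 ltW.
  have Q12 : ab \in Q1 ++ Q2 by rewrite mem_cat abQ orbT.
  exact: (osc ab abQ _ _ abg ((repc ab g Q12 tg).2 abg)).
have Q12 : ab \in Q1 ++ Q2 by rewrite mem_cat abQ orbT.
exact: (osc ab abQ _ _ ((repc ab g Q12 tg).1 abg) abg).
Qed.

End locally_constant.

(** * The groupoid norm *)

Section growth.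
Context {R : realType}.

Lemma bernoulli (d : R) k : 0 <= d -> 1 + k%:R * d <= (1 + d) ^+ k.
Proof.
move=> d0; elim: k => [|k IH]; first by rewrite mul0r addr0 expr0.
have p0 : 0 <= k%:R * d by rewrite mulr_ge0.
rewrite exprS; apply: le_trans (ler_wpM2l _ IH); last by rewrite addr_ge0.
rewrite -natr1; nra.
Qed.

(** If t = (1 + d) C with d > 0, then for N = 2^p Bernoulli gives (N d)^2 <= (1 + d)^(2 N),
    quadratic in N, against the linear factor a N + b <= N (a + b). *)
Lemma power_growth (t C a b : R) : 0 <= t -> 0 <= C -> 0 <= a -> 0 <= b ->
  (forall p, t ^+ (2 ^ p.+1) <= (a * (2 ^ p)%:R + b) * C ^+ (2 ^ p.+1)) -> t <= C.
Proof.
move=> t0 C0 a0 b0 H; rewrite leNgt; apply/negP => Ct.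
have [C00|Cn0] := eqVneq C 0.
  have := H 0%N; rewrite C00 expr0n /= mulr0 => h.
  by move: Ct; rewrite C00 ltNge => /negP; apply; rewrite -(@ler_pXn2r _ 2) ?nnegrE// expr0n.
have Cp : 0 < C by rewrite lt_def Cn0.
pose d := t / C - 1.
have d0 : 0 < d by rewrite subr_gt0 ltr_pdivlMr// mul1r.
have tE : t = (1 + d) * C by rewrite /d addrC subrK divfK.
(* Chosen so that a + b < p d^2 <= 2^p d^2. *)
pose p := Num.bound ((a + b) / (d ^+ 2)).
have hM : (a + b) / d ^+ 2 < p%:R.
  by apply: archi_boundP; rewrite divr_ge0 ?addr_ge0 ?sqr_ge0.
have pM : (p <= 2 ^ p)%N by apply: ltnW; exact: ltn_expl.
have := H p; rewrite {1}tE exprMn ler_pM2r ?exprn_gt0// => h.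
have N1 : 1 <= (2 ^ p)%:R :> R by rewrite ler1n expn_gt0.
have hN : (a + b) < (2 ^ p)%:R * d ^+ 2.
  rewrite -ltr_pdivrMr ?exprn_gt0//; apply: lt_le_trans hM _.
  by rewrite ler_nat.
have hb := @bernoulli d (2 ^ p) (ltW d0).
have : ((2 ^ p)%:R * d) ^+ 2 <= (1 + d) ^+ (2 ^ p.+1).
  rewrite expnS mulnC exprM ler_pXn2r ?nnegrE//.
  - by apply: le_trans hb; rewrite lerDr.
  - by rewrite mulr_ge0// ltW.
  - by rewrite exprn_ge0// addr_ge0// ltW.
move: h hN N1; set N : R := (2 ^ p)%:R; set Z := (1 + d) ^+ _ => h hN N1 hZ.
have : N * (a + b) < N * (N * d ^+ 2) by rewrite ltr_pM2l// (lt_le_trans ltr01).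
nra.
Qed.

End growth.

(** * Bounds in the regular representation *)

Section groupoid_norm.
Context {R : realType} {n : nat} (x0 : infword n).
Local Notation I := (int * infword n)%type.
Local Notation H := (l2 R I).
Implicit Types (f h : cuntz n -> R[i]^o) (xi : H).

Let lreg_isrep : is_rep (@l2ip R I) lreg := lreg_rep x0 (@Cc_bsupp R n).

Lemma Inorm_Cc_ge0 f : Cc f -> 0 <= Inorm f.
Proof. by move=> /Cc_bsupp[Q [M bf]]; exact: Inorm_ge0 x0 bf. Qed.

Lemma opnorm_le (V : completeNormedModType R[i]) ip (L : (cuntz n -> R[i]^o) -> V -> V) f :
  is_rep ip L -> Cc f -> opnorm (L f) <= Inorm f.
Proof.
move=> rL Cf; apply: ge_sup.
  by exists (rnorm (L f 0)), 0 => //=; rewrite rnorm0.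
move=> _ [xi /= xi1 <-]; apply: le_trans (rep_bounded rL _ Cf) _.
by rewrite ler_piMr// Inorm_Cc_ge0.
Qed.

Lemma groupoid_norm_le f : Cc f -> groupoid_norm f <= Inorm f.
Proof.
move=> Cf; apply: ge_sup.
  exists (opnorm (lreg f)), H, (@l2ip R I), lreg.
  by split=> //; exact: l2ip_inner_product.
by move=> _ [V [ip [L [_ rL ->]]]]; exact: opnorm_le rL Cf.
Qed.

(** The suprema defining [opnorm] and [groupoid_norm] are both bounded by the I-norm, so the regular
    representation does lie below them; general vectors are scaled to norm 1. *)
Lemma lreg_groupoid_norm f xi : Cc f -> rnorm (lreg f xi) <= groupoid_norm f * rnorm xi.
Proof.
move=> Cf; have lf := rep_op lreg_isrep Cf.
have lf0 : lreg f 0 = 0.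
  by have := lf (-1) 0 0; rewrite scaler0 addr0 scaleN1r addNr.
have lfZ c u : lreg f (c *: u) = c *: lreg f u.
  by have := lf c u 0; rewrite !addr0 lf0 addr0.
have ub u : rnorm u <= 1 -> rnorm (lreg f u) <= groupoid_norm f.
  move=> u1; apply: (@le_trans _ _ (opnorm (lreg f))).
    apply: ub_le_sup; last by exists u.
    exists (Inorm f) => _ [v /= v1 <-]; apply: le_trans (rep_bounded lreg_isrep _ Cf) _.
    by rewrite ler_piMr// Inorm_Cc_ge0.
  apply: ub_le_sup.
    by exists (Inorm f) => _ [V [ip [L [_ rL ->]]]]; exact: opnorm_le rL Cf.
  by exists H, (@l2ip R I), lreg; split=> //; exact: l2ip_inner_product.
have [->|xi0] := eqVneq xi 0; first by rewrite lf0 !rnorm0 mulr0.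
have nxi : 0 < rnorm xi.
  rewrite lt_def rnorm_ge0 andbT; apply: contra_neq xi0; exact: rnorm_eq0.
have cE : cabs ((rnorm xi)^-1%:C) = (rnorm xi)^-1 by rewrite cabsR// invr_ge0 ltW.
have := ub ((rnorm xi)^-1%:C *: xi); rewrite rnormZ cE mulVf ?gt_eqF// => /(_ (lexx _)).
by rewrite lfZ rnormZ cE mulrC ler_pdivrMr.
Qed.

Definition regbound (C : R) f := forall xi, rnorm (lreg f xi) <= C * rnorm xi.

Lemma regbound_convolution C D f h : Cc f -> Cc h -> 0 <= C -> regbound C f -> regbound D h ->
  regbound (C * D) (convolution f h).
Proof.
move=> Cf Ch C0 bf bh xi; rewrite (rep_conv lreg_isrep)//.
by apply: le_trans (bf _) _; rewrite -mulrA ler_wpM2l.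
Qed.

(** For v the image of xi under the adjoint, |v|^2 is the inner product of [lreg f v] with xi, hence
    at most C |v| |xi|. *)
Lemma regbound_fstar C f : Cc f -> 0 <= C -> regbound C f -> regbound C (fstar f).
Proof.
move=> Cf C0 bf xi; set v := lreg (fstar f) xi.
have [->|v0] := eqVneq v 0; first by rewrite rnorm0 mulr_ge0// rnorm_ge0.
have nv : 0 < rnorm v.
  rewrite lt_def rnorm_ge0 andbT; apply: contra_neq v0; exact: rnorm_eq0.
have e : rnorm v ^+ 2 = cabs (l2ip (lreg f v) xi).
  rewrite (rep_star lreg_isrep)// (ip_norm l2ip_inner_product) rnormE -rmorphXn /=.
  by rewrite cabsR// sqr_ge0.
rewrite -(ler_pM2l nv) -expr2 e; apply: le_trans (l2ip_le _ _) _.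
by rewrite mulrA [rnorm v * C]mulrC ler_wpM2r// rnorm_ge0.
Qed.

(** [f g] is a coordinate of the image of a basis vector of norm 1. *)
Lemma regbound_sup C f g : Cc f -> regbound C f -> cabs (f g) <= C.
Proof.
move=> Cf bf; have [Q [M bsf]] := Cc_bsupp Cf.
set q : I := (0 - gdeg g, gsource g).
pose d : H := l2fin [fset q]%fset (fun=> 1).
have nd : rnorm d = 1.
  apply/eqP; rewrite rnorm_l2 -(@eqrXn2 _ 2) ?l2nrm_ge0// l2nrm_l2fin.
  by rewrite /ssq big_seq_fset1 nsqE cabs1 expr1n.
have := bf d; rewrite nd mulr1; apply: le_trans.
apply: le_trans (cabs_le_l2 _ (0, grange g)).
rewrite (lregE _ _ bsf); have [_ sf _] := bsf.
rewrite (@mxappE _ _ _ _ _ ([fset q] `|` krow Q (0, grange g))%fset); last first.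
  by move=> p /(krowP sf); rewrite inE => ->; rewrite orbT.
rewrite -(@big_fset_incl _ _ _ _ [fset q]%fset) ?fsubsetUl//; last first.
  by move=> p _ pq; rewrite /d l2finE (negbTE pq) mulr0.
by rewrite big_seq_fset1 /d l2finE inE eqxx mulr1 /q convmxE.
Qed.

Definition trunc (k : int) f : cuntz n -> R[i]^o := fun g => if gdeg g == k then f g else 0.

Definition level_fun (i : int) (x : I -> R[i]^o) : I -> R[i]^o :=
  fun q => if q.1 == i then x q else 0.

Lemma level_l2pred i xi : level_fun i xi \in l2pred.
Proof.
apply/asboolP; exists (l2nrm xi ^+ 2) => s; apply: le_trans (ssq_le xi s).
by apply: ler_sum => q _; rewrite /level_fun; case: ifP => // _; rewrite nsq0 nsq_ge0.
Qed.

Definition level i xi : H := L2 (level_l2pred i xi).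

Lemma sum_if_eq (T : eqType) (J : seq T) (a : T) (v : R) : uniq J -> 0 <= v ->
  \sum_(i <- J) (if a == i then v else 0) <= v.
Proof.
move=> + v0; elim: J => [|i J IH] /=; first by rewrite big_nil.
move=> /andP[iJ uJ]; rewrite big_cons; case: eqP => [ai|_]; last by rewrite add0r IH.
rewrite big_seq big1 ?addr0// => j jJ; case: eqP => // aj.
by move: iJ; rewrite -ai aj jJ.
Qed.

(** Vectors on distinct levels have disjoint supports. The inequality holds for finite partial sums
    and passes to the limit over finite sets. *)
Lemma sum_level (J : seq int) xi : uniq J ->
  \sum_(i <- J) l2nrm (level i xi) ^+ 2 <= l2nrm xi ^+ 2.
Proof.
move=> uJ.
have cv : (fun s => \sum_(i <- J) ssq (level i xi) s) @ totally -->
    \sum_(i <- J) l2nrm (level i xi) ^+ 2.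
  by apply: cvg_sumR => i; exact: ssq_cvg.
apply: (cvg_le_bound totally_filter cv); apply: nearW => s; apply: le_trans (ssq_le xi s).
rewrite /ssq exchange_big /=; apply: ler_sum => q _.
rewrite (eq_bigr (fun i => if q.1 == i then nsq (xi q) else 0)) ?sum_if_eq ?nsq_ge0//.
by move=> i _; rewrite /level_fun; case: ifP => // _; rewrite nsq0.
Qed.

(* The degree k part of lreg f maps level j to level j + k, so it is bounded
   by lreg f on each level, and the levels are orthogonal. *)
Lemma regbound_trunc C k f : Cc f -> Cc (trunc k f) -> 0 <= C -> regbound C f -> regbound C (trunc k f).
Proof.
move=> Cf Ck C0 bf xi; have [Q [M bsf]] := Cc_bsupp Cf; have [Q' [M' bsk]] := Cc_bsupp Ck.
have [_ sf _] := bsf; have [_ sk _] := bsk.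
have E p : lreg (trunc k f) xi p = lreg f (level (p.1 - k) xi) p.
  rewrite (lregE _ _ bsf) (lregE _ _ bsk).
  rewrite !(@mxappE _ _ _ _ _ (krow Q p `|` krow Q' p)%fset); last 2 first.
  - by move=> q /(krowP sf); rewrite inE => ->.
  - by move=> q /(krowP sk); rewrite inE orbC => ->.
  apply: eq_bigr => q _; rewrite /level /= /level_fun /convmx /evg /trunc.
  case: pselect => [h|]; last by rewrite !mul0r.
  rewrite /=; have -> : (p.1 - q.1 == k) = (q.1 == p.1 - k) by apply/eqP/eqP => ?; lia.
  by case: ifP; rewrite ?mul0r ?mulr0.
rewrite !rnorm_l2; apply: l2nrm_le => [|t]; first by rewrite mulr_ge0// l2nrm_ge0.
(* The levels from which the truncation reaches a point of t. Each point receives one of them, and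
   duplicates would count a level twice. *)
pose J := undup [seq p.1 - k | p <- t].
apply: le_trans (_ : \sum_(j <- J) ssq (lreg f (level j xi)) t <= _); last first.
  rewrite exprMn; apply: le_trans (ler_wpM2l (sqr_ge0 C) (sum_level xi (undup_uniq _))).
  rewrite mulr_sumr; apply: ler_sum => j _; apply: le_trans (ssq_le _ _) _.
  by rewrite -exprMn ler_sqr ?nnegrE ?l2nrm_ge0 ?mulr_ge0 ?l2nrm_ge0//; exact: bf.
rewrite /ssq exchange_big /= big_seq [leRHS]big_seq; apply: ler_sum => p pt.
have pJ : p.1 - k \in J by rewrite mem_undup; apply/mapP; exists p.
rewrite E (bigD1_seq _ pJ) ?undup_uniq//= lerDl.
by apply: sumr_ge0 => *; exact: nsq_ge0.
Qed.

End groupoid_norm.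

(** * Isometry of the regular representation *)

Section isometry.
Context {R : realType} {n : nat} (x0 : infword n).
Context {A : cstarAlg R} {iota : (cuntz n -> R[i]^o) -> A} (hA : is_groupoid_cstar iota).
Implicit Types (f h : cuntz n -> R[i]^o) (a b : A).

Lemma iota_le_Inorm f : Cc f -> rnorm (iota f) <= Inorm f.
Proof. by move=> Cf; rewrite (iota_norm hA)// (groupoid_norm_le x0). Qed.

Lemma iota_regbound f : Cc f -> regbound (rnorm (iota f)) f.
Proof. by move=> Cf xi; rewrite (iota_norm hA)// (lreg_groupoid_norm x0). Qed.

Lemma rnorm_cstar a : rnorm (cmul (cadj a) a) = rnorm a ^+ 2.
Proof.
by apply: (@complexI R); rewrite -rnormE cstar_identity rnormE -rmorphXn.
Qed.

(** The 2^p-th convolution power of the adjoint of f times f, by repeated squaring. Every stage has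
    a self-adjoint image, so the C*-identity gives its norm exactly. *)
Fixpoint sqpow f (p : nat) : cuntz n -> R[i]^o :=
  if p is p'.+1 then convolution (sqpow f p') (sqpow f p') else convolution (fstar f) f.

Lemma sqpow_locconst m f p : locconst m f -> exists m', locconst m' (sqpow f p).
Proof.
move=> lf; elim: p => [|p [m' IH]] /=; last by exists (m' + m')%N; exact: locconst_convolution.
by exists (m + m + m)%N; apply: locconst_convolution => //; exact: locconst_fstar.
Qed.

Lemma sqpow_Cc m f p : locconst m f -> Cc (sqpow f p).
Proof. by move=> /(sqpow_locconst p)[m' /locconst_Cc]. Qed.

Lemma sqpow_norm m f p : locconst m f ->
  rnorm (iota (sqpow f p)) = rnorm (iota f) ^+ (2 ^ p.+1).
Proof.
move=> lf; have Cf := locconst_Cc lf; have Cf' := locconst_Cc (locconst_fstar lf).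
suff : cadj (iota (sqpow f p)) = iota (sqpow f p) /\
    rnorm (iota (sqpow f p)) = rnorm (iota f) ^+ (2 ^ p.+1) by case.
elim: p => [|p [IH1 IH2]] /=.
  rewrite (iota_conv hA)// (iota_star hA)//; split; last exact: rnorm_cstar.
  by rewrite cadj_mul cadjK.
have Cp := sqpow_Cc p lf; rewrite (iota_conv hA)//; split; first by rewrite cadj_mul IH1.
by rewrite -{1}IH1 rnorm_cstar IH2 -exprM (expnSr 2 p.+1).
Qed.

Lemma sqpow_regbound m C f p : locconst m f -> 0 <= C -> regbound C f -> regbound (C ^+ (2 ^ p.+1)) (sqpow f p).
Proof.
move=> lf C0 bf; have Cf := locconst_Cc lf; have Cf' := locconst_Cc (locconst_fstar lf).
elim: p => [|p IH] /=.
  by rewrite expn1 expr2; apply: regbound_convolution => //; exact: regbound_fstar.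
have Cp := sqpow_Cc p lf.
rewrite (expnSr 2 p.+1) exprM expr2; apply: regbound_convolution => //; exact: exprn_ge0.
Qed.

(* On functions supported on {(x,0,y) | x and y agree from index M on} the
   I-norm is at most a constant times the uniform norm, hence a constant times
   any bound on the regular representation; the constant is removed by taking
   high powers. *)
Lemma homogeneous_isometry m k C f : locconst m f -> (forall g, f g != 0 -> gdeg g = k) ->
  0 <= C -> regbound C f -> rnorm (iota f) <= C.
Proof.
move=> lf df C0 bf; have [sf _] := lf.
(* In degree k the source words have length m - k, so the first power relates points with equal
   tails from index (m - k) + m on. Such elements are closed under products, hence one M serves all
   p. *)
have [M sM] : exists M, forall p g, sqpow f p g != 0 -> tailrel M M g.
  exists (`|m%:Z - k|%N + m)%N; elim=> [|p IH] g /=.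
    move=> /(convolution_neq0 (locconst_suppin (locconst_fstar lf)))[g1 [g2 [g12]]].
    rewrite /fstar conjc_eq0 => /[dup] /df d1 /sf[j1 _ t1] /[dup] /df d2 /sf[j2 _ t2].
    have ej (j : nat) (u : cuntz n) : gdeg u = k -> tailrel m j u -> j = `|m%:Z - k|%N.
      by move=> <- [-> _]; rewrite opprB addrC subrK.
    rewrite [X in tailrel _ X]addnC.
    have E1 := ej _ _ d1 t1; have E2 := ej _ _ d2 t2.
    apply: (tailrelM g12 _ (_ : tailrel _ _ g2)).
      by apply: tailrel_inv; rewrite -{1}E1; exact: t1.
    by rewrite -{1}E2; exact: t2.
  have [m' lp] := sqpow_locconst p lf.
  move=> /(convolution_neq0 (locconst_suppin lp))[g1 [g2 [[e12 rg dg sg] /IH[d1 t1] /IH[d2 t2]]]].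
  by split; [rewrite dg d1 d2; lia|rewrite rg t1 e12 t2 sg].
pose Q : seq (seq 'I_n * seq 'I_n) := [seq (u, v) | u <- words_le M, v <- words_le M].
apply: (@power_growth _ _ _ 0 (size Q)%:R); rewrite ?rnorm_ge0// => p.
rewrite -(sqpow_norm p lf) mul0r add0r; have Cp := sqpow_Cc p lf.
apply: le_trans (iota_le_Inorm Cp) _; apply: Inorm_le.
split; first exact: exprn_ge0.
  move=> g /sM/tailrel_cyl tg; exists (mkseq (grange g) M, mkseq (gsource g) M) => //.
  by apply: allpairs_f; apply: mem_words_le; rewrite size_mkseq.
by move=> g; apply: regbound_sup => //; exact: sqpow_regbound lf C0 bf.
Qed.

Lemma iota0 : iota (fun=> 0) = 0.
Proof.
have C0 : @Cc R n (fun=> 0).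
  apply: (@locconst_Cc _ _ 0); split=> // g; by rewrite eqxx.
have := iota_linear hA (-1) C0 C0; rewrite scaleN1r addNr => <-.
by congr iota; apply/funext => g; rewrite mulr0 addr0.
Qed.

Lemma iota_sum m (J : seq int) (F : int -> cuntz n -> R[i]^o) : (forall j, locconst m (F j)) ->
  iota (fun g => \sum_(j <- J) F j g) = \sum_(j <- J) iota (F j) /\
  locconst m (fun g => \sum_(j <- J) F j g).
Proof.
move=> lF; elim: J => [|j J [IH1 IH2]].
  have E : (fun g : cuntz n => \sum_(j <- [::]) F j g) = (fun=> 0).
    by apply/funext => g; rewrite big_nil.
  rewrite E big_nil iota0; split=> //; split=> // g.
  by rewrite eqxx.
have E : (fun g : cuntz n => \sum_(i <- j :: J) F i g) =
    (fun g => 1 * F j g + \sum_(i <- J) F i g).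
  by apply/funext => g; rewrite big_cons mul1r.
rewrite E big_cons; split; last exact: locconst_linear.
by rewrite (iota_linear hA) ?IH1 ?scale1r//; [exact: locconst_Cc (lF j)|exact: locconst_Cc IH2].
Qed.

(* The regular representation is isometric (amenability of G_n): the sum of the
   norms of the homogeneous parts of sqpow f p has at most O(2 ^ p) terms. *)
Lemma locconst_isometry m C f : locconst m f -> 0 <= C -> regbound C f -> rnorm (iota f) <= C.
Proof.
move=> lf C0 bf; have [sf _] := lf.
(* Source words of length at most 2 m confine the degrees of f to [-m, m]; the first power doubles
   this range, and so does every squaring. *)
have degp p g : sqpow f p g != 0 -> (`|gdeg g| <= m * 2 ^ p.+1)%N.
  elim: p g => [|p IH] g /=.
    move=> /(convolution_neq0 (locconst_suppin (locconst_fstar lf)))[g1 [g2 [[_ _ dg _]]]].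
    rewrite /fstar conjc_eq0 => /sf[j1 jm1 [/= d1 _]] /sf[j2 jm2 [d2 _]].
    by rewrite dg d2 expn1; lia.
  have [m' lp] := sqpow_locconst p lf.
  move=> /(convolution_neq0 (locconst_suppin lp))[g1 [g2 [[_ _ dg _] /IH d1 /IH d2]]].
  by rewrite dg (expnS _ p.+1); move: d1 d2; set N := (2 ^ _)%N; nia.
apply: (@power_growth _ _ _ (4 * m%:R) 1); rewrite ?rnorm_ge0 ?mulr_ge0// => p.
rewrite -(sqpow_norm p lf); have [m' lp] := sqpow_locconst p lf; have Cp := locconst_Cc lp.
pose K := (m * 2 ^ p.+1)%N.
(* All degrees from -K to K: 2 K + 1 = 4 m 2^p + 1 of them, whence the constants 4 m and 1 above. *)
pose J : seq int := [seq i%:Z - K%:Z | i <- seq.iota 0 (K + K).+1].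
have uJ : uniq J by rewrite map_inj_uniq ?iota_uniq// => i j /addIr [].
have hJ : sqpow f p = (fun g => \sum_(k <- J) trunc k (sqpow f p) g).
  apply/funext => g; have [e0|ne] := eqVneq (sqpow f p g) 0.
    by rewrite big1 ?e0// => k _; rewrite /trunc e0; case: ifP.
  have gJ : gdeg g \in J.
    apply/mapP; exists (absz (gdeg g + K%:Z)); last by have := degp p g ne; rewrite -/K; lia.
    by rewrite mem_iota; have := degp p g ne; rewrite -/K; lia.
  rewrite (bigD1_seq _ gJ uJ)/= {1}/trunc eqxx big1 ?addr0// => k kg.
  by rewrite /trunc eq_sym (negbTE kg).
have [e _] := @iota_sum m' J (fun k => trunc k (sqpow f p)) (fun k => locconst_trunc k lp).
rewrite hJ e; apply: le_trans (ler_rnorm_sum _ _) _.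
apply: le_trans (_ : \sum_(k <- J) C ^+ (2 ^ p.+1) <= _).
  apply: ler_sum => k _; have lk := locconst_trunc k lp.
  apply: (@homogeneous_isometry _ k _ _ lk); [|exact: exprn_ge0|].
    by move=> g; case: ifP => [/eqP -> //|_]; rewrite eqxx.
  apply: regbound_trunc => //; [exact: locconst_Cc lk|exact: exprn_ge0|exact: sqpow_regbound lf C0 bf].
rewrite big_const_seq count_predT iter_addr addr0 -[leLHS]mulr_natl.
apply: ler_wpM2r; first exact: exprn_ge0.
by rewrite size_map size_iota -natr1 natrD /K natrM expnS natrM; nra.
Qed.

End isometry.

(** * Elements of C*(G_n) as functions *)

Section cstar_algebra.
Context {R : realType} {A : cstarAlg R}.
Implicit Types a b c : A.

Lemma cmulDl a b c : cmul (a + b) c = cmul a c + cmul b c.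
Proof. by have := cmul_linearl 1 a b c; rewrite !scale1r. Qed.

Lemma cmulDr a b c : cmul c (a + b) = cmul c a + cmul c b.
Proof. by have := cmul_linearr 1 c a b; rewrite !scale1r. Qed.

Lemma cmulBl a b c : cmul (a - b) c = cmul a c - cmul b c.
Proof. by have := cmul_linearl (-1) b a c; rewrite !scaleN1r addrC => ->; rewrite addrC. Qed.

Lemma cmulBr a b c : cmul c (a - b) = cmul c a - cmul c b.
Proof. by have := cmul_linearr (-1) c b a; rewrite !scaleN1r addrC => ->; rewrite addrC. Qed.

Lemma rnorm_cmul a b : rnorm (cmul a b) <= rnorm a * rnorm b.
Proof. by rewrite -lecR rmorphM /= -!rnormE cmul_norm. Qed.

Lemma cmul_dist a b a' b' (e : R) : rnorm (a' - a) <= e -> rnorm (b' - b) <= e ->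
  rnorm (cmul a' b' - cmul a b) <= e * (rnorm b + e) + rnorm a * e.
Proof.
move=> ha hb.
have -> : cmul a' b' - cmul a b = cmul (a' - a) b' + cmul a (b' - b).
  by rewrite cmulBl cmulBr addrA subrK.
have e0 : 0 <= e := le_trans (rnorm_ge0 _) ha.
apply: le_trans (ler_rnormD _ _) _; apply: lerD; apply: le_trans (rnorm_cmul _ _) _.
  apply: ler_pM; rewrite ?rnorm_ge0//.
  by rewrite -(subrK b b') addrC (le_trans (ler_rnormD _ _))// lerD2l.
by rewrite ler_wpM2l// rnorm_ge0.
Qed.

End cstar_algebra.

Lemma small_eq0 (R : realType) (V : normedModType R[i]) (v : V) (C : R) : 0 <= C ->
  (forall e : R, 0 < e -> e <= 1 -> rnorm v <= C * e) -> v = 0.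
Proof.
move=> C0 H; apply: rnorm_eq0; apply/le_anti; rewrite rnorm_ge0 andbT.
apply/ler_addgt0Pl => e e0; rewrite addr0.
have C1 : 0 < C + 1 by rewrite ltr_pwDr.
pose d := Num.min 1 (e / (C + 1)).
have d0 : 0 < d by rewrite lt_min ltr01 divr_gt0.
apply: le_trans (H d d0 _) _; first by rewrite ge_min lexx.
apply: (@le_trans _ _ (C * (e / (C + 1)))).
  by rewrite ler_wpM2l// ge_min lexx orbT.
rewrite mulrA ler_pdivrMr// mulrC; apply: ler_wpM2l; first exact: ltW.
by rewrite lerDl.
Qed.

Lemma ltr_inv_nat (R : realType) (e : R) : 0 < e -> exists N, forall k, (N <= k)%N -> k.+1%:R^-1 <= e.
Proof.
move=> e0; exists (Num.bound e^-1) => k Nk.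
rewrite -[leRHS]invrK lef_pV2 ?posrE ?invr_gt0//.
apply: le_trans (ltW (archi_boundP _)) _; first by rewrite invr_ge0 ltW.
by rewrite ler_nat leqW.
Qed.

Section uniform.
Context {R : realType} {n : nat}.
Implicit Types (F : cuntz n -> R[i]^o) (u : nat -> cuntz n -> R[i]^o).

Lemma uniform_cvg_of_sup u F :
  (forall e : R, 0 < e -> exists N, forall m, (N <= m)%N -> forall g, cabs (F g - u m g) <= e) ->
  {uniform, u @ \oo --> F}.
Proof.
move=> H P /uniform_nbhs[E [entE EP]].
move: entE; rewrite -entourage_ballE => -[e /= e0 eE].
have e0' : 0 < Re e by rewrite -ltcR RRe_real// gtr0_real.
have [N HN] := H (Re e / 2) (divr_gt0 e0' (ltr0n _ 2)).
exists N => // m /= Nm; apply: EP => /= g _; apply: eE => /=.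
rewrite -ball_normE /= rnormE -[e]RRe_real ?gtr0_real// ltcR.
by apply: le_lt_trans (HN m Nm g) _; rewrite ltr_pdivrMr// ltr_pMr// ltr1n.
Qed.

Lemma uniform_cvg_ptws u F g : {uniform, u @ \oo --> F} -> (fun m => u m g) @ \oo --> F g.
Proof.
move=> uF P; rewrite -nbhs_entourageE => -[E entE EP].
have : nbhs (F : {uniform` [set: cuntz n] -> R[i]^o})
    [set h | forall y, [set: cuntz n] y -> E (F y, h y)].
  by apply/uniform_nbhs; exists E; split.
move=> /uF[N _ HN]; exists N => // m /HN /= /(_ g Logic.I) h; apply: EP.
by apply/xsectionP.
Qed.

End uniform.

Section Cc_linear.
Context {R : realType} {n : nat}.
Implicit Types f h : cuntz n -> R[i]^o.

Lemma Cc_linear (c : R[i]) f h : Cc f -> Cc h -> Cc (fun g => c * f g + h g : R[i]^o).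
Proof.
move=> [cf kf] [ch kh]; split.
  move=> g; apply: (@cvgD _ R[i]^o _ _ (nbhs_filter g)); last exact: ch.
  by apply: (@cvgM R[i] _ _ (nbhs_filter g)); [exact: cvg_cst|exact: cf].
apply: (subclosed_compact (@closed_closure _ _) (compactU kf kh)).
rewrite -closureU; apply: closure_subset => g /= ne.
have [f0|?] := eqVneq (f g) 0; last by left.
by right; apply: contra_neq ne => ->; rewrite f0 mulr0 addr0.
Qed.

Lemma Cc_sub f h : Cc f -> Cc h -> Cc (fun g => f g - h g : R[i]^o).
Proof.
move=> Cf Ch; have := Cc_linear (-1) Ch Cf.
by congr Cc; apply/funext => g; rewrite mulN1r addrC.
Qed.

End Cc_linear.

(** * Values, injectivity and products of elements as functions *)

Section as_fun.
Context {R : realType} {n : nat} (x0 : infword n).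
Context {A : cstarAlg R} {iota : (cuntz n -> R[i]^o) -> A} (hA : is_groupoid_cstar iota).
Implicit Types (f h : cuntz n -> R[i]^o) (a b : A) (g : cuntz n).
Local Notation afun := (as_fun iota).

Lemma iota_sub f h : Cc f -> Cc h -> iota (fun g => f g - h g) = iota f - iota h.
Proof.
move=> Cf Ch; have := iota_linear hA (-1) Ch Cf.
rewrite scaleN1r [RHS]addrC => <-.
by congr iota; apply/funext => g; rewrite mulN1r addrC.
Qed.

Lemma iota_sup f h g : Cc f -> Cc h -> cabs (f g - h g) <= rnorm (iota f - iota h).
Proof.
move=> Cf Ch; have Cfh := Cc_sub Cf Ch; rewrite -iota_sub//.
exact: (regbound_sup g Cfh (iota_regbound x0 hA Cfh)).
Qed.

Lemma Cc_dense a (e : R) : 0 < e -> exists f, Cc f /\ rnorm (iota f - a) <= e.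
Proof.
move=> e0.
have ne : interior (ball a e%:C) !=set0.
  exists a; apply: nbhs_singleton; apply: nbhs_interior; apply: nbhsx_ballx.
  by rewrite ltcR.
have [v] := iota_dense hA ne (@open_interior _ _).
move=> [/interior_subset + [f Cf fv]].
rewrite -fv -ball_normE /= rnormE ltcR => h; exists f; split=> //.
by rewrite rnormB ltW.
Qed.

Lemma locconst_dense a (e : R) : 0 < e -> exists m f, locconst m f /\ rnorm (iota f - a) <= e.
Proof.
move=> e0; have e20 : 0 < e / 2 by rewrite divr_gt0.
have [f [Cf fa]] := Cc_dense a e20.
have [C [C0 HC]] := Cc_approx x0 Cf.
have C1 : 0 < C + 1 by rewrite ltr_pwDr.
have [m [f' [lf' Hf']]] := HC (e / 2 / (C + 1)) (divr_gt0 e20 C1).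
exists m, f'; split=> //; have Cf' := locconst_Cc lf'.
rewrite -(subrK (iota f) (iota f')) -addrA (splitr e).
apply: le_trans (ler_rnormD _ _) _; apply: lerD => //.
rewrite -iota_sub//; apply: le_trans (iota_le_Inorm x0 hA (Cc_sub Cf' Cf)) _.
apply: le_trans Hf' _; rewrite mulrA ler_pdivrMr// mulrC; apply: ler_wpM2l; first exact: ltW.
by rewrite lerDl.
Qed.

Lemma locconst_seq a : exists u : nat -> cuntz n -> R[i]^o,
  forall k, (exists m, locconst m (u k)) /\ rnorm (iota (u k) - a) <= k.+1%:R^-1.
Proof.
have : forall k : nat, exists f, (exists m, locconst m f) /\ rnorm (iota f - a) <= k.+1%:R^-1.
  move=> k; have [|m [f [lf fa]]] := @locconst_dense a k.+1%:R^-1; first by rewrite invr_gt0.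
  by exists f; split=> //; exists m.
by move=> /choice[u hu]; exists u.
Qed.

(** The default of [xget] is never taken: approximants of a are uniformly Cauchy because the C*-norm
    dominates the uniform norm. *)
Lemma as_fun_spec a : exists u : nat -> cuntz n -> R[i]^o,
  [/\ forall m, Cc (u m), iota (u m) @[m --> \oo] --> a & {uniform, u @ \oo --> (afun a)}].
Proof.
suff [F HF] : exists F : cuntz n -> R[i]^o, exists u : nat -> cuntz n -> R[i]^o,
    [/\ forall m, Cc (u m), iota (u m) @[m --> \oo] --> a & {uniform, u @ \oo --> F}].
  rewrite /as_fun; case: xgetP => [G _ //|noF].
  by exfalso; exact: (noF F HF).
have [u hu] := locconst_seq a.
have Cu k : Cc (u k) by have [[m lu] _] := hu k; exact: locconst_Cc lu.
have cu g (e : R) : 0 < e -> exists N, forall k, (N <= k)%N -> forall l, (N <= l)%N ->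
    cabs (u k g - u l g) <= e.
  move=> e0; have [N HN] := ltr_inv_nat (divr_gt0 e0 (ltr0n _ 2)).
  exists N => k Nk l Nl; apply: le_trans (iota_sup g (Cu k) (Cu l)) _.
  rewrite -(subrK a (iota (u k))) -addrA (splitr e).
  apply: le_trans (ler_rnormD _ _) _; apply: lerD.
    exact: le_trans (hu k).2 (HN _ Nk).
  by rewrite rnormB; exact: le_trans (hu l).2 (HN _ Nl).
have lim g : exists l : R[i]^o, (fun k => u k g) @ \oo --> l.
  apply: complex_cauchy_cvg => e /(cu g)[N HN]; exists (u N g).
  by exists N => // k /= Nk; exact: HN.
have [F HF] := choice lim.
exists F, u; split=> //.
  apply/rnorm_seqP => e /ltr_inv_nat[N HN]; exists N => k Nk.
  by rewrite rnormB; exact: le_trans (hu k).2 (HN _ Nk).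
apply: uniform_cvg_of_sup => e e0; have [N HN] := ltr_inv_nat (divr_gt0 e0 (ltr0n _ 2)).
exists N => k Nk g; rewrite rnormB.
have cv : (fun l => cabs (u k g - u l g)) @ \oo --> cabs (u k g - F g).
  by apply: cvg_rnorm; apply: cvgB; [exact: cvg_cst|exact: HF].
apply: (cvg_le_bound _ cv); exists N => // l /= Nl.
apply: le_trans (iota_sup g (Cu k) (Cu l)) _.
rewrite -(subrK a (iota (u k))) -addrA (splitr e).
apply: le_trans (ler_rnormD _ _) _; apply: lerD.
  exact: le_trans (hu k).2 (HN _ Nk).
by rewrite rnormB; exact: le_trans (hu l).2 (HN _ Nl).
Qed.

(** The inequality for two functions in C_c passes to the limit along any admissible sequence; it
    removes all dependence on the function chosen by [as_fun]. *)
Lemma as_fun_dist a f g : Cc f -> cabs (f g - afun a g) <= rnorm (iota f - a).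
Proof.
move=> Cf; have [u [Cu ua /(@uniform_cvg_ptws _ _ _ _ g) uF]] := as_fun_spec a.
have cv : (fun k => cabs (f g - u k g) - rnorm (iota f - iota (u k))) @ \oo -->
    cabs (f g - afun a g) - rnorm (iota f - a).
  apply: cvgB.
    by apply: cvg_rnorm; apply: cvgB; [exact: cvg_cst|exact: uF].
  by apply: cvg_rnorm; apply: cvgB; [exact: cvg_cst|exact: ua].
rewrite -subr_le0; apply: (cvg_le_bound _ cv); apply: nearW => k.
by rewrite subr_le0; exact: iota_sup.
Qed.

Lemma Cc0 : @Cc R n (fun=> 0).
Proof. by apply: (@locconst_Cc _ _ 0); split=> // g; rewrite eqxx. Qed.

Lemma as_fun_le a g : cabs (afun a g) <= rnorm a.
Proof.
by have := as_fun_dist a g Cc0; rewrite (iota0 hA) !sub0r !rnormN.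
Qed.

Lemma as_fun_iota f : Cc f -> (afun (iota f)) = f.
Proof.
move=> Cf; apply/funext => g; have := as_fun_dist (iota f) g Cf.
rewrite subrr rnorm0 => h; apply/eqP; rewrite eq_sym -subr_eq0; apply/eqP.
by apply: (@rnorm_eq0 _ R[i]^o); apply/le_anti; rewrite h rnorm_ge0.
Qed.

Lemma as_fun_linear (c : R[i]) a b g : (afun (c *: a + b)) g = c * afun a g + afun b g.
Proof.
apply/eqP; rewrite -subr_eq0; apply/eqP.
apply: (@small_eq0 _ R[i]^o _ (2 * (cabs c + 1))).
  by rewrite mulr_ge0// addr_ge0// rnorm_ge0.
move=> e e0 _.
have [f [Cf fa]] := Cc_dense a e0; have [h [Ch hb]] := Cc_dense b e0.
have Cfh := Cc_linear c Cf Ch.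
have h1 := as_fun_dist (c *: a + b) g Cfh.
have h2 := le_trans (as_fun_dist a g Cf) fa; have h3 := le_trans (as_fun_dist b g Ch) hb.
have h4 : rnorm (iota (fun g => c * f g + h g) - (c *: a + b)) <= cabs c * e + e.
  rewrite (iota_linear hA)// opprD addrACA -scalerBr.
  apply: le_trans (ler_rnormD _ _) _; by rewrite rnormZ lerD// ler_wpM2l ?rnorm_ge0.
have E (z x y u v : R[i]) : z - (c * x + y) = - (c * u + v - z) + (c * (u - x) + (v - y)).
  by ring.
rewrite (E _ _ _ (f g) (h g)).
apply: le_trans (ler_rnormD _ _) _; rewrite rnormN.
apply: le_trans (lerD (le_trans h1 h4) (ler_rnormD _ _)) _.
rewrite cabsM.
have := ler_wpM2l (rnorm_ge0 (c : R[i]^o)) h2; move: h3 (rnorm_ge0 (c : R[i]^o)); lra.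
Qed.

Lemma as_funB a b g : (afun (a - b)) g = afun a g - afun b g.
Proof. by have := as_fun_linear (-1) b a g; rewrite scaleN1r mulN1r addrC => ->; rewrite addrC. Qed.

Lemma as_funZ c a g : (afun (c *: a)) g = c * afun a g.
Proof.
have := as_fun_linear c a 0 g; rewrite addr0 => ->.
have : cabs ((afun 0) g) <= 0 by rewrite (le_trans (as_fun_le 0 g))// rnorm0.
move=> h; have -> : (afun 0) g = 0; last by rewrite addr0.
by apply: (@rnorm_eq0 _ R[i]^o); apply/le_anti; rewrite h rnorm_ge0.
Qed.

Local Notation I := (int * infword n)%type.
Local Notation H := (l2 R I).
Implicit Types (s t : {fset I}) (p q r : I).

Lemma lreg_fin m f s (y : I -> R[i]^o) p : locconst m f ->
  lreg f (l2fin s y) p = \sum_(q <- s) convmx f p q * y q.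
Proof.
move=> lf; have [Q [M bf]] := Cc_bsupp (locconst_Cc lf); have [_ sf _] := bf.
rewrite (lregE _ _ bf) (@mxappE _ _ _ _ _ (s `|` krow Q p)%fset); last first.
  by move=> q /(krowP sf); rewrite inE orbC => ->.
rewrite -(@big_fset_incl _ _ _ _ s) ?fsubsetUl//; last first.
  by move=> q _ qs; rewrite l2finE (negbTE qs) mulr0.
by apply: eq_big_seq => q qs; rewrite l2finE qs.
Qed.

Lemma convmx_sub f h p q : convmx (fun g => f g - h g) p q = convmx f p q - convmx h p q.
Proof. by rewrite /convmx /evg; case: pselect => // ?; rewrite subr0. Qed.

Lemma convmx_le (C : R) f p q : 0 <= C -> (forall g, cabs (f g) <= C) -> cabs (convmx f p q) <= C.
Proof. by move=> C0 fC; rewrite /convmx /evg; case: pselect => // ?; rewrite rnorm0. Qed.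

(** Let f be locally constant within e of a, and let u k tend to a, hence to 0 uniformly. On
    finitely supported vectors and finitely many coordinates, [lreg f] is the limit of the operators
    of f - u k, whose bounds are eventually at most 2 e. By isometry iota f has norm at most 2 e,
    and a at most 3 e. *)
Lemma as_fun_inj a : (forall g, afun a g = 0) -> a = 0.
Proof.
move=> a0; apply: (@small_eq0 _ _ _ 3) => // e e0 _.
have [m [f [lf fa]]] := locconst_dense a e0.
have e20 : 0 <= 2 * e by rewrite mulr_ge0// ltW.
have [u hu] := locconst_seq a.
have [N HN] := ltr_inv_nat e0.
have Cu k : Cc (u k) by have [[? lu] _] := hu k; exact: locconst_Cc lu.
have fin s (y : I -> R[i]^o) t : ssq (lreg f (l2fin s y)) t <= (2 * e) ^+ 2 * ssq y s.
  have lu k : exists m', locconst m' (fun g => f g - u k g).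
    have [[m' lm'] _] := hu k; exists (m + m')%N.
    have := locconst_linear (-1) (locconst_le (leq_addl m m') lm') (locconst_le (leq_addr m' m) lf).
    by congr locconst; apply/funext => g; rewrite mulN1r addrC.
  have cvq p q : (fun k => convmx (u k) p q : R[i]^o) @ \oo --> (0 : R[i]^o).
    apply/rnorm_seqP => d /ltr_inv_nat[N' HN']; exists N' => k Nk.
    rewrite sub0r rnormN; apply: le_trans (HN' k Nk); apply: convmx_le.
      by rewrite invr_ge0.
    by move=> g; have := le_trans (as_fun_dist a g (Cu k)) (hu k).2; rewrite a0 subr0.
  have cv : (fun k => ssq (lreg (fun g => f g - u k g) (l2fin s y)) t) @ \oo -->
      ssq (lreg f (l2fin s y)) t.
    apply: cvg_sumR => p; apply: cvg_nsq.
    have -> : (fun k => lreg (fun g => f g - u k g) (l2fin s y) p) =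
        (fun k => \sum_(q <- s) (convmx f p q - convmx (u k) p q) * y q : R[i]^o).
      apply/funext => k; have [m' lm'] := lu k; rewrite (lreg_fin _ _ _ lm').
      by apply: eq_bigr => q _; rewrite convmx_sub.
    rewrite (lreg_fin _ _ _ lf); apply: cvg_sumr => q.
    apply: (@cvgM R[i]); last exact: cvg_cst.
    rewrite -[X in _ --> X]subr0; apply: (@cvgB _ R[i]^o); [exact: cvg_cst|exact: cvq].
  apply: (cvg_le_bound _ cv); exists N => // k /= Nk.
  apply: le_trans (ssq_le _ _) _; rewrite -(l2nrm_l2fin s y) -exprMn.
  rewrite ler_sqr ?nnegrE ?mulr_ge0 ?l2nrm_ge0//; last exact: ltW.
  have Cfu := Cc_sub (locconst_Cc lf) (Cu k).
  apply: le_trans (iota_regbound x0 hA Cfu _) _; rewrite rnorm_l2 ler_wpM2r ?l2nrm_ge0//.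
  rewrite iota_sub//; last exact: locconst_Cc lf.
  rewrite -(subrK a (iota f)) -addrA (le_trans (ler_rnormD _ _))//.
  rewrite mulr_natl mulr2n lerD// rnormB; exact: le_trans (hu k).2 (HN k Nk).
have rf : regbound (2 * e) f.
  move=> xi; rewrite !rnorm_l2; apply: l2nrm_le => [|t]; first by rewrite mulr_ge0 ?l2nrm_ge0.
  have [Q [M bf]] := Cc_bsupp (locconst_Cc lf); have [_ sf _] := bf.
  have [s hs] := row_finite_seq t (convmx_row_finite sf).
  have -> : ssq (lreg f xi) t = ssq (lreg f (l2fin s xi)) t.
    rewrite /ssq; apply: eq_big_seq => p pt; congr nsq.
    by rewrite (lreg_fin s xi p lf) (lregE xi p bf) (mxappE _ (hs p pt)).
  apply: le_trans (fin s xi t) _; rewrite [leRHS]exprMn.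
  by rewrite ler_wpM2l ?sqr_ge0// ssq_le.
have fe := locconst_isometry x0 hA lf e20 rf.
rewrite -(subrK (iota f) a) (le_trans (ler_rnormD _ _))// rnormB.
by move: fa fe; lra.
Qed.

Lemma col_le m f q t : locconst m f -> \sum_(p <- t) nsq (convmx f p q) <= rnorm (iota f) ^+ 2.
Proof.
move=> lf; pose d : H := l2fin [fset q]%fset (fun=> 1).
have nd : l2nrm d ^+ 2 = 1 by rewrite l2nrm_l2fin /ssq big_seq_fset1 nsqE cabs1 expr1n.
have := ssq_le (lreg f d) t; rewrite /ssq.
under eq_bigr do rewrite (lreg_fin _ _ _ lf) big_seq_fset1 mulr1.
move=> /le_trans; apply; rewrite -[leRHS]mulr1 -nd -exprMn.
rewrite ler_sqr ?nnegrE ?mulr_ge0 ?l2nrm_ge0 ?rnorm_ge0//.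
exact: (iota_regbound x0 hA (locconst_Cc lf)).
Qed.

(** Rows of f are columns of its adjoint, whose norm is no larger by the C*-identity. *)
Lemma row_le m f p t : locconst m f -> \sum_(q <- t) nsq (convmx f p q) <= rnorm (iota f) ^+ 2.
Proof.
move=> lf; have := col_le p t (locconst_fstar lf).
rewrite convmx_fstar; under eq_bigr do rewrite /adjmx nsqJ.
move=> /le_trans; apply; rewrite (iota_star hA); last exact: locconst_Cc lf.
have nf : rnorm (cadj (iota f)) <= rnorm (iota f).
  set a := iota f; have [->|n0] := eqVneq (cadj a) 0; first by rewrite rnorm0 rnorm_ge0.
  have nv : 0 < rnorm (cadj a).
    rewrite lt_def rnorm_ge0 andbT; apply: contra_neq n0; exact: rnorm_eq0.
  rewrite -(ler_pM2l nv) -expr2 -rnorm_cstar cadjK mulrC.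
  exact: rnorm_cmul.
by rewrite ler_sqr ?nnegrE ?rnorm_ge0.
Qed.

Lemma convmx_cvg (u : nat -> cuntz n -> R[i]^o) (F : cuntz n -> R[i]^o) p q :
  (forall g, (fun k => u k g) @ \oo --> F g) ->
  (fun k => convmx (u k) p q : R[i]^o) @ \oo --> (convmx F p q : R[i]^o).
Proof.
by move=> uF; rewrite /convmx /evg; case: pselect => [h|_]; [exact: uF|exact: cvg_cst].
Qed.

Lemma locconst_seq_cvg a (u : nat -> cuntz n -> R[i]^o) :
  (forall k, (exists m, locconst m (u k)) /\ rnorm (iota (u k) - a) <= k.+1%:R^-1) ->
  (iota (u k) @[k --> \oo] --> a) /\ (forall g, (fun k => u k g) @ \oo --> afun a g).
Proof.
move=> hu; split=> [|g]; apply/rnorm_seqP => e /ltr_inv_nat[N HN]; exists N => k Nk;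
    rewrite rnormB.
  exact: le_trans (hu k).2 (HN k Nk).
have [[m lu] ua] := hu k.
exact: le_trans (as_fun_dist a g (locconst_Cc lu)) (le_trans ua (HN k Nk)).
Qed.

(** [pq] runs along a row or a column, so one passage to the limit serves both. *)
Lemma line_dist m f a t (pq : I -> I * I) :
  (forall m' h, locconst m' h -> \sum_(i <- t) nsq (convmx h (pq i).1 (pq i).2) <= rnorm (iota h) ^+ 2) ->
  locconst m f -> \sum_(i <- t) nsq (convmx f (pq i).1 (pq i).2 - convmx (afun a) (pq i).1 (pq i).2)
    <= rnorm (iota f - a) ^+ 2.
Proof.
move=> le lf; have [u hu] := locconst_seq a; have [ua uF] := locconst_seq_cvg hu.
have lu k : exists m', locconst m' (fun g => f g - u k g).
  have [[m' lm'] _] := hu k; exists (m + m')%N.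
  have := locconst_linear (-1) (locconst_le (leq_addl m m') lm') (locconst_le (leq_addr m' m) lf).
  by congr locconst; apply/funext => g; rewrite mulN1r addrC.
have cv : (fun k => \sum_(i <- t) nsq (convmx f (pq i).1 (pq i).2 - convmx (u k) (pq i).1 (pq i).2)
     - rnorm (iota f - iota (u k)) ^+ 2) @ \oo -->
    \sum_(i <- t) nsq (convmx f (pq i).1 (pq i).2 - convmx (afun a) (pq i).1 (pq i).2)
     - rnorm (iota f - a) ^+ 2.
  apply: cvgB.
    apply: cvg_sumR => i; apply: cvg_nsq; apply: cvgB; [exact: cvg_cst|exact: convmx_cvg].
  have c : (fun k => rnorm (iota f - iota (u k))) @ \oo --> rnorm (iota f - a).
    by apply: cvg_rnorm; apply: cvgB; [exact: cvg_cst|].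
  by rewrite expr2; under eq_cvg do rewrite expr2; exact: cvgM.
rewrite -subr_le0; apply: (cvg_le_bound _ cv); apply: nearW => k; rewrite subr_le0.
have [m' lm'] := lu k; have [[m2 lk] _] := hu k.
rewrite -iota_sub; [|exact: locconst_Cc lf|exact: locconst_Cc lk].
apply: le_trans (le _ _ lm').
by apply: ler_sum => i _; rewrite convmx_sub.
Qed.

Lemma locconst0 : @locconst R n 0 (fun=> 0).
Proof. by split=> // g; rewrite eqxx. Qed.

Lemma row_dist m f a p t : locconst m f ->
  \sum_(q <- t) nsq (convmx f p q - convmx (afun a) p q) <= rnorm (iota f - a) ^+ 2.
Proof. by move=> lf; apply: (@line_dist m f a t (fun q => (p, q))) lf => m' h; exact: row_le. Qed.

Lemma col_dist m f a q t : locconst m f ->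
  \sum_(p <- t) nsq (convmx f p q - convmx (afun a) p q) <= rnorm (iota f - a) ^+ 2.
Proof. by move=> lf; apply: (@line_dist m f a t (fun p => (p, q))) lf => m' h; exact: col_le. Qed.

Lemma row_as_fun a p t : \sum_(q <- t) nsq (convmx (afun a) p q) <= rnorm a ^+ 2.
Proof.
have := row_dist a p t locconst0; rewrite (iota0 hA) sub0r rnormN; apply: le_trans.
by apply: ler_sum => q _; rewrite {2}/convmx /evg; case: pselect => ?; rewrite sub0r nsqN.
Qed.

(** Rows and columns of general elements are only square summable. Replacing a and b by locally
    constant f and h costs, by Cauchy-Schwarz, the row distance from f to a times a column of h,
    plus a row of a times the column distance from h to b, uniformly over finite index sets. *)
Lemma as_fun_mul a b g s :
  (forall q, convmx (afun a) (0, grange g) q != 0 ->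
     convmx (afun b) q (0 - gdeg g, gsource g) != 0 -> q \in s) ->
  (afun (cmul a b)) g =
    \sum_(q <- s) convmx (afun a) (0, grange g) q * convmx (afun b) q (0 - gdeg g, gsource g).
Proof.
set p := (0, grange g); set r := (0 - gdeg g, gsource g) => hs.
apply/eqP; rewrite -subr_eq0; apply/eqP.
pose C := (rnorm b + 1) + rnorm a.
have C0 : 0 <= C by rewrite !addr_ge0// rnorm_ge0.
apply: (@small_eq0 _ R[i]^o _ (2 * C)); first by rewrite mulr_ge0.
move=> e e0 e1.
have [m [f [lf fa]]] := locconst_dense a e0; have [m' [h [lh hb]]] := locconst_dense b e0.
have Cf := locconst_Cc lf; have Ch := locconst_Cc lh; have Cfh := locconst_Cc (locconst_convolution lf lh).
have nh : rnorm (iota h) <= rnorm b + 1.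
  rewrite -(subrK b (iota h)) addrC (le_trans (ler_rnormD _ _))// lerD2l.
  exact: le_trans hb e1.
(* Large enough for the convolution of f and h as well; the points added to s contribute nothing to
   the sum for a and b. *)
pose S := (s `|` krow (Qlc m) p)%fset.
have cE : convolution f h g = \sum_(q <- S) convmx f p q * convmx h q r.
  apply: convolutionE => q /(krowP (locconst_suppin lf)) qk.
  by rewrite in_fsetU qk orbT.
have sE : \sum_(q <- s) convmx (afun a) p q * convmx (afun b) q r =
    \sum_(q <- S) convmx (afun a) p q * convmx (afun b) q r.
  apply: big_fset_incl; first exact: fsubsetUl.
  move=> q _; apply: contraNeq; rewrite mulf_eq0 negb_or => /andP[]; exact: hs.
have d1 : cabs ((afun (cmul a b)) g - convolution f h g) <= C * e.
  rewrite rnormB; apply: le_trans (as_fun_dist _ g Cfh) _.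
  rewrite (iota_conv hA)//; apply: le_trans (cmul_dist fa hb) _.
  rewrite /C mulrDl [e * _]mulrC; rewrite lerD2r; apply: ler_wpM2r; first exact: ltW.
  by rewrite lerD2l.
have d2 : cabs (convolution f h g - \sum_(q <- s) convmx (afun a) p q * convmx (afun b) q r) <= C * e.
  rewrite cE sE -sumrB.
  rewrite (eq_bigr (fun q => (convmx f p q - convmx (afun a) p q) * convmx h q r +
      convmx (afun a) p q * (convmx h q r - convmx (afun b) q r))); last by move=> q _; ring.
  have CS (x y : I -> R[i]) (X Y : R) : 0 <= X -> 0 <= Y -> \sum_(q <- S) nsq (x q) <= X ^+ 2 ->
      \sum_(q <- S) nsq (y q) <= Y ^+ 2 -> cabs (\sum_(q <- S) x q * y q) <= X * Y.
    move=> X0 Y0 hX hY; rewrite -ler_sqr ?nnegrE ?rnorm_ge0 ?mulr_ge0// -nsqE exprMn.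
    apply: le_trans (cauchy_schwarz_cabs _ _ _) _.
    by apply: ler_pM => //; apply: sumr_ge0 => *; exact: nsq_ge0.
  have sqle (x y : R) : 0 <= x -> x <= y -> x ^+ 2 <= y ^+ 2.
    by move=> x0' xy; rewrite ler_sqr ?nnegrE// (le_trans x0').
  rewrite big_split /=; apply: le_trans (ler_rnormD _ _) _; rewrite /C mulrDl.
  apply: lerD; last first.
    apply: CS; [exact: rnorm_ge0|exact: ltW|exact: row_as_fun|].
    by apply: le_trans (col_dist _ _ _ lh) _; apply: sqle; rewrite ?rnorm_ge0.
  rewrite mulrC; apply: CS; [exact: ltW|by rewrite addr_ge0 ?rnorm_ge0| |].
    by apply: le_trans (row_dist _ _ _ lf) _; apply: sqle; rewrite ?rnorm_ge0.
  by apply: le_trans (col_le _ _ lh) _; apply: sqle; rewrite ?rnorm_ge0.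
rewrite -(subrK (convolution f h g) ((afun (cmul a b)) g)) -addrA.
apply: le_trans (ler_rnormD _ _) _.
by rewrite -mulrA mulr_natl mulr2n lerD.
Qed.

End as_fun.

(** * The set P_V *)

Section PV.
Context {n : nat}.
Local Notation X := (infword n).
Implicit Types (x y z : X) (a b : seq 'I_n) (g : cuntz n).

Lemma lexi_wcat a b x y : size a = size b ->
  ((a : seqlexi 'I_n) < b)%O <->
  exists m, [/\ (m < size a)%N, forall i, (i < m)%N -> wcat a x i = wcat b y i
    & (wcat a x m < wcat b y m)%N].
Proof.
elim: a b => [|u a IH] [|v b] //; first by move=> _; split=> // -[m []].
move=> /= /succn_inj ab.
rewrite ltxi_cons leEord; split=> [/andP[uv]|[m [ma mlt hm]]].
  move=> /implyP h; have [vu|vu] := leqP v u.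
    have /(IH b ab)[m [ma mlt hm]] := h vu.
    have e : u = v by apply/val_inj/anti_leq; rewrite uv vu.
    by exists m.+1; split=> // -[|i] //=; rewrite ltnS => /mlt.
  by exists 0%N; split.
case: m ma mlt hm => [|m] ma mlt hm; first by rewrite (ltnW hm) leqNgt hm.
have e : u = v := mlt 0%N isT.
rewrite e leqnn /=; apply/(IH b ab); exists m; split=> // i im.
exact: (mlt i.+1).
Qed.

Lemma lexi_mkseq x y m k : (forall i, (i < m)%N -> x i = y i) -> (x m < y m)%N -> (m < k)%N ->
  ((mkseq x k : seqlexi 'I_n) < mkseq y k)%O.
Proof.
move=> e lt mk; apply/(lexi_wcat (wtail k x) (wtail k y)); rewrite ?size_mkseq//.
by exists m; rewrite !wcat_mkseq.
Qed.

Lemma take_mkseq x (i j : nat) : (i <= j)%N -> take i (mkseq x j) = mkseq x i.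
Proof. by move=> ij; rewrite /mkseq -map_take take_iota (minn_idPl ij). Qed.

Lemma lexi_infword_lt a b x y : size a = size b -> ((a : seqlexi 'I_n) < b)%O ->
  infword_lt (wcat a x) (wcat b y).
Proof. by move=> ab /(lexi_wcat x y ab)[m [_ h1 h2]]; exists m. Qed.

Lemma infword_lt_wcat a x y : infword_lt x y -> infword_lt (wcat a x) (wcat a y).
Proof.
move=> [m [h1 h2]]; exists (size a + m)%N; split=> [i im|].
  have [ia|ai] := ltnP i (size a); first exact: wcatL.
  by rewrite !wcatR// h1// ltn_subLR.
by rewrite !wcatR ?leq_addr// addKn.
Qed.

(* Prefixing a nonempty constant word c...c moves a sequence towards ccc... *)
Lemma wcat_const (c : 'I_n) d z : all (pred1 c) d -> (0 < size d)%N ->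
  (forall i, z i = c) \/ exists i0, [/\ z i0 != c, wcat d z i0 = c &
    forall i, (i < i0)%N -> z i = c /\ wcat d z i = c].
Proof.
move=> /allP dc d0; have [h|/existsNP ex] := pselect (forall i, z i = c); first by left.
right; have ex' : exists i, z i != c by have [i /eqP ?] := ex; exists i.
exists (ex_minn ex'); case: ex_minnP => i0 zi0 min.
have small i : (i < i0)%N -> z i = c.
  by move=> ii0; apply/eqP/negPn/negP => /min; rewrite leqNgt ii0.
have pre i : (i <= i0)%N -> wcat d z i = c.
  move=> ii0; have [id|di] := ltnP i (size d).
    by apply/eqP/dc; rewrite /wcat mem_nth.
  rewrite wcatR//; apply: small; apply: leq_trans ii0.
  by rewrite ltn_subrL d0 (leq_trans d0 di).
by split=> // [|i ii0]; [exact: pre|split; [exact: small|apply: pre; exact: ltnW]].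
Qed.

Definition ev_const (P : pred nat) x := exists N, forall i, (N <= i)%N -> P (x i).

Definition isotropy_ok g := [\/ gdeg g = 0,
  0 < gdeg g /\ ev_const (fun k => k == 0%N) (grange g) |
  gdeg g < 0 /\ ev_const (fun k => k.+1 == n) (grange g)].

(** Unequal prefixes of the common length decide the order. In the remaining unequal-length cases
    the longer word adds a block d of letters n or 1, and z is compared with d z: they agree only
    for the constant sequence, which gives isotropy, and otherwise differ in the right direction at
    the first letter of z unlike the block. *)
Lemma PV_elim g : PV g -> infword_lt (grange g) (gsource g) \/
  grange g = gsource g /\ isotropy_ok g.
Proof.
move=> [a [b [w [z /= [rg dg sg]]]]].
have [|] := boolP (size a == size b) => [/eqP ab|ab].
  case: w => [[_ le]|[]|[]|[[]|[]]]; rewrite ?ab ?ltnn//.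
  move: le; rewrite le_eqVlt => /orP[/eqP e|lt].
    by right; rewrite rg sg e; split=> //; apply: Or31; rewrite dg ab subrr.
  by left; rewrite rg sg; exact: lexi_infword_lt.
have wdrop (c d : seq 'I_n) : (size c < size d)%N ->
    wcat d z = wcat (take (size c) d) (wcat (drop (size c) d) z).
  by move=> _; rewrite -wcat_cat cat_take_drop.
case: w => [[e]|[lt w]|[lt e al]|[[lt w]|[lt e al]]].
- by rewrite e eqxx in ab.
- left; rewrite rg sg (wdrop a b)//; apply: lexi_infword_lt => //.
  by rewrite size_takel// ltnW.
- have n0 : (0 < n)%N.
    by case: (b) lt => // u ? _; exact: leq_ltn_trans (ltn_ord u).
  have n1 : (n.-1 < n)%N by rewrite prednK.
  pose c := Ordinal n1.
  have al' : all (pred1 c) (drop (size a) b).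
    apply: sub_all al => u /= /eqP un; apply/eqP/val_inj => /=; lia.
  have d0 : (0 < size (drop (size a) b))%N by rewrite size_drop subn_gt0.
  have bE : wcat b z = wcat a (wcat (drop (size a) b) z) by rewrite {1}(wdrop a b lt) -e.
  have [zc|[i0 [zi0 wi0 small]]] := wcat_const z al' d0.
    have e' : wcat (drop (size a) b) z = z.
      apply/funext => i; rewrite zc.
      have [id|di] := ltnP i (size (drop (size a) b)); last by rewrite wcatR// zc.
      by apply/eqP/(allP al'); rewrite /wcat mem_nth.
    right; split; first by rewrite rg sg bE e'.
    apply: Or33; split; first by rewrite dg; lia.
    exists (size a) => i ai; rewrite rg wcatR// zc /=; lia.
  left; rewrite rg sg bE; apply: infword_lt_wcat; exists i0; split.
    by move=> i /small[-> ->].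
  rewrite wi0 /=; have := ltn_ord (z i0).
  have : z i0 != n.-1 :> nat by apply: contra_neq zi0 => ?; apply: val_inj.
  by move: (nat_of_ord (z i0)) => k; lia.
- left; rewrite rg sg (wdrop b a)//; apply: lexi_infword_lt => //.
  by rewrite size_takel// ltnW.
- have n0 : (0 < n)%N.
    by case: (a) lt => // u ? _; exact: leq_ltn_trans (ltn_ord u).
  pose c := Ordinal n0.
  have al' : all (pred1 c) (drop (size b) a).
    by apply: sub_all al => u /= /eqP un; apply/eqP/val_inj.
  have d0 : (0 < size (drop (size b) a))%N by rewrite size_drop subn_gt0.
  have aE : wcat a z = wcat b (wcat (drop (size b) a) z) by rewrite {1}(wdrop b a lt) e.
  have [zc|[i0 [zi0 wi0 small]]] := wcat_const z al' d0.
    have e' : wcat (drop (size b) a) z = z.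
      apply/funext => i; rewrite zc.
      have [id|di] := ltnP i (size (drop (size b) a)); last by rewrite wcatR// zc.
      by apply/eqP/(allP al'); rewrite /wcat mem_nth.
    right; split; first by rewrite rg sg aE e'.
    apply: Or32; split; first by rewrite dg; lia.
    by exists (size b) => i bi; rewrite rg aE e' wcatR// zc.
  left; rewrite rg sg aE; apply: infword_lt_wcat; exists i0; split.
    by move=> i /small[-> ->].
  rewrite wi0 /= lt0n; apply: contra_neq zi0 => ?; exact: val_inj.
Qed.

(** Both words are lengthened beyond the first difference m, so that a strict comparison of prefixes
    applies whatever their lengths. *)
Lemma infword_lt_PV g : infword_lt (grange g) (gsource g) -> PV g.
Proof.
move=> [m [e lt]]; have [a [b [c [ra da sb]]]] := cuntzP g.
have : tailrel (m.+1 + size a) (m.+1 + size b) g.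
  by apply: tailrelD; split=> //; rewrite ra sb !wtail_wcat.
move=> /tailrel_cyl tg.
set i := (m.+1 + _)%N in tg *; set j := (m.+1 + size b)%N in tg *.
have mi : (m < i)%N by rewrite /i; lia.
have mj : (m < j)%N by rewrite /j; lia.
exists (mkseq (grange g) i), (mkseq (gsource g) j); split=> //.
rewrite /PV_words !size_mkseq; have [ij|ji|ij] := ltngtP i j.
- by apply: Or42; split=> //; rewrite take_mkseq ?(ltnW ij)//; exact: lexi_mkseq lt mi.
- by apply: Or44; left; split=> //; rewrite take_mkseq ?(ltnW ji)//; exact: lexi_mkseq lt mj.
- by apply: Or41; split=> //; rewrite -ij; apply: ltW; exact: lexi_mkseq lt mi.
Qed.

Lemma isotropy_PV g : grange g = gsource g -> isotropy_ok g -> PV g.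
Proof.
move=> rs [d0|[d0 [N hN]]|[d0 [N hN]]].
- exists [::], [::]; split; first by apply: Or41; split.
  by exists (grange g) => /=; rewrite d0 -rs; split=> //; apply/funext => i; rewrite wcatR ?subn0.
- have gi : gdeg g = `|gdeg g|%N by rewrite gez0_abs// ltW.
  set k := `|gdeg g|%N in gi; have k0 : (0 < k)%N by lia.
  exists (mkseq (grange g) (N + k)), (mkseq (gsource g) N); split; last first.
    apply: tailrel_cyl; split; first by rewrite gi; lia.
    rewrite -rs; apply/funext => i; apply: val_inj; rewrite /wtail /=.
    by rewrite (eqP (hN _ _)) ?(eqP (hN _ _))//; lia.
  rewrite /PV_words !size_mkseq; apply: Or44; right; split; first by lia.
    by rewrite take_mkseq ?leq_addr// rs.
  apply/(all_nthP (grange g 0%N)) => i; rewrite size_drop size_mkseq => ik.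
  by rewrite nth_drop nth_mkseq; [apply: hN|]; lia.
- have gi : gdeg g = - (`|gdeg g|%N)%:Z by rewrite lez0_abs ?opprK// ltW.
  set k := `|gdeg g|%N in gi; have k0 : (0 < k)%N by lia.
  exists (mkseq (grange g) N), (mkseq (gsource g) (N + k)); split; last first.
    apply: tailrel_cyl; split; first by rewrite gi; lia.
    rewrite -rs; apply/funext => i; apply: val_inj; rewrite /wtail /=.
    apply: succn_inj.
    by rewrite (eqP (hN _ _)) ?(eqP (hN _ _))//; lia.
  rewrite /PV_words !size_mkseq; apply: Or43; split; first by lia.
    by rewrite take_mkseq ?leq_addr// rs.
  apply/(all_nthP (grange g 0%N)) => i; rewrite size_drop size_mkseq => ik.
  by rewrite nth_drop nth_mkseq -?rs; [apply: hN|]; lia.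
Qed.

Lemma infword_lt_trans x y z : infword_lt x y -> infword_lt y z -> infword_lt x z.
Proof.
move=> [m [e lt]] [m' [e' lt']]; exists (minn m m'); split=> [i|].
  by rewrite leq_min => /andP[im im']; rewrite e// e'.
have [mm|mm|mm] := ltngtP m m'; first by rewrite -e'.
  by rewrite e.
by rewrite -mm in lt'; exact: ltn_trans lt lt'.
Qed.

Lemma infword_lt_irr x : ~ infword_lt x x.
Proof. by move=> [m [_]]; rewrite ltnn. Qed.

Lemma ev_const_excl x : (2 <= n)%N -> ev_const (fun k => k == 0%N) x ->
  ev_const (fun k => k.+1 == n) x -> False.
Proof.
move=> n2 [N hN] [M hM].
have /eqP h1 := hN (N + M)%N (leq_addr _ _).
have /eqP := hM (N + M)%N (leq_addl _ _); rewrite h1; lia.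
Qed.

(** Strict inequalities absorb isotropy. Isotropy of opposite signs cannot meet at one point, whose
    letters would be eventually both 1 and n. *)
Lemma PV_mul (n2 : (2 <= n)%N) g1 g2 g : gmul g1 g2 g -> PV g1 -> PV g2 -> PV g.
Proof.
move=> [e12 rg dg sg] /PV_elim[lt1|[rs1 ok1]] /PV_elim[lt2|[rs2 ok2]].
- by apply: infword_lt_PV; rewrite rg sg; apply: infword_lt_trans lt1 _; rewrite e12.
- by apply: infword_lt_PV; rewrite rg sg -rs2 -e12.
- by apply: infword_lt_PV; rewrite rg sg rs1 e12.
- apply: isotropy_PV; first by rewrite rg sg rs1 e12.
  have r12 : grange g1 = grange g2 by rewrite rs1.
  rewrite /isotropy_ok dg rg; rewrite /isotropy_ok -r12 in ok2.
  case: ok1 => [->|[d1 c1]|[d1 c1]]; first by rewrite add0r.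
    case: ok2 => [->|[d2 c2]|[d2 c2]].
    + by rewrite addr0; apply: Or32.
    + by apply: Or32; split=> //; rewrite addr_gt0.
    + by exfalso; exact: ev_const_excl c1 c2.
  case: ok2 => [->|[d2 c2]|[d2 c2]].
  + by rewrite addr0; apply: Or33.
  + by exfalso; exact: ev_const_excl c2 c1.
  + by apply: Or33; split=> //; lia.
Qed.

End PV.

(** * The radical *)

Lemma mem_fset_seq (T : choiceType) (r : seq T) (q : T) :
  (q \in [fset q | q in r]%fset) = (q \in r).
Proof. by rewrite !inE. Qed.

Section radical.
Context {R : realType} {n : nat} (n2 : (2 <= n)%N) (x0 : infword n).
Context {A : cstarAlg R} {iota : (cuntz n -> R[i]^o) -> A} (hA : is_groupoid_cstar iota).
Implicit Types (a b : A) (g : cuntz n).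
Local Notation X := (infword n).
Local Notation I := (int * infword n)%type.
Local Notation afun := (as_fun iota).
Local Notation B := (A_of iota (@PV n)).

(** Without a factorization no intermediate point contributes, so the product formula applies with
    the empty index set. *)
Lemma as_fun_mul_supp a b g : afun (cmul a b) g != 0 ->
  exists g1 g2, [/\ gmul g1 g2 g, afun a g1 != 0 & afun b g2 != 0].
Proof.
apply: contraPP => /forallNP H; apply/negP; rewrite negbK; apply/eqP.
rewrite (as_fun_mul x0 hA (s := fset0)) ?big_seq_fset0// => q.
move=> /convmx_neq0[g1 [/= r1 -> f1]] /convmx_neq0[g2 [/= r2 [] d2 s2 h2]].
by exfalso; apply: (H g1); exists g2; split=> //; split=> //; lia.
Qed.

Lemma A_of_PVP a g : B a -> afun a g != 0 -> PV g.
Proof. by move=> Ba; apply: contraPP => nP; apply/negP; rewrite negbK Ba. Qed.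

Lemma A_of_PV_sub a b : B a -> B b -> B (a - b).
Proof. by move=> Ba Bb g nP; rewrite (as_funB x0 hA) Ba// Bb// subrr. Qed.

Lemma A_of_PV_scale c a : B a -> B (c *: a).
Proof. by move=> Ba g nP; rewrite (as_funZ x0 hA) Ba// mulr0. Qed.

Lemma A_of_PV0 : B 0.
Proof. by move=> g nP; have := as_funZ x0 hA 0 0 g; rewrite scale0r mul0r. Qed.

Lemma A_of_PV_add a b : B a -> B b -> B (a + b).
Proof.
move=> Ba Bb; rewrite -[b]opprK; apply: A_of_PV_sub => //.
by rewrite -scaleN1r; exact: A_of_PV_scale.
Qed.

Lemma A_of_PV_mul a b : B a -> B b -> B (cmul a b).
Proof.
move=> Ba Bb g nP; apply/eqP; apply: contra_notT nP.
move=> /as_fun_mul_supp[g1 [g2 [g12 /(A_of_PVP Ba) P1 /(A_of_PVP Bb) P2]]].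
exact: PV_mul g12 P1 P2.
Qed.

Lemma as_fun_chi ab : afun (iota (chi ab)) = chi ab.
Proof. by apply: (as_fun_iota x0 hA); exact: locconst_Cc (chi_locconst ab). Qed.

Lemma chi_neq0 ab g : @chi R n ab g != 0 -> cyl ab g.
Proof. by rewrite /chi; case: asboolP => //; rewrite eqxx. Qed.

Definition unit_elt : A := iota (chi ([::], [::])).
Local Notation "1u" := unit_elt.

Lemma cyl_unitP g : cyl ([::], [::]) g <-> grange g = gsource g /\ gdeg g = 0.
Proof.
have w0 (z : X) : wcat [::] z = z by apply/funext => i; rewrite wcatR ?subn0.
split=> [[z /= [-> -> ->]]|[e d]]; first by rewrite subrr.
by exists (grange g); rewrite !w0 d subrr -e.
Qed.

Lemma as_fun_unit g : afun 1u g = if `[< grange g = gsource g /\ gdeg g = 0 >] then 1 else 0.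
Proof.
rewrite as_fun_chi /chi; congr (if _ then _ else _).
by apply: asbool_equiv_eq; exact: cyl_unitP.
Qed.

Lemma unit_gpoint g : exists g', [/\ grange g' = grange g, gsource g' = grange g,
  gdeg g' = 0 & afun 1u g' = 1].
Proof.
exists (Cuntz (in_cuntz_refl (grange g))); split=> //=.
by rewrite as_fun_unit; case: asboolP => // -[].
Qed.

Lemma as_fun_unit_neq0 g : afun 1u g != 0 -> grange g = gsource g /\ gdeg g = 0.
Proof. by rewrite as_fun_unit; case: asboolP => //; rewrite eqxx. Qed.

Lemma unit_in_A_of_PV : B 1u.
Proof.
move=> g nP; apply/eqP; apply: contra_notT nP => /as_fun_unit_neq0[e d].
by apply: isotropy_PV => //; apply: Or31.
Qed.

Lemma cmul1u a : cmul 1u a = a.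
Proof.
apply/eqP; rewrite -subr_eq0; apply/eqP; apply: (as_fun_inj x0 hA) => g.
rewrite (as_funB x0 hA) (as_fun_mul x0 hA (s := [fset (0 - 0, grange g)]%fset)).
  rewrite big_seq_fset1; have [g' [r' s' d' e']] := unit_gpoint g.
  have := @convmxE _ _ (afun 1u) 0 g'; rewrite r' s' d' e' => ->.
  by rewrite mul1r subr0 convmxE subrr.
move=> q /convmx_neq0[g1 [/= r1 -> /as_fun_unit_neq0[e d]]] _.
by rewrite inE d -e r1.
Qed.

Lemma cmulu1 a : cmul a 1u = a.
Proof.
apply/eqP; rewrite -subr_eq0; apply/eqP; apply: (as_fun_inj x0 hA) => g.
rewrite (as_funB x0 hA) (as_fun_mul x0 hA (s := [fset (0 - gdeg g, gsource g)]%fset)).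
  rewrite big_seq_fset1 convmxE.
  have [g' [r' s' d' e']] := unit_gpoint (ginv g).
  have := @convmxE _ _ (afun 1u) (0 - gdeg g) g'; rewrite r' s' d' e' /= subr0 => ->.
  by rewrite mulr1 subrr.
move=> q _ /convmx_neq0[g1 [/= r1 [] dq sq /as_fun_unit_neq0[e d]]].
rewrite inE; case: q r1 dq => [k z] /= r1 dq; apply/eqP; congr (_, _).
  by rewrite dq d subr0.
by rewrite -r1 e sq.
Qed.

Lemma cmul0l a : cmul 0 a = 0.
Proof. by have := cmulBl (0 : A) 0 a; rewrite !subrr. Qed.

Lemma cmulZl (c : R[i]) a b : cmul (c *: a) b = c *: cmul a b.
Proof. by have := cmul_linearl c a 0 b; rewrite cmul0l !addr0. Qed.

(** If f is not in M, maximality gives 1 = c + b f with c in M. Then (1 + b f) c = (1 + b f)(1 - b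
    f) = 1, since b f b f = 0, and M contains the unit. *)
Lemma square_zero_radical f : B f -> (forall b, B b -> cmul f (cmul b f) = 0) ->
  jacobson_radical B f.
Proof.
move=> Bf fbf; split=> // M [[MB M0 Msub Mmul] MneB Mmax].
apply: contrapT => nMf.
pose J : set A := [set v | exists c b, [/\ M c, B b & v = c + cmul b f]].
have JB : left_ideal B J.
  split.
  - by move=> _ [c [b [Mc Bb ->]]]; apply: A_of_PV_add (MB _ Mc) (A_of_PV_mul Bb Bf).
  - by exists 0, 0; rewrite cmul0l addr0; split=> //; exact: A_of_PV0.
  - move=> _ _ [c [b [Mc Bb ->]]] [c' [b' [Mc' Bb' ->]]].
    exists (c - c'), (b - b'); split; [exact: Msub|exact: A_of_PV_sub|].
    by rewrite cmulBl opprD addrACA.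
  - move=> d _ Bd [c [b [Mc Bb ->]]]; exists (cmul d c), (cmul d b).
    by rewrite cmulDr cmulA; split=> //; [exact: Mmul|exact: A_of_PV_mul].
have MJ : M `<=` J.
  by move=> v Mv; exists v, 0; rewrite cmul0l addr0; split=> //; exact: A_of_PV0.
have Jf : J f by exists 0, 1u; rewrite cmul1u add0r; split=> //; exact: unit_in_A_of_PV.
have [JM|JeB] := Mmax J JB MJ; first by apply: nMf; rewrite -JM.
have : J 1u by rewrite JeB; exact: unit_in_A_of_PV.
move=> [c [b [Mc Bb e]]]; apply: MneB; apply/seteqP; split=> // v Bv.
suff M1 : M 1u by rewrite -[v]cmulu1; exact: Mmul.
have cE : c = 1u - cmul b f by rewrite e addrK.
have -> : 1u = cmul (1u + cmul b f) c.
  rewrite cE cmulBr cmulu1 cmulDl cmul1u -cmulA fbf//.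
  have -> : cmul b 0 = 0 by have := cmulBr (0 : A) 0 b; rewrite !subrr.
  by rewrite addr0 addrK.
by apply: Mmul Mc; apply: A_of_PV_add unit_in_A_of_PV _; exact: A_of_PV_mul.
Qed.

Lemma lt_in_spectrum g : infword_lt (grange g) (gsource g) ->
  spectrum iota (jacobson_radical B) g.
Proof.
move=> [m [e lt]]; have [a [b [c [ra da sb]]]] := cuntzP g.
have : tailrel (m.+1 + size a) (m.+1 + size b) g.
  by apply: tailrelD; split=> //; rewrite ra sb !wtail_wcat.
move=> /tailrel_cyl tg.
set i := (m.+1 + _)%N in tg; set j := (m.+1 + size b)%N in tg.
have mi : (m < i)%N by rewrite /i; lia.
have mj : (m < j)%N by rewrite /j; lia.
set ab := (mkseq _ _, mkseq _ _) in tg.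
(* The words decide the order, whatever tails follow; in particular the whole cylinder lies in
   P_V. *)
have ltab (z z' : X) : infword_lt (wcat ab.1 z) (wcat ab.2 z').
  exists m; have E k : (k <= m)%N -> wcat ab.1 z k = grange g k /\ wcat ab.2 z' k = gsource g k.
    move=> km; split.
      by rewrite (@wcatL _ _ z (wtail i (grange g))) ?wcat_mkseq// size_mkseq (leq_ltn_trans km).
    by rewrite (@wcatL _ _ z' (wtail j (gsource g))) ?wcat_mkseq// size_mkseq (leq_ltn_trans km).
  split=> [k km|]; first by have [-> ->] := E k (ltnW km); exact: e.
  by have [-> ->] := E m (leqnn m).
exists (iota (chi ab)); last first.
  by rewrite as_fun_chi /chi; case: asboolP => //; rewrite oner_eq0.
apply: square_zero_radical => [h|b' Bb'].
  move=> nP; apply/eqP; apply: contra_notT nP; rewrite as_fun_chi.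
  move=> /chi_neq0[z [rh _ sh]]; apply: infword_lt_PV; rewrite rh sh; exact: ltab.
apply: (as_fun_inj x0 hA) => h; apply/eqP; apply: contraT.
move=> /as_fun_mul_supp[g1 [g' [[e1 _ _ _]]]]; rewrite as_fun_chi => /chi_neq0[z1 [_ _ s1]].
move=> /as_fun_mul_supp[g2 [g3 [[e2 re _ _] /(A_of_PVP Bb')/PV_elim P2]]].
rewrite as_fun_chi => /chi_neq0[z3 [r3 _ _]].
(* The middle factor would go from the range side of the cylinder to its source side, strictly
   against the order of P_V. *)
have lt2 : infword_lt (gsource g2) (grange g2).
  by rewrite e2 r3 -re -e1 s1; exact: ltab.
case: P2 => [lt2'|[e2' _]].
  by have := infword_lt_irr (infword_lt_trans lt2 lt2').
by move: lt2; rewrite e2' => /infword_lt_irr.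
Qed.

(** The kernel has codimension one in the algebra: any e outside it spans a complement, so a left
    ideal containing the kernel and e is everything. *)
Lemma radical_character (rho : A -> R[i]) :
  (forall a b, rho (a - b) = rho a - rho b) ->
  (forall c a, rho (c *: a) = c * rho a) ->
  (forall a b, B a -> B b -> rho (cmul a b) = rho a * rho b) ->
  rho 1u = 1 -> forall a, jacobson_radical B a -> rho a = 0.
Proof.
move=> rB rZ rM r1 a [Ba rad].
have r0 : rho 0 = 0 by rewrite -(scale0r (0 : A)) rZ mul0r.
pose K : set A := [set v | B v /\ rho v = 0].
suff : K a by case.
apply: rad; split.
- split.
  + by move=> v [].
  + by split=> //; exact: A_of_PV0.
  + by move=> u v [Bu ru] [Bv rv]; split; [exact: A_of_PV_sub|rewrite rB ru rv subrr].
  + by move=> u v Bu [Bv rv]; split; [exact: A_of_PV_mul|rewrite rM// rv mulr0].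
- move=> KB; have : K 1u by rewrite KB; exact: unit_in_A_of_PV.
  by move=> [_]; rewrite r1 => /eqP; rewrite oner_eq0.
- move=> J [JB J0 Jsub Jmul] KJ; have [JK|/existsNP[e]] := pselect (J `<=` K).
    by left; apply/seteqP.
  move=> /not_implyP[Je nKe]; right; apply/seteqP; split=> // v Bv.
  have re : rho e != 0 by apply/eqP => re; apply: nKe; split=> //; exact: JB.
  (* The sum is written as a difference because left ideals are given as closed under
     subtraction. *)
  have E : v = (v - (rho v / rho e) *: e) - (0 - (rho v / rho e) *: e).
    by rewrite sub0r opprK subrK.
  have Jce : J ((rho v / rho e) *: e).
    rewrite -[e in X in J X]cmul1u -cmulZl; apply: Jmul => //.
    by apply: A_of_PV_scale; exact: unit_in_A_of_PV.
  rewrite E; apply: (Jsub) => //; last exact: Jsub.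
  apply: KJ; split; first by apply: A_of_PV_sub => //; exact: JB.
  by rewrite rB rZ divfK// subrr.
Qed.

(** * Power series functionals at isotropy points *)

Section isotropy_characters.
Context (x : X) (s : int) (s_pm1 : s = 1 \/ s = -1).
Context (PV_isotropy : forall g, PV g -> grange g = x -> gsource g = x ->
  exists k : nat, gdeg g = s * k%:Z).

(* Over (x,x), elements of A(P_V) live in degrees s * k with k natural, and
   convolution restricts to the Cauchy product of the sequences icoef. *)
Definition icoef a (k : nat) : R[i] := evg (afun a) x (s * k%:Z) x.

Lemma icoef_le a k : cabs (icoef a k) <= rnorm a.
Proof.
rewrite /icoef /evg; case: pselect => [h|_]; first exact: (as_fun_le x0 hA).
by rewrite rnorm0 rnorm_ge0.
Qed.

Lemma icoefB a b k : icoef (a - b) k = icoef a k - icoef b k.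
Proof.
by rewrite /icoef /evg; case: pselect => [h|_]; rewrite ?(as_funB x0 hA)// subr0.
Qed.

Lemma icoefZ c a k : icoef (c *: a) k = c * icoef a k.
Proof.
by rewrite /icoef /evg; case: pselect => [h|_]; rewrite ?(as_funZ x0 hA)// mulr0.
Qed.

Lemma icoef1 k : icoef 1u k = if k == 0%N then 1 else 0.
Proof.
rewrite /icoef /evg; case: pselect => [h|nh].
  rewrite as_fun_unit /=; case: eqP => [->|k0]; case: asboolP => //.
    by rewrite mulr0; case.
  by move=> [_ e]; exfalso; move: e k0; case: s_pm1 => ->; lia.
case: eqP => // k0; exfalso; apply: nh; rewrite k0 mulr0; exact: in_cuntz_refl.
Qed.

Lemma smul_inj (i j : int) : s * i = s * j -> i = j.
Proof. by case: s_pm1 => ->; rewrite ?mul1r// !mulN1r => /oppr_inj. Qed.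

(** An intermediate point z satisfies x <= z <= x, so z = x, and both degrees are natural multiples
    of s; this leaves k + 1 terms. If (x, s k, x) is not in G_n, no product of coefficients survives
    either. *)
Lemma icoefM a b k : B a -> B b ->
  icoef (cmul a b) k = \sum_(i < k.+1) icoef a i * icoef b (k - i).
Proof.
move=> Ba Bb; rewrite {1}/icoef /evg; case: pselect => [h|nh]; last first.
  rewrite big1// => i _; apply/eqP; apply: contra_notT nh; rewrite mulf_eq0 negb_or => /andP[].
  rewrite /icoef => /evg_neq0[g1 [r1 d1 s1 _]] /evg_neq0[g2 [r2 d2 s2 _]].
  have -> : s * k%:Z = gdeg g1 + gdeg g2.
    by rewrite d1 d2 -mulrDr; congr (s * _); have := ltn_ord i; lia.
  apply: (@in_cuntzD _ _ _ x); first by rewrite -{1}r1 -s1; exact: cuntzP.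
  by rewrite -{1}r2 -s2; exact: cuntzP.
pose phi (i : nat) : I := (0 - s * i%:Z, x).
pose r := [seq phi i | i <- seq.iota 0 k.+1].
have ur : uniq r.
  by rewrite map_inj_uniq ?iota_uniq// => i j [/addrI/oppr_inj/smul_inj []].
rewrite (as_fun_mul x0 hA (s := [fset q | q in r]%fset)); last first.
  move=> q /convmx_neq0[g1 [/= r1 -> /(A_of_PVP Ba) P1]].
  move=> /convmx_neq0[g2 [/= r2 [] d2 s2 /(A_of_PVP Bb) P2]].
  have sx : gsource g1 = x.
    have [lt1|[e1 _]] := PV_elim P1; last by rewrite -e1.
    have [lt2|[e2 _]] := PV_elim P2; last by rewrite -r2 e2.
    exfalso; apply: (@infword_lt_irr _ x); rewrite r1 in lt1; rewrite r2 -s2 in lt2.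
    exact: infword_lt_trans lt1 lt2.
  have [i ei] := PV_isotropy P1 r1 sx.
  have [|j ej] := PV_isotropy P2 _ (esym s2); first by rewrite r2.
  rewrite mem_fset_seq; apply/mapP; exists i; last by rewrite /phi ei sx.
  rewrite mem_iota add0n ltnS; have : s * k%:Z = s * (i%:Z + j%:Z).
    by rewrite mulrDr -ei -ej; lia.
  by move=> /smul_inj; lia.
rewrite (perm_big r); last first.
  by apply: uniq_perm => // [|q]; [exact: fset_uniq|rewrite mem_fset_seq].
rewrite /r big_map -(big_mkord xpredT (fun i => icoef a i * icoef b (k - i))) /index_iota subn0.
apply: eq_big_seq => i; rewrite mem_iota add0n ltnS => /= ik; rewrite /convmx /icoef /phi /=.
have -> : 0 - (0 - s * i%:Z) = s * i%:Z by rewrite !sub0r opprK.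
have -> : 0 - s * i%:Z - (0 - s * k%:Z) = s * (k - i)%:Z.
  by rewrite -subzn// mulrBr !sub0r opprK addrC.
by [].
Qed.

Section character.
Context (w : R) (w0 : 0 < w) (w8 : w <= 8^-1).

(** Partial sums are taken as polynomials so that the error of a Cauchy product can be read off
    coefficientwise. *)
Definition ipoly a N : {poly R[i]} := \poly_(i < N) icoef a i.
Definition isum a N : R[i] := (ipoly a N).[w%:C].

Lemma isumE a N : isum a N = \sum_(i < N) icoef a i * w%:C ^+ i.
Proof. by rewrite /isum horner_poly. Qed.

Lemma cabs_wX i : cabs (w%:C ^+ i : R[i]) = w ^+ i.
Proof. by rewrite cabsX cabsR// ltW. Qed.

Lemma w_small N : w ^+ N <= N.+1%:R^-1.
Proof.
apply: le_trans (_ : 2^-1 ^+ N <= _).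
  apply: lerXn2r; rewrite ?nnegrE ?invr_ge0 ?(ltW w0)//; apply: le_trans w8 _.
  by rewrite lef_pV2 ?posrE// ler_nat.
by rewrite exprVn lef_pV2 ?posrE ?exprn_gt0// -natrX ler_nat ltn_expl.
Qed.

(** The geometric bound is kept as the difference w^N - w^m so that the induction on m telescopes;
    the factor 2 suffices because w <= 1/2. *)
Lemma isum_tail a N m : (N <= m)%N ->
  cabs (isum a m - isum a N) <= 2 * rnorm a * (w ^+ N - w ^+ m).
Proof.
move=> /subnK <-; elim: (m - N)%N => [|k IH]; first by rewrite add0n !subrr rnorm0 mulr0.
rewrite addSn; set M := (k + N)%N in IH *.
have -> : isum a M.+1 - isum a N = (isum a M - isum a N) + icoef a M * w%:C ^+ M.
  by rewrite !isumE big_ord_recr /= addrAC.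
apply: le_trans (ler_rnormD _ _) _; rewrite cabsM cabs_wX.
have h1 : cabs (icoef a M) * w ^+ M <= rnorm a * w ^+ M.
  by rewrite ler_wpM2r ?icoef_le// exprn_ge0// ltW.
have h2 : rnorm a * w ^+ M <= 2 * rnorm a * (w ^+ M - w ^+ M.+1).
  have wM : 0 <= w ^+ M by rewrite exprn_ge0// ltW.
  have hw : w * w ^+ M <= 8^-1 * w ^+ M by rewrite ler_wpM2r.
  have h : w ^+ M <= 2 * (w ^+ M - w ^+ M.+1) by rewrite exprS; lra.
  have := ler_wpM2l (rnorm_ge0 a) h; rewrite mulrA [rnorm a * 2]mulrC.
  by [].
lra.
Qed.

Lemma ichar_exists a : exists l : R[i]^o, (isum a : nat -> R[i]^o) @ \oo --> l.
Proof.
apply: complex_cauchy_cvg => e e0.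
pose D := 2 * rnorm a + 1; have D0 : 0 < D by rewrite ltr_pwDr// mulr_ge0// rnorm_ge0.
have [N HN] := ltr_inv_nat (divr_gt0 e0 D0).
exists (isum a N); exists N => // m /= Nm; rewrite rnormB.
apply: le_trans (isum_tail a Nm) _.
have wN : w ^+ N <= e / D := le_trans (w_small N) (HN N (leqnn N)).
have wm : 0 <= w ^+ m by rewrite exprn_ge0// ltW.
have wN0 : 0 <= w ^+ N by rewrite exprn_ge0// ltW.
apply: (@le_trans _ _ (D * w ^+ N)).
  by rewrite /D; have := rnorm_ge0 a; nra.
by rewrite mulrC -ler_pdivlMr.
Qed.

Definition ichar a : R[i]^o := projT1 (cid (ichar_exists a)).

Lemma ichar_cvg a : (isum a : nat -> R[i]^o) @ \oo --> ichar a.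
Proof. exact: projT2 (cid (ichar_exists a)). Qed.

Lemma ichar_unique a (l : R[i]^o) : (isum a : nat -> R[i]^o) @ \oo --> l -> ichar a = l.
Proof.
move=> h; transitivity (lim ((isum a : nat -> R[i]^o) @ \oo) : R[i]^o); last first.
  by apply: (@cvg_lim R[i]^o).
by apply/esym; apply: (@cvg_lim R[i]^o) => //; exact: ichar_cvg.
Qed.

Lemma icharB a b : ichar (a - b) = ichar a - ichar b.
Proof.
apply: ichar_unique.
have -> : isum (a - b) = (fun N => isum a N - isum b N : R[i]^o).
  apply/funext => N; rewrite !isumE -sumrB; apply: eq_bigr => i _.
  by rewrite icoefB mulrBl.
by apply: (@cvgB _ R[i]^o); exact: ichar_cvg.
Qed.

Lemma icharZ c a : ichar (c *: a) = c * ichar a.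
Proof.
apply: ichar_unique.
have -> : isum (c *: a) = (fun N => c * isum a N : R[i]^o).
  apply/funext => N; rewrite !isumE mulr_sumr; apply: eq_bigr => i _.
  by rewrite icoefZ mulrA.
by apply: (@cvgM R[i]); [exact: cvg_cst|exact: ichar_cvg].
Qed.

Lemma ichar1 : ichar 1u = 1.
Proof.
apply: ichar_unique; apply/rnorm_seqP => e e0; exists 1%N => -[//|m] _.
rewrite isumE big_ord_recl big1 => [|i _]; last by rewrite icoef1 mul0r.
by rewrite icoef1 mul1r expr0 addr0 subrr rnorm0 ltW.
Qed.

(** The product of the truncations agrees with the truncation of the product below degree N. The at
    most N coefficients above are bounded by 2 N |a| |b|, an error of 2 N^2 |a| |b| w^N. With N^2 <=
    4^N, the bound w <= 1/8 leaves 2^-N, at most 1/(N + 1). *)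
Lemma isumM a b N : B a -> B b ->
  cabs (isum a N * isum b N - isum (cmul a b) N) <= 2 * rnorm a * rnorm b * N.+1%:R^-1.
Proof.
move=> Ba Bb; rewrite /isum -hornerM -hornerN -hornerD.
set P := ipoly a N * ipoly b N - _.
have cP (k : nat) : (k < N)%N -> P`_k = 0.
  move=> kN; rewrite coefB coefM [X in _ - X]coef_poly kN icoefM//.
  apply/eqP; rewrite subr_eq0; apply/eqP/eq_bigr => i _.
  have ik : (i <= k)%N by have := ltn_ord i; rewrite ltnS.
  by rewrite !coef_poly (leq_ltn_trans ik kN) (leq_ltn_trans (leq_subr _ _) kN).
have lP k : (N <= k)%N -> (k < N + N)%N -> cabs P`_k <= (N + N)%:R * (rnorm a * rnorm b).
  move=> Nk kN; rewrite coefB coefM [X in _ - X]coef_poly ltnNge Nk /= subr0.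
  apply: le_trans (ler_rnorm_sum _ _) _.
  apply: le_trans (_ : \sum_(i < k.+1) rnorm a * rnorm b <= _).
    apply: ler_sum => i _; rewrite cabsM; apply: ler_pM; rewrite ?rnorm_ge0//.
      by rewrite coef_poly; case: ifP => _; rewrite ?icoef_le// rnorm0 rnorm_ge0.
    by rewrite coef_poly; case: ifP => _; rewrite ?icoef_le// rnorm0 rnorm_ge0.
  rewrite sumr_const card_ord -[leLHS]mulr_natl ler_wpM2r ?mulr_ge0 ?rnorm_ge0//.
  by rewrite ler_nat.
have sP : (size P <= N + N)%N.
  have sa c : (size (ipoly c N) <= N)%N by exact: size_poly.
  apply: leq_trans (size_polyD _ _) _; rewrite size_polyN geq_max.
  apply/andP; split; last by apply: leq_trans (sa _) _; rewrite leq_addr.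
  apply: leq_trans (size_polyMleq _ _) _.
  by apply: leq_trans (leq_pred _) _; apply: leq_add.
rewrite (horner_coef_wide _ sP); apply: le_trans (ler_rnorm_sum _ _) _.
set D := rnorm a * rnorm b; have D0 : 0 <= D by rewrite mulr_ge0 ?rnorm_ge0.
rewrite big_split_ord /= [X in X + _]big1 ?add0r; last first.
  by move=> i _; rewrite cP ?mul0r ?rnorm0.
apply: le_trans (_ : \sum_(i < N) ((N + N)%:R * D * w ^+ N) <= _).
  apply: ler_sum => i _; rewrite cabsM cabs_wX; apply: ler_pM; rewrite ?rnorm_ge0//.
  - by rewrite exprn_ge0// ltW.
  - by apply: lP; rewrite ?leq_addr// ltn_add2l.
  - rewrite exprD ler_piMr ?exprn_ge0 ?(ltW w0)// exprn_ile1 ?(ltW w0)//.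
    by apply: le_trans w8 _; rewrite invf_le1// ler1n.
rewrite sumr_const card_ord -[leLHS]mulr_natl -[2 * _ * _]mulrA -/D.
have N4 : (N%:R * N%:R : R) <= 4 ^+ N.
  rewrite -natrM -natrX ler_nat (_ : 4 ^ N = 2 ^ N * 2 ^ N)%N ?leq_mul ?(ltnW (ltn_expl _ _))//.
  by rewrite -expnMn.
have wN : w ^+ N <= 8^-1 ^+ N by apply: lerXn2r; rewrite ?nnegrE ?invr_ge0 ?(ltW w0).
have h2 : (4 ^+ N : R) * 8^-1 ^+ N <= N.+1%:R^-1.
  rewrite -exprMn (_ : 4 * 8^-1 = 2^-1 :> R); last by field.
  by rewrite exprVn lef_pV2 ?posrE ?exprn_gt0// -natrX ler_nat ltn_expl.
have h3 : N%:R * N%:R * w ^+ N <= N.+1%:R^-1 :> R.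
  by apply: le_trans h2; apply: ler_pM; rewrite ?mulr_ge0 ?exprn_ge0 ?(ltW w0).
rewrite natrD.
have -> : N%:R * ((N%:R + N%:R) * D * w ^+ N) = 2 * D * (N%:R * N%:R * w ^+ N) by ring.
by rewrite ler_wpM2l// mulr_ge0.
Qed.

Lemma icharM a b : B a -> B b -> ichar (cmul a b) = ichar a * ichar b.
Proof.
move=> Ba Bb; apply: ichar_unique.
have c : (fun N => isum a N * isum b N : R[i]^o) @ \oo --> (ichar a * ichar b : R[i]^o).
  by apply: (@cvgM R[i]); exact: ichar_cvg.
move: c => /rnorm_seqP c; apply/rnorm_seqP => e e0.
have e20 : 0 < e / 2 by rewrite divr_gt0.
have [N HN] := c _ e20.
pose D := 2 * rnorm a * rnorm b + 1.
have D0 : 0 < D by rewrite ltr_pwDr// !mulr_ge0// rnorm_ge0.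
have [N' HN'] := ltr_inv_nat (divr_gt0 e20 D0).
exists (N + N')%N => m Nm.
rewrite -(subrK (isum a m * isum b m) (ichar a * ichar b)) -addrA (splitr e).
apply: le_trans (ler_rnormD _ _) _; apply: lerD.
  by apply: HN; apply: leq_trans Nm; rewrite leq_addr.
apply: le_trans (isumM m Ba Bb) _.
have h := HN' m (leq_trans (leq_addl _ _) Nm).
have m0 : 0 <= m.+1%:R^-1 :> R by rewrite invr_ge0.
apply: (@le_trans _ _ (D * m.+1%:R^-1)); first by rewrite ler_wpM2r// /D lerDl.
by rewrite mulrC -ler_pdivlMr.
Qed.

Lemma ichar_dist a N : cabs (ichar a - isum a N) <= 2 * rnorm a * w ^+ N.
Proof.
have c : (fun m => cabs (isum a m - isum a N)) @ \oo --> cabs (ichar a - isum a N).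
  by apply: cvg_rnorm; apply: (@cvgB _ R[i]^o); [exact: ichar_cvg|exact: cvg_cst].
apply: (cvg_le_bound _ c); exists N => // m /= Nm.
apply: le_trans (isum_tail a Nm) _; rewrite ler_wpM2l ?mulr_ge0 ?rnorm_ge0//.
by rewrite lerBlDr lerDl exprn_ge0// ltW.
Qed.

Lemma ichar_radical a : jacobson_radical B a -> ichar a = 0.
Proof.
exact: (radical_character icharB icharZ icharM ichar1).
Qed.

End character.

(** Strong induction on k. Once the lower coefficients vanish, the vanishing of the functional gives
    |c_k| w^k <= 2 |a| w^(k+1), so |c_k| <= 2 |a| w for every small w. *)
Lemma icoef_radical a k : jacobson_radical B a -> icoef a k = 0.
Proof.
move=> ra; elim/ltn_ind: k => k IH.
apply: (@small_eq0 _ R[i]^o _ (2 * rnorm a)); first by rewrite mulr_ge0// rnorm_ge0.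
(* Dividing by 8 turns e <= 1 into the bound required of w. *)
move=> e e0 e1; pose w := e / 8.
have w0 : 0 < w by rewrite divr_gt0.
have w8 : w <= 8^-1 by rewrite /w ler_piMl ?invr_ge0.
have := ichar_dist w0 w8 a k.+1; rewrite (ichar_radical w0 w8 ra) sub0r rnormN.
rewrite isumE big_ord_recr /= big1 ?add0r; last by move=> i _; rewrite IH// mul0r.
rewrite cabsM cabs_wX// exprSr mulrA [leRHS]mulrAC -subr_ge0 -mulrBl.
rewrite pmulr_lge0 ?exprn_gt0// subr_ge0 => /le_trans; apply.
have we : w <= e by rewrite /w; lra.
by rewrite ler_wpM2l ?mulr_ge0 ?rnorm_ge0.
Qed.

End isotropy_characters.

Lemma radical_vanish a g : jacobson_radical B a -> PV g -> grange g = gsource g ->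
  afun a g = 0.
Proof.
move=> ra Pg e; pose x := grange g.
(* If x ends neither in 1's nor in n's, only degree 0 occurs in P_V over (x, x), and the sign 1 is
   as good as any. *)
pose s : int := if `[< ev_const (fun k => k.+1 == n) x >] then -1 else 1.
have s1 : s = 1 \/ s = -1 by rewrite /s; case: asboolP; [right|left].
have iso h : PV h -> grange h = x -> gsource h = x -> exists k : nat, gdeg h = s * k%:Z.
  move=> /PV_elim[lt rx sx|[_ ok] rx sx].
    by exfalso; move: lt; rewrite rx sx; exact: infword_lt_irr.
  exists `|gdeg h|%N; rewrite /s; rewrite /isotropy_ok rx in ok.
  case: ok => [->|[d0 c0]|[d0 c0]]; first by rewrite mulr0.
    by case: asboolP => [/(ev_const_excl n2 c0)//|_]; rewrite mul1r gez0_abs// ltW.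
  by case: asboolP => // _; rewrite mulN1r lez0_abs ?opprK// ltW.
have [k dk] := iso g Pg erefl (esym e).
have := icoef_radical s1 iso k ra.
rewrite /icoef -dk => <-.
by have := evgE (afun a) g; rewrite -e.
Qed.

End radical.

Theorem proposition6 (R : realType) (n : nat) (hn : (2 <= n)%N)
    (A : cstarAlg R) (iota : (cuntz n -> R[i]^o) -> A)
    (hA : is_groupoid_cstar iota) :
  spectrum iota (jacobson_radical (A_of iota (@PV n)))
  = [set g : cuntz n | infword_lt (grange g) (gsource g)].
Proof.
have n0 : (0 < n)%N by exact: ltnW.
have x0 : infword n := fun=> Ordinal n0.
apply/seteqP; split=> [g [a ra ag]|g]; last exact: lt_in_spectrum.
have Pg : PV g by case: ra => Ba _; exact: A_of_PVP Ba ag.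
have [//|[e _]] := PV_elim Pg.
by move: ag; rewrite (radical_vanish hn x0 hA ra Pg e) eqxx.
Qed.
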